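(* Suppose $\kappa>\omega$ is inaccessible and $\xi<\kappa^+$. There is a $\Pi^1_{\xi+1}$ formula $\Phi^\kappa_\xi(Z)$ over $V_\kappa$ (with free second-order variable $Z$) and a club $C\subseteq\kappa$ such that for all $S\subseteq\kappa$ we have \[S\text{ is a }\Pi^1_\xi\text{-indescribable subset of }\kappa\text{ if and only if }V_\kappa\models\Phi^\kappa_\xi(S)\] and for all regular $\alpha\in C$ we have \[S\cap\alpha\text{ is a }\Pi^1_{f^\kappa_\xi(\alpha)}\text{-indescribable subset of }\alpha\text{ if and only if }V_\alpha\models\Phi^\kappa_\xi(S)|^\kappa_\alpha.\]
   Context: Canonical functions. For every regular cardinal $\kappa$ and every ordinal $\xi$ with $\kappa\le\xi<\kappa^+$ fix a bijection $b_{\kappa,\xi}:\kappa\to\xi$, with $b_{\kappa,\kappa}=\mathrm{id}_\kappa$. For $\xi<\kappa^+$ and $\alpha<\kappa$ let $F^\kappa_\xi(\alpha)=\xi$ if $\xi<\kappa$, and $F^\kappa_\xi(\alpha)=b_{\kappa,\xi}[\alpha]$ if $\kappa\le\xi<\kappa^+$. Let $f^\kappa_\xi(\alpha)=\mathrm{ot}(F^\kappa_\xi(\alpha))$ and let $\pi^\kappa_{\xi,\alpha}:F^\kappa_\xi(\alpha)\to f^\kappa_\xi(\alpha)$ be the transitive collapse. Formulas. A formula is $\Pi^1_0$ (equivalently $\Sigma^1_0$) over $V_\kappa$ if it is a first-order formula of set theory (only first-order quantifiers) in which free variables and parameters of two types may occur: first-order ones (ranging over, resp. being, elements of $V_\kappa$)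 and second-order ones (ranging over, resp. being, subsets of $V_\kappa$). It is $\Pi^1_{\xi+1}$ over $V_\kappa$ if it has the form $\forall X_{k_1}\cdots\forall X_{k_m}\psi$ with $\psi$ a $\Sigma^1_\xi$ formula over $V_\kappa$, and $\Sigma^1_{\xi+1}$ if it has the form $\exists X_{k_1}\cdots\exists X_{k_m}\psi$ with $\psi$ a $\Pi^1_\xi$ formula over $V_\kappa$ ($m\in\omega$; second-order quantifiers). For $\xi$ a limit, a formula with finitely many second-order free variables and finitely many second-order parameters is $\Pi^1_\xi$ over $V_\kappa$ if it has the form $\bigwedge_{\zeta<\xi}\varphi_\zeta$ with each $\varphi_\zeta$ being $\Pi^1_\zeta$ over $V_\kappa$, and $\Sigma^1_\xi$ if it has the form $\bigvee_{\zeta<\xi}\varphi_\zeta$ with each $\varphi_\zeta$ being $\Sigma^1_\zeta$ over $V_\kappa$. Restriction. For $\varphi$ a $\Pi^1_\xi$ or $\Sigma^1_\xi$ formula over $V_\kappa$, $\xi<\kappa^+$, and $\alpha<\kappa$ regular, $\varphi|^\kappa_\alpha$ is defined by recursion on $\xi$. If $\xi<\kappa$, replace each second-order parameter $A_i$ by $A_i\cap V_\alpha$. If $\xi=\zeta+1\geq\kappa$, the restriction of $\forall\vec X\psi$ is $\forall\vec X(\psi|^\kappa_\alpha)$ and that of $\exists\vec X\psi$ is $\exists\vec X(\psi|^\kappa_\alpha)$. If $\xi\ge\kappa$ is a limit and $\varphi=\bigwedge_{\zeta<\xi}\psi_\zeta$, then $\varphi|^\kappa_\alpha=\bigwedge_{\zeta<f^\kappa_\xi(\alpha)}\psi_{(\pi^\kappa_{\xi,\alpha})^{-1}(\zeta)}|^\kappa_\alpha$,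 provided $\psi_{(\pi^\kappa_{\xi,\alpha})^{-1}(\zeta)}|^\kappa_\alpha$ is a $\Pi^1_\zeta$ formula over $V_\alpha$ for every $\zeta<f^\kappa_\xi(\alpha)$; otherwise undefined. Similarly for $\Sigma^1_\xi$ with $\bigvee$. Indescribability. For a cardinal $\kappa$ and $\xi<\kappa^+$, a set $S\subseteq\kappa$ is $\Pi^1_\xi$-indescribable (in $\kappa$) if for every $\Pi^1_\xi$ sentence $\varphi$ over $V_\kappa$ (parameters allowed), if $V_\kappa\models\varphi$ then there is some $\alpha\in S$ with $V_\alpha\models\varphi|^\kappa_\alpha$ (which includes that $\varphi|^\kappa_\alpha$ is defined and is a formula over $V_\alpha$). *)

(* Defs.v *)
From Stdlib Require Import List Arith Wellfounded ClassicalEpsilon FunctionalExtensionality.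
From Stdlib Require Finite_sets.

Set Implicit Arguments.
Unset Strict Implicit.

(** The ambient universe of sets is an arbitrary model of ZFC, with separation
    and replacement for all predicates and functions of the metatheory. *)

Record ZFC : Type := {
  carrier :> Type;
  mem : carrier -> carrier -> Prop;
  empty : carrier;
  pair : carrier -> carrier -> carrier;
  union : carrier -> carrier;
  power : carrier -> carrier;
  sep : (carrier -> Prop) -> carrier -> carrier;
  repl : (carrier -> carrier) -> carrier -> carrier;
  infinite : carrier;
  extensionality : forall x y, (forall z, mem z x <-> mem z y) -> x = y;
  foundation : well_founded mem;
  emptyP : forall x, ~ mem x empty;
  pairP : forall x y z, mem z (pair x y) <-> z = x \/ z = y;
  unionP : forall x z, mem z (union x) <-> exists y, mem y x /\ mem z y;
  powerP : forall x z, mem z (power x) <-> (forall w, mem w z -> mem w x);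
  sepP : forall P x z, mem z (sep P x) <-> mem z x /\ P z;
  replP : forall F x z, mem z (repl F x) <-> exists y, mem y x /\ z = F y;
  infiniteP : mem empty infinite /\
    forall x, mem x infinite -> mem (union (pair x (pair x x))) infinite;
  choice : forall x,
    (forall y, mem y x -> exists z, mem z y) ->
    (forall y y', mem y x -> mem y' x -> (exists z, mem z y /\ mem z y') -> y = y') ->
    exists c, forall y, mem y x -> exists! z, mem z y /\ mem z c
}.

Arguments empty {_}.
Arguments infinite {_}.

Declare Scope zfc_scope.
Delimit Scope zfc_scope with zfc.
Notation "x ∈ y" := (mem x y) (at level 70, no associativity) : zfc_scope.
Notation "x ⊆ y" := (forall w, mem w x -> mem w y)
  (at level 70, no associativity) : zfc_scope.
Notation "x ∩ y" := (sep (fun w => mem w y) x)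
  (at level 40, left associativity) : zfc_scope.
Open Scope zfc_scope.

Section SetTheory.
Variable M : ZFC.
Implicit Types (x y z X Y κ α ξ ζ : M).

(** ** Ordinals and cardinals *)

Definition transitive x : Prop := forall y, y ∈ x -> y ⊆ x.
Definition ordinal x : Prop := transitive x /\ forall y, y ∈ x -> transitive y.
Definition succ x : M := union (pair x (pair x x)).
Definition limit x : Prop :=
  ordinal x /\ x <> empty /\ forall y, y ∈ x -> succ y ∈ x.

Definition inductive x : Prop := empty ∈ x /\ forall y, y ∈ x -> succ y ∈ x.
Definition omega : M := sep (fun n => forall x, inductive x -> n ∈ x) infinite.

Definition bijection (F : M -> M) X Y : Prop :=
  (forall x, x ∈ X -> F x ∈ Y) /\
  (forall x x', x ∈ X -> x' ∈ X -> F x = F x' -> x = x') /\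
  (forall y, y ∈ Y -> exists x, x ∈ X /\ F x = y).

Definition cardinal κ : Prop :=
  ordinal κ /\ forall β, β ∈ κ -> ~ exists F, bijection F β κ.

Definition regular κ : Prop :=
  cardinal κ /\ limit κ /\
  forall β (F : M -> M), β ∈ κ -> (forall δ, δ ∈ β -> F δ ∈ κ) ->
    exists γ, γ ∈ κ /\ forall δ, δ ∈ β -> F δ ∈ γ.

(** Regular and strong limit, the latter expressed as: for every [β < κ], [P(β)]
    is equinumerous with an element of [κ].  Uncountability is not included. *)
Definition inaccessible κ : Prop :=
  regular κ /\
  forall β, β ∈ κ -> exists γ F, γ ∈ κ /\ bijection F γ (power β).

Definition is_card_succ κ κ' : Prop :=
  cardinal κ' /\ κ ∈ κ' /\ forall μ, cardinal μ -> κ ∈ μ -> κ' ⊆ μ.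

(** [ξ < κ⁺] *)
Definition below_card_succ ξ κ : Prop :=
  exists κ', is_card_succ κ κ' /\ ξ ∈ κ'.

Definition club C κ : Prop :=
  C ⊆ κ /\
  (forall β, β ∈ κ -> exists γ, γ ∈ C /\ β ∈ γ) /\
  (forall δ, δ ∈ κ -> limit δ ->
     (forall β, β ∈ δ -> exists γ, γ ∈ C /\ γ ∈ δ /\ β ∈ γ) -> δ ∈ C).

(** ** Recursion on membership *)

(** [G x r] may only depend on the values of [r] on elements of [x]; outside of
    [x], [r] is [empty]. *)
Definition mem_rec (G : M -> (M -> M) -> M) : M -> M :=
  Fix (@foundation M) (fun _ => carrier M)
    (fun x r => G x (fun y =>
       match excluded_middle_informative (y ∈ x) with
       | left h => r y h
       | right _ => empty
       end)).

Lemma mem_rec_eq G x :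
  mem_rec G x = G x (fun y =>
    if excluded_middle_informative (y ∈ x) then mem_rec G y else empty).
Proof.
unfold mem_rec at 1. rewrite Fix_eq.
- apply f_equal. apply functional_extensionality. intro y.
  destruct (excluded_middle_informative (y ∈ x)); reflexivity.
- intros u f g Hfg. apply f_equal. apply functional_extensionality. intro y.
  destruct (excluded_middle_informative (y ∈ u)); auto.
Qed.

Lemma repl_ext (F F' : M -> M) x :
  (forall y, y ∈ x -> F y = F' y) -> repl F x = repl F' x.
Proof.
intro H. apply extensionality. intro z. rewrite !replP.
split; intros [y [Hy ->]]; exists y; split; auto; symmetry; auto.
Qed.

(** The cumulative hierarchy. *)
Definition Vh : M -> M :=
  mem_rec (fun α r => union (repl (fun β => power (r β)) α)).

Lemma Vh_eq α : Vh α = union (repl (fun β => power (Vh β)) α).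
Proof.
unfold Vh at 1. rewrite mem_rec_eq. apply f_equal. apply repl_ext. intros y Hy.
destruct (excluded_middle_informative (y ∈ α)); [reflexivity | contradiction].
Qed.

(** The transitive collapse of [(X, ∈)] and, for sets of ordinals, the order type. *)
Definition collapse X : M -> M := mem_rec (fun x r => repl r (x ∩ X)).
Definition ot X : M := repl (collapse X) X.

Lemma collapse_eq X x : collapse X x = repl (collapse X) (x ∩ X).
Proof.
unfold collapse at 1. rewrite mem_rec_eq. apply repl_ext. intros y Hy.
apply sepP in Hy. destruct Hy as [Hy _].
destruct (excluded_middle_informative (y ∈ x)); [reflexivity | contradiction].
Qed.

(** ** Canonical functions *)

Definition canonical_bijections (b : M -> M -> M -> M) : Prop :=
  (forall κ ξ, regular κ -> κ ⊆ ξ -> below_card_succ ξ κ -> bijection (b κ ξ) κ ξ) /\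
  (forall κ α, regular κ -> α ∈ κ -> b κ κ α = α).

Definition Fcan (b : M -> M -> M -> M) κ ξ α : M :=
  if excluded_middle_informative (ξ ∈ κ) then ξ else repl (b κ ξ) α.
Definition fcan b κ ξ α : M := ot (Fcan b κ ξ α).
Definition pican b κ ξ α : M -> M := collapse (Fcan b κ ξ α).

(** ** Formulas *)

(** First-order and second-order variables are named by natural numbers,
    separately for the two types. *)
Inductive term : Type :=
| Var1 (n : nat)
| Par1 (a : M)
| Var2 (k : nat)
| Par2 (A : M).

Inductive fo : Type :=
| Mem (s t : term)
| Eq (s t : term)
| Not (φ : fo)
| And (φ ψ : fo)
| All1 (n : nat) (φ : fo).

(** In [BigAnd ξ ψ] and [BigOr ξ ψ] only the [ψ ζ] with [ζ ∈ ξ] are conjuncts,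
    resp. disjuncts; all notions below ignore the other values of [ψ]. *)
Inductive formula : Type :=
| FO (φ : fo)
| All2 (k : nat) (φ : formula)
| Ex2 (k : nat) (φ : formula)
| BigAnd (ξ : M) (ψ : M -> formula)
| BigOr (ξ : M) (ψ : M -> formula).

Definition alls2 (ks : list nat) (φ : formula) : formula := fold_right All2 φ ks.
Definition exs2 (ks : list nat) (φ : formula) : formula := fold_right Ex2 φ ks.

Fixpoint fo_free1 (φ : fo) (n : nat) : Prop :=
  match φ with
  | Mem s t | Eq s t => s = Var1 n \/ t = Var1 n
  | Not φ => fo_free1 φ n
  | And φ ψ => fo_free1 φ n \/ fo_free1 ψ n
  | All1 m φ => n <> m /\ fo_free1 φ n
  end.

(** [t] occurs in [φ]; used for terms which are not first-order variables. *)
Fixpoint fo_occurs (φ : fo) (t : term) : Prop :=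
  match φ with
  | Mem s s' | Eq s s' => s = t \/ s' = t
  | Not φ => fo_occurs φ t
  | And φ ψ => fo_occurs φ t \/ fo_occurs ψ t
  | All1 _ φ => fo_occurs φ t
  end.

Fixpoint free1 (φ : formula) (n : nat) : Prop :=
  match φ with
  | FO φ => fo_free1 φ n
  | All2 _ φ | Ex2 _ φ => free1 φ n
  | BigAnd ξ ψ | BigOr ξ ψ => exists ζ, ζ ∈ ξ /\ free1 (ψ ζ) n
  end.

Fixpoint free2 (φ : formula) (k : nat) : Prop :=
  match φ with
  | FO φ => fo_occurs φ (Var2 k)
  | All2 j φ | Ex2 j φ => k <> j /\ free2 φ k
  | BigAnd ξ ψ | BigOr ξ ψ => exists ζ, ζ ∈ ξ /\ free2 (ψ ζ) k
  end.

Fixpoint par2 (φ : formula) (A : M) : Prop :=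
  match φ with
  | FO φ => fo_occurs φ (Par2 A)
  | All2 _ φ | Ex2 _ φ => par2 φ A
  | BigAnd ξ ψ | BigOr ξ ψ => exists ζ, ζ ∈ ξ /\ par2 (ψ ζ) A
  end.

Definition sentence (φ : formula) : Prop :=
  (forall n, ~ free1 φ n) /\ (forall k, ~ free2 φ k).

(** Finitely many second-order free variables and second-order parameters. *)
Definition finitary2 (φ : formula) : Prop :=
  Finite_sets.Finite nat (free2 φ) /\ Finite_sets.Finite M (par2 φ).

(** [is_Pi κ ξ φ]: [φ] is a [Π¹_ξ] formula over [V_κ]. *)
Inductive is_Pi κ : M -> formula -> Prop :=
| Pi_zero φ :
    (forall a, fo_occurs φ (Par1 a) -> a ∈ Vh κ) ->
    (forall A, fo_occurs φ (Par2 A) -> A ⊆ Vh κ) ->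
    is_Pi κ empty (FO φ)
| Pi_succ ξ ks ψ : is_Sigma κ ξ ψ -> is_Pi κ (succ ξ) (alls2 ks ψ)
| Pi_limit ξ ψ :
    limit ξ -> (forall ζ, ζ ∈ ξ -> is_Pi κ ζ (ψ ζ)) ->
    finitary2 (BigAnd ξ ψ) -> is_Pi κ ξ (BigAnd ξ ψ)
with is_Sigma κ : M -> formula -> Prop :=
| Sigma_zero φ :
    (forall a, fo_occurs φ (Par1 a) -> a ∈ Vh κ) ->
    (forall A, fo_occurs φ (Par2 A) -> A ⊆ Vh κ) ->
    is_Sigma κ empty (FO φ)
| Sigma_succ ξ ks ψ : is_Pi κ ξ ψ -> is_Sigma κ (succ ξ) (exs2 ks ψ)
| Sigma_limit ξ ψ :
    limit ξ -> (forall ζ, ζ ∈ ξ -> is_Sigma κ ζ (ψ ζ)) ->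
    finitary2 (BigOr ξ ψ) -> is_Sigma κ ξ (BigOr ξ ψ).

Definition formula_over κ (φ : formula) : Prop :=
  exists ξ, below_card_succ ξ κ /\ (is_Pi κ ξ φ \/ is_Sigma κ ξ φ).

(** Substitution of the second-order parameter [S] for the free occurrences of
    the second-order variable [z]. *)
Definition subst2_term (z : nat) (S : M) (t : term) : term :=
  match t with
  | Var2 k => if Nat.eqb k z then Par2 S else t
  | _ => t
  end.

Fixpoint subst2_fo (z : nat) (S : M) (φ : fo) : fo :=
  match φ with
  | Mem s t => Mem (subst2_term z S s) (subst2_term z S t)
  | Eq s t => Eq (subst2_term z S s) (subst2_term z S t)
  | Not φ => Not (subst2_fo z S φ)
  | And φ ψ => And (subst2_fo z S φ) (subst2_fo z S ψ)
  | All1 n φ => All1 n (subst2_fo z S φ)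
  end.

Fixpoint subst2 (z : nat) (S : M) (φ : formula) : formula :=
  match φ with
  | FO φ => FO (subst2_fo z S φ)
  | All2 k ψ => if Nat.eqb k z then φ else All2 k (subst2 z S ψ)
  | Ex2 k ψ => if Nat.eqb k z then φ else Ex2 k (subst2 z S ψ)
  | BigAnd ξ ψ => BigAnd ξ (fun ζ => subst2 z S (ψ ζ))
  | BigOr ξ ψ => BigOr ξ (fun ζ => subst2 z S (ψ ζ))
  end.

(** ** Satisfaction *)

Definition upd (e : nat -> M) (n : nat) (a : M) : nat -> M :=
  fun m => if Nat.eqb m n then a else e m.

Definition eval (e1 e2 : nat -> M) (t : term) : M :=
  match t with
  | Var1 n => e1 n
  | Par1 a => a
  | Var2 k => e2 k
  | Par2 A => A
  end.

Fixpoint fo_sat (D : M) (e1 e2 : nat -> M) (φ : fo) : Prop :=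
  match φ with
  | Mem s t => eval e1 e2 s ∈ eval e1 e2 t
  | Eq s t => eval e1 e2 s = eval e1 e2 t
  | Not φ => ~ fo_sat D e1 e2 φ
  | And φ ψ => fo_sat D e1 e2 φ /\ fo_sat D e1 e2 ψ
  | All1 n φ => forall a, a ∈ D -> fo_sat D (upd e1 n a) e2 φ
  end.

Fixpoint sat (D : M) (e1 e2 : nat -> M) (φ : formula) : Prop :=
  match φ with
  | FO φ => fo_sat D e1 e2 φ
  | All2 k φ => forall A, A ⊆ D -> sat D e1 (upd e2 k A) φ
  | Ex2 k φ => exists A, A ⊆ D /\ sat D e1 (upd e2 k A) φ
  | BigAnd ξ ψ => forall ζ, ζ ∈ ξ -> sat D e1 e2 (ψ ζ)
  | BigOr ξ ψ => exists ζ, ζ ∈ ξ /\ sat D e1 e2 (ψ ζ)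
  end.

(** [V_κ ⊨ φ]. Meant for sentences, whose truth does not depend on the
    assignment; the one used here is constantly [∅]. *)
Definition models κ (φ : formula) : Prop :=
  sat (Vh κ) (fun _ => empty) (fun _ => empty) φ.

(** ** Restriction *)

Definition cut_term α (t : term) : term :=
  match t with
  | Par2 A => Par2 (A ∩ Vh α)
  | _ => t
  end.

Fixpoint cut_fo α (φ : fo) : fo :=
  match φ with
  | Mem s t => Mem (cut_term α s) (cut_term α t)
  | Eq s t => Eq (cut_term α s) (cut_term α t)
  | Not φ => Not (cut_fo α φ)
  | And φ ψ => And (cut_fo α φ) (cut_fo α ψ)
  | All1 n φ => All1 n (cut_fo α φ)
  end.

Fixpoint cut α (φ : formula) : formula :=
  match φ with
  | FO φ => FO (cut_fo α φ)
  | All2 k φ => All2 k (cut α φ)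
  | Ex2 k φ => Ex2 k (cut α φ)
  | BigAnd ξ ψ => BigAnd ξ (fun ζ => cut α (ψ ζ))
  | BigOr ξ ψ => BigOr ξ (fun ζ => cut α (ψ ζ))
  end.

(** [restr b κ α ξ φ φ']: the restriction to [α] of the [Π¹_ξ] or [Σ¹_ξ]
    formula [φ] over [V_κ] is defined and is [φ'].  In the limit clauses, [η]
    stands for the preimage of [ζ] under the collapse of [F^κ_ξ(α)]. *)
Inductive restr b κ α : M -> formula -> formula -> Prop :=
| restr_small ξ φ : ξ ∈ κ -> restr b κ α ξ φ (cut α φ)
| restr_all ζ ks ψ ψ' :
    κ ⊆ succ ζ -> restr b κ α ζ ψ ψ' ->
    restr b κ α (succ ζ) (alls2 ks ψ) (alls2 ks ψ')
| restr_ex ζ ks ψ ψ' :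
    κ ⊆ succ ζ -> restr b κ α ζ ψ ψ' ->
    restr b κ α (succ ζ) (exs2 ks ψ) (exs2 ks ψ')
| restr_and ξ ψ χ :
    κ ⊆ ξ -> limit ξ ->
    (forall ζ η, ζ ∈ fcan b κ ξ α -> η ∈ Fcan b κ ξ α -> pican b κ ξ α η = ζ ->
       restr b κ α η (ψ η) (χ ζ)) ->
    (forall ζ, ζ ∈ fcan b κ ξ α -> is_Pi α ζ (χ ζ)) ->
    restr b κ α ξ (BigAnd ξ ψ) (BigAnd (fcan b κ ξ α) χ)
| restr_or ξ ψ χ :
    κ ⊆ ξ -> limit ξ ->
    (forall ζ η, ζ ∈ fcan b κ ξ α -> η ∈ Fcan b κ ξ α -> pican b κ ξ α η = ζ ->
       restr b κ α η (ψ η) (χ ζ)) ->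
    (forall ζ, ζ ∈ fcan b κ ξ α -> is_Sigma α ζ (χ ζ)) ->
    restr b κ α ξ (BigOr ξ ψ) (BigOr (fcan b κ ξ α) χ).

(** [V_α ⊨ φ|^κ_α], including that the restriction is defined and is a formula
    over [V_α]. *)
Definition models_restr b κ α ξ (φ : formula) : Prop :=
  exists φ', restr b κ α ξ φ φ' /\ formula_over α φ' /\ models α φ'.

(** ** Indescribability *)

(** Restrictions to [α] are only considered for regular [α < κ]. *)
Definition indescribable b κ ξ (S : M) : Prop :=
  S ⊆ κ /\
  forall φ, is_Pi κ ξ φ -> sentence φ -> models κ φ ->
    exists α, α ∈ S /\ regular α /\ models_restr b κ α ξ φ.

End SetTheory.

(* Main.v *)
(** Every Π¹_ξ sentence is equivalent, in V_κ and in V_α for club many regular α, to a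
    statement about a game of rank ξ played on V_κ: blocks of second-order quantifiers are
    single moves, conjunctions and disjunctions of limit length are choices of an index, and
    a final position is decided by the test "⟨V_β, the moves cut down to V_β⟩ ∈ R for every
    V_β closed under D", where D is the last move. By Löwenheim-Skolem the first-order
    matrix has the same truth value in V_α and in club many V_β, so a single code R ⊆ V_κ
    replaces it, and the choice of R takes care of all sentences at once. The game is itself
    expressed by a Π¹_ξ formula in R and D. Hence S is indescribable iff for all R and D such
    that the game is won in V_κ there is a regular β ∈ S such that it is won in V_β; this is
    Π¹_(ξ+1), because the truth of the conclusion for each β < κ is stored in a parameter.
    The game only depends on an enumeration of ξ in order type κ, so at α the collapse of the
    enumeration restricted to α may be used, whatever bijections were chosen for α. *)

From Stdlib Require Import List Arith Lia Classical ClassicalEpsilon FunctionalExtensionality PropExtensionality Setoid Morphisms.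
From Stdlib Require Finite_sets.
Require Import Defs.
Set Implicit Arguments.
Unset Strict Implicit.

(** Two obstacles shape the proof. First, a first-order matrix is decided correctly only on a club
    of β that depends on the position, so a move D has to carry this club, at the cost of a
    second-order quantifier. It is merged with the last block, hence levels from 1 on are kept;
    below a limit every level ζ is replaced by 1+ζ, and ξ = 0 is treated apart. Second,
    indescribability yields some α in S of which nothing is known, while restriction is well behaved
    only on a club. Membership in the club is therefore made part of the reflected statement: a set
    E of stages is used whose cofinality in V_α forces α into the club. Since a formula of limit
    level is a bare conjunction or disjunction, a first-order statement cannot be joined to it from
    outside; it is joined to every leaf instead, and then follows from the truth of the restriction
    at any such α, good or not. The same device, with a disjunction, places the conclusion of the
    reflection property inside the defining formula. The enumerated ordinal is Ω = ξ+2, because both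
    ξ and the level ξ+1 of the defining formula need an index. *)

Section Ordinals.
Context {M : ZFC}.
Implicit Types (x y z u v w X Y α β γ δ ζ η κ : M).

(** * Ordinals, the cumulative hierarchy and transitive collapses *)

Lemma mem_irrefl x : ~ x ∈ x.
Proof.
induction (foundation x) as [x _ IH]. intro H. exact (IH x H H).
Qed.

Lemma mem_asym x y : x ∈ y -> ~ y ∈ x.
Proof.
revert y. induction (foundation x) as [x _ IH]. intros y H H'.
exact (IH y H' x H' H).
Qed.

Lemma mem_least (P : M -> Prop) x : P x -> exists y, P y /\ forall z, z ∈ y -> ~ P z.
Proof.
induction (foundation x) as [x _ IH]. intro Hx.
destruct (classic (exists z, z ∈ x /\ P z)) as [[z [Hz Pz]]|H].
- exact (IH z Hz Pz).
- exists x. split; auto. intros z Hz Pz. apply H. eauto.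
Qed.

Lemma empty_or_inhabited x : x = empty \/ exists y, y ∈ x.
Proof.
destruct (classic (exists y, y ∈ x)) as [H|H]; auto.
left. apply extensionality. intro z. split; intro Hz.
- destruct H. eauto.
- destruct (emptyP Hz).
Qed.

Lemma in_succ x z : z ∈ succ x <-> z ∈ x \/ z = x.
Proof.
unfold succ. rewrite unionP. split.
- intros [y [Hy Hz]]. apply pairP in Hy. destruct Hy as [->| ->]; auto.
  apply pairP in Hz. tauto.
- intros [Hz| ->].
  + exists x. rewrite pairP. auto.
  + exists (pair x x). rewrite !pairP. auto.
Qed.

Lemma succ_self x : x ∈ succ x.
Proof. apply in_succ. auto. Qed.

Lemma succ_inj x y : succ x = succ y -> x = y.
Proof.
intro H.
assert (Hx : x ∈ succ y) by (rewrite <- H; apply succ_self).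
assert (Hy : y ∈ succ x) by (rewrite H; apply succ_self).
apply in_succ in Hx. apply in_succ in Hy.
destruct Hx as [Hx|]; auto. destruct Hy as [Hy|]; auto.
destruct (mem_asym Hx Hy).
Qed.

Lemma succ_not_empty x : succ x <> empty.
Proof. intro H. apply (@emptyP M x). rewrite <- H. apply succ_self. Qed.

Lemma ordinal_in α β : ordinal α -> β ∈ α -> ordinal β.
Proof.
intros [Ht H] Hb. split; auto.
intros y Hy. exact (H y (Ht β Hb y Hy)).
Qed.

Lemma ordinal_trans α x y : ordinal α -> x ∈ α -> y ∈ x -> y ∈ α.
Proof. intros [Ht _] Hx Hy. exact (Ht x Hx y Hy). Qed.

Lemma ordinal_trichotomy α β : ordinal α -> ordinal β -> α ∈ β \/ α = β \/ β ∈ α.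
Proof.
revert β. induction (foundation α) as [α _ IHa]. intros β.
induction (foundation β) as [β _ IHb]. intros Ha Hb.
destruct (classic (α ∈ β)) as [|Hn1]; auto.
destruct (classic (β ∈ α)) as [|Hn2]; auto.
right; left. apply extensionality. intro z. split; intro Hz.
- destruct (IHa z Hz β (ordinal_in Ha Hz) Hb) as [H|[->|H]]; auto.
  + contradiction.
  + destruct Hn2. exact (ordinal_trans Ha Hz H).
- destruct (IHb z Hz Ha (ordinal_in Hb Hz)) as [H|[->|H]]; auto.
  + destruct Hn1. exact (ordinal_trans Hb Hz H).
  + contradiction.
Qed.

Lemma ordinal_sub α β : ordinal α -> ordinal β -> α ⊆ β -> α = β \/ α ∈ β.
Proof.
intros Ha Hb H. destruct (ordinal_trichotomy Ha Hb) as [|[|H']]; auto.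
destruct (mem_irrefl (H _ H')).
Qed.

Lemma ordinal_not_in α β : ordinal α -> ordinal β -> ~ α ∈ β -> β ⊆ α.
Proof.
intros Ha Hb H w Hw. destruct (ordinal_trichotomy Ha Hb) as [|[->|H']]; auto.
- contradiction.
- exact (ordinal_trans Ha H' Hw).
Qed.

Lemma ordinal_empty : ordinal (@empty M).
Proof. split; intros y Hy; destruct (emptyP Hy). Qed.

Lemma ordinal_succ α : ordinal α -> ordinal (succ α).
Proof.
intros Ha. split.
- intros y Hy z Hz. apply in_succ. apply in_succ in Hy. left.
  destruct Hy as [Hy| ->]; auto. exact (ordinal_trans Ha Hy Hz).
- intros y Hy. apply in_succ in Hy. destruct Hy as [Hy| ->]; [exact (proj2 Ha y Hy)|exact (proj1 Ha)].
Qed.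

Lemma succ_in α β : ordinal α -> β ∈ α -> succ β = α \/ succ β ∈ α.
Proof.
intros Ha Hb. apply ordinal_sub; auto.
- apply ordinal_succ. exact (ordinal_in Ha Hb).
- intros w Hw. apply in_succ in Hw. destruct Hw as [Hw| ->]; auto.
  exact (ordinal_trans Ha Hb Hw).
Qed.

Lemma ordinal_cases α : ordinal α ->
  α = empty \/ (exists ζ, ordinal ζ /\ α = succ ζ) \/ limit α.
Proof.
intro Ha. destruct (classic (α = empty)) as [|He]; auto. right.
destruct (classic (exists y, y ∈ α /\ ~ succ y ∈ α)) as [[y [Hy Hs]]|H].
- left. exists y. split; [exact (ordinal_in Ha Hy)|].
  destruct (succ_in Ha Hy); auto. contradiction.
- right. split; auto. split; auto. intros y Hy. apply NNPP. intro Hs. eauto.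
Qed.

Lemma limit_not_succ ζ : ~ limit (succ ζ).
Proof.
intros [_ [_ H]]. exact (mem_irrefl (H ζ (succ_self ζ))).
Qed.

Lemma limit_not_empty : ~ limit (@empty M).
Proof. intros [_ [H _]]. auto. Qed.

Lemma ordinal_empty_in α : ordinal α -> α <> empty -> empty ∈ α.
Proof.
intros Ha He. destruct (ordinal_trichotomy ordinal_empty Ha) as [|[|H]]; auto.
- congruence.
- destruct (emptyP H).
Qed.

Lemma ordinal_max α β γ : ordinal γ -> α ∈ γ -> β ∈ γ ->
  exists μ, μ ∈ γ /\ α ⊆ μ /\ β ⊆ μ.
Proof.
intros Hg Ha Hb.
destruct (ordinal_trichotomy (ordinal_in Hg Ha) (ordinal_in Hg Hb)) as [H|[->|H]].
- exists β. split; auto. split; auto. intros w Hw. exact (ordinal_trans (ordinal_in Hg Hb) H Hw).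
- exists β. auto.
- exists α. split; auto. split; auto. intros w Hw. exact (ordinal_trans (ordinal_in Hg Ha) H Hw).
Qed.

Lemma ordinal_of_transitive X : (forall x, x ∈ X -> ordinal x) -> transitive X -> ordinal X.
Proof. intros H Ht. split; auto. intros y Hy. exact (proj1 (H y Hy)). Qed.

Lemma ordinal_union X : (forall x, x ∈ X -> ordinal x) -> ordinal (union X).
Proof.
intro H. apply ordinal_of_transitive.
- intros x Hx. apply unionP in Hx. destruct Hx as [y [Hy Hx]]. exact (ordinal_in (H y Hy) Hx).
- intros y Hy z Hz. apply unionP in Hy. destruct Hy as [w [Hw Hy]]. apply unionP.
  exists w. split; auto. exact (ordinal_trans (H w Hw) Hy Hz).
Qed.

(** * Natural numbers *)

Fixpoint num (n : nat) : M := match n with 0 => empty | S n => succ (num n) end.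

(** The model is ω-standard: separation holds for predicates of the metatheory, so the numerals form
    an inductive set. *)
Lemma in_omega x : x ∈ omega M <-> exists n, x = num n.
Proof.
split.
- intro H. apply sepP in H. destruct H as [_ H].
  pose (I := sep (fun x => exists n, x = num n) (@infinite M)).
  assert (HI : inductive I).
  { destruct (@infiniteP M) as [H0 HS]. split.
    - apply sepP. split; auto. exists 0. reflexivity.
    - intros y Hy. apply sepP in Hy. destruct Hy as [Hy [n ->]].
      apply sepP. split; [apply (HS _ Hy)|]. exists (S n). reflexivity. }
  apply (H I) in HI. apply sepP in HI. tauto.
- intros [n ->]. apply sepP.
  assert (Hn : forall x, inductive x -> num n ∈ x).
  { intros y [H0 HS]. induction n as [|n IH]; simpl; auto. }
  split; auto. apply Hn. apply infiniteP.
Qed.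

Lemma ordinal_num n : ordinal (num n).
Proof. induction n; simpl; [apply ordinal_empty|apply ordinal_succ; auto]. Qed.

Lemma in_num n x : x ∈ num n <-> exists m, m < n /\ x = num m.
Proof.
induction n as [|n IH]; simpl.
- split; [intro H; destruct (emptyP H)|intros [m [Hm _]]; lia].
- rewrite in_succ, IH. split.
  + intros [[m [Hm ->]]| ->]; [exists m|exists n]; split; auto; lia.
  + intros [m [Hm ->]]. destruct (Nat.eq_dec m n) as [->|]; auto.
    left. exists m. split; auto. lia.
Qed.

Lemma num_inj m n : num m = num n -> m = n.
Proof.
assert (H : forall m n, m < n -> num m <> num n).
{ intros a b' Hab E. apply (@mem_irrefl (num a)). rewrite E at 2. apply in_num. eauto. }
intro E. destruct (Nat.lt_trichotomy m n) as [Hl|[|Hl]]; auto.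
- destruct (H _ _ Hl E).
- destruct (H _ _ Hl (eq_sym E)).
Qed.

Lemma ordinal_omega : ordinal (omega M).
Proof.
apply ordinal_of_transitive.
- intros x Hx. apply in_omega in Hx. destruct Hx as [n ->]. apply ordinal_num.
- intros x Hx y Hy. apply in_omega in Hx. destruct Hx as [n ->].
  apply in_num in Hy. destruct Hy as [m [_ ->]]. apply in_omega. eauto.
Qed.

Lemma num_not_limit n : ~ limit (num n).
Proof.
destruct n; simpl; [apply limit_not_empty|apply limit_not_succ].
Qed.

Lemma limit_num_in α n : limit α -> num n ∈ α.
Proof.
intros [Ho [He Hs]]. induction n; simpl; auto. apply ordinal_empty_in; auto.
Qed.

(** * Ordered pairs *)

Definition opair x y : M := pair (pair x x) (pair x y).

Lemma pair_eq x y u v : pair x y = pair u v -> (x = u /\ y = v) \/ (x = v /\ y = u).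
Proof.
intro E.
assert (Hx : x ∈ pair u v) by (rewrite <- E; apply pairP; auto).
assert (Hy : y ∈ pair u v) by (rewrite <- E; apply pairP; auto).
assert (Hu : u ∈ pair x y) by (rewrite E; apply pairP; auto).
assert (Hv : v ∈ pair x y) by (rewrite E; apply pairP; auto).
apply pairP in Hx, Hy, Hu, Hv.
destruct Hx, Hy, Hu, Hv; subst; auto.
Qed.

Lemma opair_inj x y u v : opair x y = opair u v -> x = u /\ y = v.
Proof.
intro E. apply pair_eq in E. destruct E as [[E1 E2]|[E1 E2]].
- apply pair_eq in E1. apply pair_eq in E2.
  destruct E1 as [[? ?]|[? ?]], E2 as [[? ?]|[? ?]]; split; congruence.
- apply pair_eq in E1. apply pair_eq in E2.
  destruct E1 as [[? ?]|[? ?]], E2 as [[? ?]|[? ?]]; split; congruence.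
Qed.

(** * The cumulative hierarchy *)

Lemma in_V α x : x ∈ Vh α <-> exists β, β ∈ α /\ x ⊆ Vh β.
Proof.
rewrite Vh_eq, unionP. split.
- intros [y [Hy Hx]]. apply replP in Hy. destruct Hy as [β [Hb ->]].
  rewrite powerP in Hx. eauto.
- intros [β [Hb Hx]]. exists (power (Vh β)). split.
  + apply replP. eauto.
  + rewrite powerP. auto.
Qed.

Lemma V_mono α β : α ⊆ β -> Vh α ⊆ Vh β.
Proof.
intros H w Hw. apply in_V in Hw. apply in_V. destruct Hw as [γ [Hg Hw]]. eauto.
Qed.

Lemma V_trans α x y : ordinal α -> x ∈ Vh α -> y ∈ x -> y ∈ Vh α.
Proof.
intros Ha Hx Hy. apply in_V in Hx. destruct Hx as [β [Hb Hx]].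
apply (@V_mono β α); auto. apply (proj1 Ha); auto.
Qed.

Lemma V_sub α x y : x ∈ Vh α -> y ⊆ x -> y ∈ Vh α.
Proof.
intros Hx Hy. apply in_V in Hx. apply in_V. destruct Hx as [β [Hb Hx]]. eauto.
Qed.

Lemma V_in α β : β ∈ α -> Vh β ∈ Vh α.
Proof. intro H. apply in_V. exists β. auto. Qed.

Lemma ordinal_sub_V α : ordinal α -> α ⊆ Vh α.
Proof.
induction (foundation α) as [α _ IH]. intros Ha w Hw.
apply in_V. exists w. split; auto. apply IH; auto. exact (ordinal_in Ha Hw).
Qed.

Lemma ordinal_in_V α β : ordinal α -> ordinal β -> (β ∈ Vh α <-> β ∈ α).
Proof.
intros Ha Hb. split; [|apply ordinal_sub_V; auto].
revert β Hb. induction (foundation α) as [α _ IH]. intros β Hb H.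
apply in_V in H. destruct H as [γ [Hg H]].
assert (Hog := ordinal_in Ha Hg).
assert (Hs : β ⊆ γ).
{ intros w Hw. apply (IH γ Hg Hog); auto. exact (ordinal_in Hb Hw). }
destruct (ordinal_sub Hb Hog Hs) as [->|H1]; auto.
exact (ordinal_trans Ha Hg H1).
Qed.

Lemma V_rank α x : limit α -> x ∈ Vh α -> exists β, β ∈ α /\ x ∈ Vh β.
Proof.
intros [Ho [He Hs]] Hx. apply in_V in Hx. destruct Hx as [β [Hb Hx]].
exists (succ β). split; auto. apply in_V. exists β. split; auto. apply succ_self.
Qed.

Lemma V_pair α x y : limit α -> x ∈ Vh α -> y ∈ Vh α -> pair x y ∈ Vh α.
Proof.
intros Hl Hx Hy. destruct (V_rank Hl Hx) as [β [Hb Hx']]. destruct (V_rank Hl Hy) as [γ [Hg Hy']].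
destruct (ordinal_max (proj1 Hl) Hb Hg) as [μ [Hm [H1 H2]]].
apply in_V. exists μ. split; auto. intros w Hw. apply pairP in Hw.
destruct Hw as [-> | ->]; [apply (V_mono H1)|apply (V_mono H2)]; auto.
Qed.

Lemma V_opair α x y : limit α -> (opair x y ∈ Vh α <-> x ∈ Vh α /\ y ∈ Vh α).
Proof.
intro Hl. split.
- intro H. assert (Ht := fun a b' => @V_trans α a b' (proj1 Hl)).
  assert (H1 : pair x y ∈ Vh α) by (apply (Ht _ _ H), pairP; auto).
  split; apply (Ht _ _ H1), pairP; auto.
- intros [Hx Hy]. repeat apply V_pair; auto.
Qed.

Lemma V_inj α β : ordinal α -> ordinal β -> Vh α = Vh β -> α = β.
Proof.
intros Ha Hb E. destruct (ordinal_trichotomy Ha Hb) as [H|[|H]]; auto; apply V_in in H;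
  rewrite E in H; destruct (mem_irrefl H).
Qed.

Lemma V_empty_in α : limit α -> empty ∈ Vh α.
Proof.
intros Hl. apply (@ordinal_sub_V α (proj1 Hl)). exact (limit_num_in 0 Hl).
Qed.

(** An ordered pair has at most two elements, a limit stage at least three. This separates a tuple
    with entries from a bare base stage. *)
Lemma V_limit_not_opair α x y : limit α -> Vh α <> opair x y.
Proof.
intros Hl E.
assert (H : forall n, num n = pair x x \/ num n = pair x y).
{ intro n. apply pairP. change (num n ∈ opair x y). rewrite <- E.
  apply (ordinal_sub_V (proj1 Hl)). apply limit_num_in; auto. }
assert (H3 : num 0 = num 1 \/ num 0 = num 2 \/ num 1 = num 2).
{ destruct (H 0) as [->| ->], (H 1) as [->| ->], (H 2) as [->| ->]; auto. }
destruct H3 as [E'|[E'|E']]; apply num_inj in E'; discriminate.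
Qed.

(** * Transitive collapse of sets of ordinals *)

Lemma in_collapse X x z : z ∈ collapse X x <-> exists y, y ∈ x /\ y ∈ X /\ z = collapse X y.
Proof.
rewrite collapse_eq, replP. split.
- intros [y [Hy ->]]. apply sepP in Hy. exists y. tauto.
- intros [y [H1 [H2 ->]]]. exists y. rewrite sepP. auto.
Qed.

Lemma in_ot X z : z ∈ ot X <-> exists y, y ∈ X /\ z = collapse X y.
Proof. unfold ot. rewrite replP. reflexivity. Qed.

Lemma ordinal_collapse X x : ordinal x -> ordinal (collapse X x).
Proof.
induction (foundation x) as [x _ IH]. intro Hx. apply ordinal_of_transitive.
- intros z Hz. apply in_collapse in Hz. destruct Hz as [y [Hy [_ ->]]].
  apply IH; auto. exact (ordinal_in Hx Hy).
- intros z Hz w Hw. apply in_collapse in Hz. destruct Hz as [y [Hy [_ ->]]].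
  apply in_collapse in Hw. destruct Hw as [u [Hu [HX ->]]].
  apply in_collapse. exists u. split; auto. exact (ordinal_trans Hx Hy Hu).
Qed.

Lemma collapse_mem X x y : x ∈ y -> x ∈ X -> collapse X x ∈ collapse X y.
Proof. intros. apply in_collapse. eauto. Qed.

Lemma collapse_inj X x y : ordinal x -> ordinal y -> x ∈ X -> y ∈ X ->
  collapse X x = collapse X y -> x = y.
Proof.
intros Hx Hy Xx Xy E. destruct (ordinal_trichotomy Hx Hy) as [H|[|H]]; auto;
  apply (@collapse_mem X) in H; auto; rewrite E in H; destruct (mem_irrefl H).
Qed.

Lemma collapse_mem_iff X x y : ordinal x -> ordinal y -> x ∈ X ->
  (collapse X x ∈ collapse X y <-> x ∈ y).
Proof.
intros Hx Hy Xx. split; [|intro; apply collapse_mem; auto].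
intro H. apply in_collapse in H. destruct H as [z [Hz [HX E]]].
apply collapse_inj in E; auto.
- subst. auto.
- exact (ordinal_in Hy Hz).
Qed.

Lemma collapse_le X x : ordinal x -> collapse X x ⊆ x.
Proof.
induction (foundation x) as [x _ IH]. intros Hx w Hw.
apply in_collapse in Hw. destruct Hw as [y [Hy [_ ->]]].
assert (Hoy := ordinal_in Hx Hy).
destruct (ordinal_sub (ordinal_collapse X Hoy) Hoy (IH y Hy Hoy)) as [->|H]; auto.
exact (ordinal_trans Hx Hy H).
Qed.

Lemma ordinal_ot X : (forall x, x ∈ X -> ordinal x) -> ordinal (ot X).
Proof.
intro H. apply ordinal_of_transitive.
- intros z Hz. apply in_ot in Hz. destruct Hz as [y [Hy ->]]. apply ordinal_collapse; auto.
- intros z Hz w Hw. apply in_ot in Hz. destruct Hz as [y [Hy ->]].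
  apply in_collapse in Hw. destruct Hw as [u [_ [HX ->]]]. apply in_ot. eauto.
Qed.

Lemma collapse_inter X η x : ordinal η -> x ∈ η -> collapse (X ∩ η) x = collapse X x.
Proof.
intro He. induction (foundation x) as [x _ IH]. intro Hx.
apply extensionality. intro z. rewrite !in_collapse. split.
- intros [y [Hy [HX ->]]]. apply sepP in HX. destruct HX as [HX Hye].
  exists y. rewrite IH; auto.
- intros [y [Hy [HX ->]]]. assert (Hye : y ∈ η) by exact (ordinal_trans He Hx Hy).
  exists y. rewrite IH; auto. split; auto. split; auto. apply sepP. auto.
Qed.

(** Once F^κ_η(α) is known to be X ∩ η, this makes a single collapse of X compute all the values
    f^κ_η(α). *)
Lemma ot_inter X η : ordinal η -> ot (X ∩ η) = collapse X η.
Proof.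
intro He. apply extensionality. intro z. rewrite in_ot, in_collapse. split.
- intros [y [Hy ->]]. apply sepP in Hy. exists y. rewrite collapse_inter; tauto.
- intros [y [Hy [HX ->]]]. exists y. rewrite sepP, collapse_inter; tauto.
Qed.

Lemma collapse_succ X ζ : ζ ∈ X -> collapse X (succ ζ) = succ (collapse X ζ).
Proof.
intros HX. apply extensionality. intro z. rewrite in_succ, !in_collapse. split.
- intros [y [Hy [Hy' ->]]]. apply in_succ in Hy. destruct Hy as [Hy| ->]; eauto.
- intros [[y [Hy [Hy' ->]]]| ->].
  + exists y. rewrite in_succ. auto.
  + exists ζ. rewrite in_succ. auto.
Qed.

Lemma collapse_empty X : collapse X empty = empty.
Proof.
apply extensionality. intro z. rewrite in_collapse. split.
- intros [y [Hy _]]. destruct (emptyP Hy).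
- intro H. destruct (emptyP H).
Qed.

Lemma collapse_transitive X η : ordinal η -> η ⊆ X -> collapse X η = η.
Proof.
induction (foundation η) as [η _ IH]. intros He HX. apply extensionality. intro z.
rewrite in_collapse.
assert (H : forall y, y ∈ η -> collapse X y = y).
{ intros y Hy. apply IH; auto. exact (ordinal_in He Hy).
  intros w Hw. apply HX. exact (ordinal_trans He Hy Hw). }
split.
- intros [y [Hy [_ ->]]]. rewrite H; auto.
- intro Hz. exists z. rewrite H; auto.
Qed.

End Ordinals.

Lemma choice_on (M : ZFC) (A : Type) (a0 : A) (X : M) (R : M -> A -> Prop) :
  (forall x, x ∈ X -> exists y, R x y) -> exists f, forall x, x ∈ X -> R x (f x).
Proof.
intro H. exists (fun x => epsilon (inhabits a0) (R x)).
intros x Hx. apply epsilon_spec. auto.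
Qed.

(** * Sizes below an inaccessible, successor cardinals and clubs *)

Section Cardinals.
Context {M : ZFC}.
Implicit Types (x y z u v w X Y α β γ δ ζ η κ : M).

Lemma regular_limit κ : regular κ -> limit κ.
Proof. intros [_ [H _]]. exact H. Qed.

Lemma regular_ordinal κ : regular κ -> ordinal κ.
Proof. intro H. exact (proj1 (regular_limit H)). Qed.

(** Size less than κ, by a surjection from an ordinal below κ; with surjections no injectivity has
    to be checked. *)
Definition small κ X : Prop :=
  exists γ (F : M -> M), γ ∈ κ /\ forall x, x ∈ X -> exists i, i ∈ γ /\ F i = x.

Lemma small_bound κ X (F : M -> M) : regular κ -> small κ X ->
  (forall x, x ∈ X -> F x ∈ κ) -> exists γ, γ ∈ κ /\ forall x, x ∈ X -> F x ∈ γ.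
Proof.
intros Hk [β [G [Hb HG]]] HF.
assert (H0 := limit_num_in 0 (regular_limit Hk)).
destruct (proj2 (proj2 Hk) β
  (fun i => if excluded_middle_informative (G i ∈ X) then F (G i) else empty) Hb)
  as [γ [Hg H]].
- intros δ _. destruct (excluded_middle_informative _); auto.
- exists γ. split; auto. intros x Hx. destruct (HG x Hx) as [i [Hi <-]].
  specialize (H i Hi). simpl in H. destruct (excluded_middle_informative _); auto. contradiction.
Qed.

Lemma small_elem κ β : β ∈ κ -> small κ β.
Proof. intro H. exists β, (fun x => x). eauto. Qed.

Lemma small_image κ X Y (G : M -> M) : small κ X ->
  (forall y, y ∈ Y -> exists x, x ∈ X /\ G x = y) -> small κ Y.
Proof.
intros [γ [F [Hg HF]]] H. exists γ, (fun i => G (F i)). split; auto.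
intros y Hy. destruct (H y Hy) as [x [Hx <-]]. destruct (HF x Hx) as [i [Hi <-]]. eauto.
Qed.

Lemma small_power κ X : inaccessible κ -> small κ X -> small κ (power X).
Proof.
intros [Hk Hs] [γ [F [Hg HF]]].
destruct (Hs γ Hg) as [γ' [G [Hg' [_ [_ HG]]]]].
apply (@small_image κ (power γ) (power X) (fun t => repl F t)).
- exists γ', G. auto.
- intros y Hy. rewrite powerP in Hy.
  exists (sep (fun i => F i ∈ y) γ). split.
  + rewrite powerP. intros w Hw. apply sepP in Hw. tauto.
  + apply extensionality. intro z. rewrite replP. split.
    * intros [i [Hi ->]]. apply sepP in Hi. tauto.
    * intro Hz. destruct (HF z (Hy z Hz)) as [i [Hi E]]. exists i.
      rewrite sepP, E. auto.
Qed.

(** Induction on β: the sizes of the power sets of the V_δ with δ < β are bounded by regularity, and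
    a union of few small sets is covered by pairs (δ, i). *)
Lemma small_V κ β : inaccessible κ -> β ∈ κ -> small κ (Vh β).
Proof.
intros Hk. assert (Hko := regular_ordinal (proj1 Hk)).
induction (foundation β) as [β _ IH]. intro Hb.
destruct (@choice_on M (M * (M -> M)) (empty, fun x => x) β (fun δ p =>
  fst p ∈ κ /\ forall x, x ∈ power (Vh δ) -> exists i, i ∈ fst p /\ snd p i = x))
  as [f Hf].
{ intros δ Hd. assert (Hs : small κ (power (Vh δ))).
  { apply small_power; auto. apply IH; auto. exact (ordinal_trans Hko Hb Hd). }
  destruct Hs as [γ [F H]]. exists (γ, F). exact H. }
destruct (small_bound (F := fun δ => fst (f δ)) (proj1 Hk) (small_elem Hb)) as [γ [Hg HG]].
{ intros x Hx. apply Hf; auto. }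
destruct (ordinal_max Hko Hb Hg) as [μ [Hm [H1 H2]]].
(* A pair of elements of μ belongs to the double power set of μ, which is small by two uses of the
   strong limit property; this replaces cardinal multiplication. *)
apply (@small_image κ (power (power μ)) (Vh β) (fun p =>
  epsilon (inhabits empty) (fun y => exists δ i, p = opair δ i /\ y = snd (f δ) i))).
- apply small_power; auto. apply small_power; auto. apply small_elem; auto.
- intros y Hy. apply in_V in Hy. destruct Hy as [δ [Hd Hy]].
  destruct (proj2 (Hf δ Hd) y) as [i [Hi Ei]]; [rewrite powerP; auto|].
  exists (opair δ i). split.
  + assert (Hdm : δ ∈ μ) by auto.
    assert (Him : i ∈ μ).
    { apply H2. apply (ordinal_trans (ordinal_in Hko Hg) (HG δ Hd)). auto. }
    rewrite powerP. intros w Hw. rewrite powerP. intros v Hv.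
    apply pairP in Hw. destruct Hw as [-> | ->]; apply pairP in Hv; destruct Hv as [-> | ->]; auto.
  + match goal with |- epsilon ?h ?P = _ => assert (HP : P (epsilon h P)) by
      (apply epsilon_spec; exists y, δ, i; auto); destruct HP as [δ' [i' [E ->]]] end.
    apply opair_inj in E. destruct E as [<- <-]. auto.
Qed.

Lemma V_bound κ β (F : M -> M) : inaccessible κ -> β ∈ κ ->
  (forall x, x ∈ Vh β -> F x ∈ κ) -> exists γ, γ ∈ κ /\ forall x, x ∈ Vh β -> F x ∈ γ.
Proof.
intros Hk Hb. apply small_bound; [exact (proj1 Hk)|apply small_V; auto].
Qed.

(** The tuples are total assignments; only their first [n] entries matter. *)
Lemma tuple_bound κ β n (Q : (nat -> M) -> M -> Prop) : inaccessible κ -> β ∈ κ ->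
  (forall e γ γ', γ ⊆ γ' -> Q e γ -> Q e γ') ->
  (forall e e' γ, (forall m, m < n -> e m = e' m) -> Q e γ -> Q e' γ) ->
  (forall e, exists γ, γ ∈ κ /\ Q e γ) ->
  exists γ, γ ∈ κ /\ forall e, (forall m, m < n -> e m ∈ Vh β) -> Q e γ.
Proof.
intros Hk Hb. assert (Hko := regular_ordinal (proj1 Hk)).
revert Q. induction n as [|n IH]; intros Q Hm Hl Hex.
- destruct (Hex (fun _ => empty)) as [γ [Hg HQ]]. exists γ. split; auto.
  intros e _. apply (Hl (fun _ => empty)); auto. intros; lia.
- assert (H : forall a, a ∈ Vh β -> exists γ, γ ∈ κ /\
    forall e, (forall m, m < n -> e m ∈ Vh β) -> Q (upd e n a) γ).
  { intros a _. apply (IH (fun e γ => Q (upd e n a) γ)).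
    - eauto.
    - intros e e' γ He. apply Hl. intros m Hmn. unfold upd.
      destruct (Nat.eqb_spec m n); auto. apply He. lia.
    - intros e. apply Hex. }
  destruct (choice_on empty H) as [f Hf].
  destruct (V_bound (F := f) Hk Hb) as [γ [Hg HG]].
  { intros x Hx. apply Hf; auto. }
  exists γ. split; auto. intros e He.
  assert (Hn : e n ∈ Vh β) by (apply He; lia).
  apply (Hl (upd e n (e n))).
  + intros m _. unfold upd. destruct (Nat.eqb_spec m n); subst; auto.
  + apply (Hm _ (f (e n))).
    * intros w Hw. apply (ordinal_trans (ordinal_in Hko Hg) (HG _ Hn)); auto.
    * apply (proj2 (Hf _ Hn)). intros m Hmn. apply He. lia.
Qed.

(** * Successor cardinals *)

Lemma card_succ_exists κ α : cardinal κ -> cardinal α -> α ∈ κ -> exists κ', is_card_succ α κ'.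
Proof.
intros Hk Ha Hak.
destruct (@mem_least M (fun μ => cardinal μ /\ α ∈ μ) κ (conj Hk Hak)) as [μ [[H1 H2] H]].
exists μ. split; auto. split; auto. intros ν Hn Han.
apply ordinal_not_in; [exact (proj1 Hn)|exact (proj1 H1)|]. intro Hnm. exact (H ν Hnm (conj Hn Han)).
Qed.

(** Otherwise κ' ⊆ η, and choosing preimages injects κ' into κ. The order type of the image is then
    an ordinal below κ' in bijection with the cardinal κ'. *)
Lemma surjection_below_card_succ κ κ' η (c : M -> M) : ordinal κ -> is_card_succ κ κ' ->
  ordinal η -> (forall y, y ∈ η -> exists i, i ∈ κ /\ c i = y) -> η ∈ κ'.
Proof.
intros Hk [Hc [Hkk' _]] He Hs. assert (Ho := proj1 Hc).
apply NNPP. intro Hn. assert (Hsub := ordinal_not_in He Ho Hn).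
destruct (@choice_on M M empty κ' (fun y i => i ∈ κ /\ c i = y)) as [j Hj]; [auto|].
pose (Y := repl j κ').
assert (HY : forall y, y ∈ Y -> y ∈ κ).
{ intros y Hy. apply replP in Hy. destruct Hy as [x [Hx ->]]. apply Hj. auto. }
assert (HYo : forall y, y ∈ Y -> ordinal y).
{ intros y Hy. exact (ordinal_in Hk (HY y Hy)). }
assert (Hto := ordinal_ot HYo).
assert (Htk : ot Y ⊆ κ).
{ intros w Hw. apply in_ot in Hw. destruct Hw as [y [Hy ->]].
  destruct (ordinal_sub (ordinal_collapse Y (HYo y Hy)) (HYo y Hy) (@collapse_le M Y y (HYo y Hy))) as [->|H]; auto.
  exact (ordinal_trans Hk (HY y Hy) H). }
assert (Ht : ot Y ∈ κ').
{ destruct (ordinal_sub Hto Hk Htk) as [->|H]; auto. exact (ordinal_trans Ho Hkk' H). }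
apply (proj2 Hc _ Ht).
exists (fun t => epsilon (inhabits empty) (fun x => x ∈ κ' /\ collapse Y (j x) = t)).
assert (HE : forall t, t ∈ ot Y -> let x := epsilon (inhabits empty) (fun x => x ∈ κ' /\ collapse Y (j x) = t) in
   x ∈ κ' /\ collapse Y (j x) = t).
{ intros t Ht'. apply epsilon_spec. apply in_ot in Ht'. destruct Ht' as [y [Hy ->]].
  apply replP in Hy. destruct Hy as [x [Hx ->]]. eauto. }
assert (HinY : forall x, x ∈ κ' -> j x ∈ Y) by (intros x Hx; apply replP; eauto).
split; [|split].
- intros t Ht'. apply HE; auto.
- intros t t' H1 H2 E. destruct (HE t H1) as [_ E1]. destruct (HE t' H2) as [_ E2].
  simpl in *. rewrite <- E1, <- E2, E. reflexivity.
- intros y Hy. exists (collapse Y (j y)).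
  assert (Hin : collapse Y (j y) ∈ ot Y) by (apply in_ot; eauto).
  split; auto. destruct (HE _ Hin) as [H1 H2]. simpl in *.
  apply collapse_inj in H2; auto.
  assert (E1 := proj2 (Hj _ Hy)). assert (E2 := proj2 (Hj _ H1)). congruence.
Qed.

(** * Closure points *)

Definition closed (g : M -> M) α : Prop := forall i, i ∈ α -> g i ∈ α.

(** [P] contains the limit ordinals closed under some function; for regular [κ]
    this amounts to containing a club. *)
Definition Cl κ (P : M -> Prop) : Prop :=
  exists g, closed g κ /\ forall α, α ∈ κ -> limit α -> closed g α -> P α.

Lemma Cl_mono κ (P Q : M -> Prop) : (forall α, α ∈ κ -> limit α -> P α -> Q α) -> Cl κ P -> Cl κ Q.
Proof. intros H [g [Hg HP]]. exists g. auto. Qed.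

Lemma Cl_tail κ β : β ∈ κ -> Cl κ (fun α => β ∈ α).
Proof.
intro H. exists (fun _ => β). split; [intros i _; auto|].
intros α _ Hl Ha. apply (Ha empty). exact (limit_num_in 0 Hl).
Qed.

Lemma Cl_limit κ : Cl κ (fun α => limit α).
Proof. exists (fun i => i). split; [intros i Hi; auto|auto]. Qed.

Lemma Cl_closed κ (g : M -> M) : closed g κ -> Cl κ (closed g).
Proof. intro H. exists g. auto. Qed.

(** Diagonal intersection. If [G i] witnesses [P i], let [g m] bound all [G i j] with i, j ≤ m; a
    limit α closed under g is closed under [G i] for each i < α. *)
Lemma Cl_diag κ (P : M -> M -> Prop) : regular κ ->
  (forall i, i ∈ κ -> Cl κ (P i)) -> Cl κ (fun α => forall i, i ∈ α -> P i α).
Proof.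
intros Hk H. assert (Hko := regular_ordinal Hk).
destruct (choice_on (fun x => x) H) as [G HG].
assert (Hb1 : forall m i, m ∈ κ -> i ∈ κ -> exists γ, γ ∈ κ /\ forall j, j ∈ succ m -> G i j ∈ γ).
{ intros m i Hm Hi. apply (proj2 (proj2 Hk)).
  - apply (regular_limit Hk). auto.
  - intros j Hj. apply (HG i Hi). apply (ordinal_trans Hko (proj2 (proj2 (regular_limit Hk)) m Hm)). auto. }
assert (Hb2 : forall m, m ∈ κ -> exists γ, γ ∈ κ /\ forall i j, i ∈ succ m -> j ∈ succ m -> G i j ∈ γ).
{ intros m Hm. assert (Hsm := proj2 (proj2 (regular_limit Hk)) m Hm).
  destruct (@choice_on M M empty (succ m) (fun i γ => γ ∈ κ /\ forall j, j ∈ succ m -> G i j ∈ γ)) as [f Hf].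
  { intros i Hi. apply Hb1; auto. exact (ordinal_trans Hko Hsm Hi). }
  destruct (proj2 (proj2 Hk) (succ m) f Hsm) as [γ [Hg HG']].
  { intros i Hi. apply Hf. auto. }
  exists γ. split; auto. intros i j Hi Hj.
  apply (ordinal_trans (ordinal_in Hko Hg) (HG' i Hi)). apply Hf; auto. }
destruct (choice_on empty Hb2) as [g Hg].
exists g. split.
{ intros m Hm. apply Hg. auto. }
intros α Ha Hl Hc i Hi. apply (HG i (ordinal_trans Hko Ha Hi)); auto.
intros j Hj. destruct (ordinal_max (proj1 Hl) Hi Hj) as [m [Hm [H1 H2]]].
assert (Hom := ordinal_in (proj1 Hl) Hm).
assert (Hin : forall k, k ∈ α -> k ⊆ m -> k ∈ succ m).
{ intros k Hk' Hkm. apply in_succ.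
  destruct (ordinal_sub (ordinal_in (proj1 Hl) Hk') Hom Hkm); auto. }
apply (ordinal_trans (proj1 Hl) (Hc m Hm)).
apply (Hg m (ordinal_trans Hko Ha Hm)); auto.
Qed.

(** A diagonal intersection with P at index 0 and Q at all others; the indices 0 and 1 lie below
    every limit ordinal. *)
Lemma Cl_and κ (P Q : M -> Prop) : regular κ -> Cl κ P -> Cl κ Q -> Cl κ (fun α => P α /\ Q α).
Proof.
intros Hk HP HQ.
assert (H := @Cl_diag κ (fun i α => (i = empty -> P α) /\ (i <> empty -> Q α)) Hk).
eapply Cl_mono; [|apply H].
- intros α Ha Hl Hc. split.
  + apply (proj1 (Hc (num 0) (limit_num_in 0 Hl))). reflexivity.
  + apply (proj2 (Hc (num 1) (limit_num_in 1 Hl))). apply succ_not_empty.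
- intros i Hi. destruct (classic (i = empty)) as [->|Hn].
  + eapply Cl_mono; [|exact HP]. intros α _ _ Ha. simpl. tauto.
  + eapply Cl_mono; [|exact HQ]. intros α _ _ Ha. simpl. tauto.
Qed.

Lemma closed_unbounded κ (g : M -> M) β : regular κ -> omega M ∈ κ -> closed g κ -> β ∈ κ ->
  exists γ, γ ∈ κ /\ limit γ /\ closed g γ /\ β ∈ γ.
Proof.
intros Hk Hw Hg Hb. assert (Hko := regular_ordinal Hk).
assert (Hstep : forall x, x ∈ κ -> exists y, y ∈ κ /\ x ∈ y /\ forall i, i ∈ x -> g i ∈ y).
{ intros x Hx. destruct (proj2 (proj2 Hk) x g Hx) as [y [Hy H]].
  { intros i Hi. apply Hg. exact (ordinal_trans Hko Hx Hi). }
  destruct (ordinal_max Hko (proj2 (proj2 (regular_limit Hk)) x Hx) Hy) as [μ [Hm [H1 H2]]].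
  exists μ. split; auto. split; auto. apply H1. apply succ_self. }
destruct (choice_on empty Hstep) as [f Hf].
pose (s := fix s (n : nat) := match n with 0 => succ β | S n => f (s n) end).
assert (Hs : forall n, s n ∈ κ).
{ induction n as [|n IH]; simpl; [apply (regular_limit Hk); auto|apply Hf; auto]. }
(* Regularity speaks of functions on elements of κ, so the sequence is transported from the natural
   numbers to the ω of the model. *)
pose (F := fun x : M => s (epsilon (inhabits 0) (fun n => x = num n))).
assert (HF : forall n, F (num n) = s n).
{ intro n. unfold F. f_equal. apply (@num_inj M). symmetry.
  apply (epsilon_spec (inhabits 0) (fun m => num n = num m)). eauto. }
destruct (proj2 (proj2 Hk) (omega M) F Hw) as [γ0 [Hg0 H0]].
{ intros x _. apply Hs. }
pose (γ := union (repl F (omega M))).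
assert (Hin : forall x, x ∈ γ <-> exists n, x ∈ s n).
{ intro x. unfold γ. rewrite unionP. split.
  - intros [y [Hy Hx]]. apply replP in Hy. destruct Hy as [m [Hm ->]].
    apply in_omega in Hm. destruct Hm as [n ->]. rewrite HF in Hx. eauto.
  - intros [n Hn]. exists (s n). split; auto. apply replP. exists (num n). rewrite HF.
    split; auto. apply in_omega. eauto. }
assert (Hgo : ordinal γ).
{ apply ordinal_union. intros x Hx. apply replP in Hx. destruct Hx as [m [_ ->]].
  exact (ordinal_in Hko (Hs _)). }
exists γ. split; [|split; [|split]].
- assert (Hsub : γ ⊆ γ0).
  { intros w Hw'. apply Hin in Hw'. destruct Hw' as [n Hn]. rewrite <- HF in Hn.
    apply (@ordinal_trans M _ (F (num n))); auto; [exact (ordinal_in Hko Hg0)|].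
    apply H0. apply in_omega. eauto. }
  destruct (ordinal_sub Hgo (ordinal_in Hko Hg0) Hsub) as [->|H]; auto.
  exact (ordinal_trans Hko Hg0 H).
- split; auto. split.
  + intro E. apply (@emptyP M β). rewrite <- E. apply Hin. exists 0. apply succ_self.
  + intros y Hy. apply Hin in Hy. destruct Hy as [n Hn]. apply Hin. exists (S n).
    assert (H1 : s n ∈ s (S n)) by (apply Hf; auto).
    destruct (succ_in (ordinal_in Hko (Hs n)) Hn) as [->|H2]; auto.
    exact (ordinal_trans (ordinal_in Hko (Hs (S n))) H1 H2).
- intros i Hi. apply Hin in Hi. destruct Hi as [n Hn]. apply Hin. exists (S n).
  apply Hf; auto.
- apply Hin. exists 0. apply succ_self.
Qed.

Lemma closed_sup (g : M -> M) δ : limit δ ->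
  (forall β, β ∈ δ -> exists γ, γ ∈ δ /\ closed g γ /\ β ∈ γ) -> closed g δ.
Proof.
intros Hl H i Hi. destruct (H i Hi) as [γ [Hg [Hc Hig]]].
exact (ordinal_trans (proj1 Hl) Hg (Hc i Hig)).
Qed.

Lemma Cl_club κ (P : M -> Prop) : regular κ -> omega M ∈ κ -> Cl κ P ->
  exists C, club C κ /\ forall α, α ∈ C -> α ∈ κ /\ P α.
Proof.
intros Hk Hw [g [Hg HP]].
exists (sep (fun α => limit α /\ closed g α) κ). split; [split; [|split]|].
- intros α Ha. apply sepP in Ha. tauto.
- intros β Hb. destruct (closed_unbounded Hk Hw Hg Hb) as [γ [H1 [H2 [H3 H4]]]].
  exists γ. rewrite sepP. auto.
- intros δ Hd Hl H. apply sepP. split; auto. split; auto. apply closed_sup; auto.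
  intros β Hb. destruct (H β Hb) as [γ [H1 [H2 H3]]]. apply sepP in H1.
  exists γ. tauto.
- intros α Ha. apply sepP in Ha. destruct Ha as [H1 [H2 H3]]. auto.
Qed.

Lemma Cl_meets κ (P : M -> Prop) β : regular κ -> omega M ∈ κ -> Cl κ P -> β ∈ κ ->
  exists γ, γ ∈ κ /\ limit γ /\ β ∈ γ /\ P γ.
Proof.
intros Hk Hw [g [Hg HP]] Hb.
destruct (closed_unbounded Hk Hw Hg Hb) as [γ [H1 [H2 [H3 H4]]]]. eauto 6.
Qed.

Lemma Cl_inaccessible κ : inaccessible κ -> Cl κ (fun α => regular α -> inaccessible α).
Proof.
intros [Hk Hs].
destruct (choice_on empty Hs) as [g Hg].
exists g. split; [intros i Hi; destruct (Hg i Hi) as [F H]; tauto|].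
intros α Ha Hl Hc Hr. split; auto. intros β Hb. exists (g β).
assert (Hbk := ordinal_trans (regular_ordinal Hk) Ha Hb).
destruct (Hg β Hbk) as [F [_ HF]]. exists F. split; auto.
Qed.

End Cardinals.

(** * Reflection of first-order truth with second-order parameters *)

Section FirstOrder.
Context {M : ZFC}.
Implicit Types (x y z u v w X Y α β γ δ ζ η κ : M) (t s : term M) (φ ψ : fo M).

Lemma cut_of_mem β x : ordinal β -> x ∈ Vh β -> x ∩ Vh β = x.
Proof.
intros Hb Hx. apply extensionality. intro z. rewrite sepP. split; [tauto|].
intro Hz. split; auto. exact (V_trans Hb Hx Hz).
Qed.

Lemma cut_of_sub D x : x ⊆ D -> x ∩ D = x.
Proof.
intros H. apply extensionality. intro z. rewrite sepP. split; [tauto|]. auto.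
Qed.

Lemma cut_cut D E x : D ⊆ E -> (x ∩ E) ∩ D = x ∩ D.
Proof.
intros H. apply extensionality. intro z. rewrite !sepP. split; intuition.
Qed.

Lemma cut_sub D x : x ∩ D ⊆ D.
Proof. intros w Hw. apply sepP in Hw. tauto. Qed.

Lemma Cl_V_mem α x : inaccessible α -> x ∈ Vh α -> Cl α (fun β => x ∈ Vh β).
Proof.
intros Ha Hx. assert (Hl := regular_limit (proj1 Ha)).
destruct (V_rank Hl Hx) as [γ [Hg Hx']].
eapply Cl_mono; [|exact (Cl_tail Hg)]. intros δ Hd Hld Hgd.
apply (@V_mono M γ δ); auto. apply (proj1 (proj1 Hld)). auto.
Qed.

(** * Reflection of first-order formulas *)

(** The value of a second-order term may happen to be an element of V_α, and then it can occur on
    the left of ∈. Stability says that cutting u to V_β neither destroys nor creates this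
    situation. *)
Definition stable α β u : Prop :=
  (u ∈ Vh α -> u ∈ Vh β) /\ (~ u ∈ Vh α -> ~ u ∩ Vh β ∈ Vh β).

Lemma Cl_stable α u : inaccessible α -> u ⊆ Vh α -> Cl α (fun β => stable α β u).
Proof.
intros Ha Hu. assert (Hl := regular_limit (proj1 Ha)).
destruct (classic (u ∈ Vh α)) as [Hin|Hn].
- eapply Cl_mono; [|exact (Cl_V_mem Ha Hin)]. intros β _ _ Hb. split; tauto.
- assert (H : forall i, i ∈ α -> exists j, j ∈ α /\ exists y, y ∈ u /\ ~ y ∈ Vh i /\ y ∈ Vh j).
  { intros i Hi. destruct (classic (exists y, y ∈ u /\ ~ y ∈ Vh i)) as [[y [Hy Hy']]|Hc].
    - destruct (V_rank Hl (Hu y Hy)) as [j [Hj Hyj]]. exists j. eauto.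
    - destruct Hn. apply in_V. exists i. split; auto. intros w Hw. apply NNPP. eauto. }
  destruct (choice_on empty H) as [g Hg].
  exists g. split; [intros i Hi; apply Hg; auto|].
  intros β Hb Hlb Hc. split; [tauto|]. intros _ Hin.
  apply in_V in Hin. destruct Hin as [i [Hi Hs]].
  assert (Hia : i ∈ α) by exact (ordinal_trans (proj1 Hl) Hb Hi).
  destruct (Hg i Hia) as [_ [y [Hy [Hy1 Hy2]]]].
  apply Hy1, Hs, sepP. split; auto.
  apply (@V_mono M (g i) β); auto. apply (proj1 (proj1 Hlb)). apply Hc. auto.
Qed.

Lemma Cl_distinct α u w : inaccessible α -> u ⊆ Vh α -> w ⊆ Vh α -> u <> w ->
  Cl α (fun β => u ∩ Vh β <> w ∩ Vh β).
Proof.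
intros Ha Hu Hw Hn.
assert (H : exists y, y ∈ Vh α /\ ~ (y ∈ u <-> y ∈ w)).
{ apply NNPP. intro Hc. apply Hn. apply extensionality. intro z. apply NNPP. intro Hz.
  apply Hc. exists z. split; auto. apply NNPP. intro Hza. apply Hz. split; intro Hz'.
  - destruct Hza. auto.
  - destruct Hza. auto. }
destruct H as [y [Hy Hd]].
eapply Cl_mono; [|exact (Cl_V_mem Ha Hy)]. intros β _ _ Hb E.
apply Hd. assert (E' : y ∈ u ∩ Vh β <-> y ∈ w ∩ Vh β) by (rewrite E; tauto).
rewrite !sepP in E'. tauto.
Qed.

Lemma stable_mem α β u w : ordinal β -> Vh β ⊆ Vh α -> w ⊆ Vh α -> stable α β u ->
  (u ∩ Vh β ∈ w ∩ Vh β <-> u ∈ w).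
Proof.
intros Hb Hs Hw [H1 H2]. rewrite sepP. split.
- intros [H3 H4]. destruct (classic (u ∈ Vh α)) as [Hu|Hu].
  + rewrite cut_of_mem in H3; auto.
  + destruct (H2 Hu H4).
- intro H. assert (Hu := H1 (Hw u H)). rewrite cut_of_mem; auto.
Qed.

(** If only one of u and w is an element of V_α, stability alone keeps the traces apart; the last
    hypothesis covers the case that neither is. *)
Lemma stable_eq α β u w : ordinal β -> Vh β ⊆ Vh α -> stable α β u -> stable α β w ->
  (~ u ∈ Vh α -> ~ w ∈ Vh α -> u <> w -> u ∩ Vh β <> w ∩ Vh β) ->
  (u ∩ Vh β = w ∩ Vh β <-> u = w).
Proof.
intros Hb Hs [H1 H2] [H3 H4] H. split; [|congruence]. intro E.
destruct (classic (u ∈ Vh α)) as [Hu|Hu], (classic (w ∈ Vh α)) as [Hw|Hw].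
- rewrite (@cut_of_mem β u), (@cut_of_mem β w) in E; auto.
- rewrite (@cut_of_mem β u) in E; auto. destruct (H4 Hw). rewrite <- E. auto.
- rewrite (@cut_of_mem β w) in E; auto. destruct (H2 Hu). rewrite E. auto.
- apply NNPP. intro Hn. exact (H Hu Hw Hn E).
Qed.

Definition second_order t : Prop :=
  match t with Var2 _ _ | Par2 _ => True | _ => False end.

Lemma Cl_term α t (e2 : nat -> M) : inaccessible α ->
  (forall a, t = Par1 a -> a ∈ Vh α) -> (forall k, e2 k ⊆ Vh α) ->
  Cl α (fun β => forall e1, (forall n, e1 n ∈ Vh β) ->
    let u := eval e1 e2 (cut_term α t) in
    u ⊆ Vh α /\ stable α β u /\
    eval e1 (fun k => e2 k ∩ Vh β) (cut_term β t) = u ∩ Vh β).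
Proof.
intros Ha Hp He. assert (Hl := regular_limit (proj1 Ha)).
assert (Hm : forall β, β ∈ α -> Vh β ⊆ Vh α).
{ intros β Hb. apply V_mono. exact (proj1 (proj1 Hl) β Hb). }
assert (H1 : forall β x, β ∈ α -> limit β -> x ∈ Vh β -> x ⊆ Vh α /\ stable α β x /\ x = x ∩ Vh β).
{ intros β x Hb Hlb Hx. split; [|split].
  - intros w Hw. apply (Hm β Hb). exact (V_trans (proj1 Hlb) Hx Hw).
  - split; auto. intro Hn. destruct Hn. apply (Hm β); auto.
  - rewrite cut_of_mem; auto. exact (proj1 Hlb). }
destruct t as [n|a|k|A]; simpl.
- eapply Cl_mono; [|exact (Cl_limit α)]. intros β Hb Hlb _ e1 He1. apply H1; auto.
- eapply Cl_mono; [|exact (Cl_V_mem Ha (Hp a eq_refl))]. intros β Hb Hlb Hx e1 He1. apply H1; auto.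
- eapply Cl_mono; [|exact (Cl_stable Ha (He k))]. intros β Hb Hlb Hx e1 He1. split; [exact (He k)|split; [exact Hx|reflexivity]].
- eapply Cl_mono; [|exact (Cl_stable Ha (@cut_sub (Vh α) A))].
  intros β Hb Hlb Hx e1 He1. split; [apply cut_sub|]. split; [exact Hx|].
  symmetry. apply cut_cut. exact (Hm β Hb).
Qed.

Lemma eval_second_order t α (e1 e1' e2 : nat -> M) : second_order t ->
  eval e1 e2 (cut_term α t) = eval e1' e2 (cut_term α t).
Proof. destruct t; simpl; tauto. Qed.

Lemma eval_first_order t α (e1 e2 : nat -> M) : ~ second_order t ->
  (forall a, t = Par1 a -> a ∈ Vh α) -> (forall n, e1 n ∈ Vh α) ->
  eval e1 e2 (cut_term α t) ∈ Vh α.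
Proof. destruct t; simpl; try tauto; auto. Qed.

(** Values outside V_α come only from second-order terms. These do not depend on the first-order
    assignment, so one club serves all assignments. *)
Lemma Cl_term_distinct α t s (e2 : nat -> M) : inaccessible α ->
  (forall a, t = Par1 a -> a ∈ Vh α) -> (forall a, s = Par1 a -> a ∈ Vh α) ->
  (forall k, e2 k ⊆ Vh α) ->
  Cl α (fun β => forall e1, (forall n, e1 n ∈ Vh α) ->
    let u := eval e1 e2 (cut_term α t) in let w := eval e1 e2 (cut_term α s) in
    ~ u ∈ Vh α -> ~ w ∈ Vh α -> u <> w -> u ∩ Vh β <> w ∩ Vh β).
Proof.
intros Ha Ht Hs He.
destruct (classic (second_order t)) as [H1|H1]; [destruct (classic (second_order s)) as [H2|H2]|].
- pose (e0 := fun _ : nat => @empty M).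
  assert (Hsub : forall t, second_order t -> eval e0 e2 (cut_term α t) ⊆ Vh α).
  { intros t' H'. destruct t' as [| |k|A]; simpl in *; try tauto; [exact (He k)|exact (@cut_sub (Vh α) A)]. }
  destruct (classic (eval e0 e2 (cut_term α t) = eval e0 e2 (cut_term α s))) as [E|E].
  + eapply Cl_mono; [|exact (Cl_limit α)]. intros β _ _ _ e1 _ u w _ _ Hn.
    destruct Hn. unfold u, w. rewrite (eval_second_order _ e1 e0), (eval_second_order _ e1 e0 _ H2); auto.
  + eapply Cl_mono; [|exact (Cl_distinct Ha (Hsub _ H1) (Hsub _ H2) E)]. intros β _ _ Hd e1 _ u w _ _ _.
    unfold u, w. rewrite (eval_second_order _ e1 e0), (eval_second_order _ e1 e0 _ H2); auto.
- eapply Cl_mono; [|exact (Cl_limit α)]. intros β _ _ _ e1 He1 u w _ Hw. destruct Hw.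
  apply eval_first_order; auto.
- eapply Cl_mono; [|exact (Cl_limit α)]. intros β _ _ _ e1 He1 u w Hw. destruct Hw.
  apply eval_first_order; auto.
Qed.

(** Bound variables are counted too. Truth then depends on the first n entries of a total
    assignment, which is what [tuple_bound] can handle. *)
Fixpoint vars1_below φ (n : nat) : Prop :=
  match φ with
  | Mem s t | Eq s t =>
    (forall m, s = Var1 _ m -> m < n) /\ (forall m, t = Var1 _ m -> m < n)
  | Not φ => vars1_below φ n
  | And φ ψ => vars1_below φ n /\ vars1_below ψ n
  | All1 m φ => m < n /\ vars1_below φ n
  end.

Lemma vars1_below_mono φ n n' : n <= n' -> vars1_below φ n -> vars1_below φ n'.
Proof.
intro Hn. induction φ; simpl; try tauto.
- intros [H1 H2]. split; intros m Hm; [apply H1 in Hm|apply H2 in Hm]; lia.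
- intros [H1 H2]. split; intros m Hm; [apply H1 in Hm|apply H2 in Hm]; lia.
- intros [H1 H2]. split; auto. lia.
Qed.

Lemma vars1_bound φ : exists n, vars1_below φ n.
Proof.
assert (Ht : forall t : term M, exists n, forall m, t = Var1 _ m -> m < n).
{ intro t. destruct t as [k| | |]; [exists (S k); intros m [= ->]; lia|..]; exists 0; discriminate. }
induction φ as [s t|s t|φ IH|φ [n1 IH1] ψ [n2 IH2]|m φ [n IH]]; simpl; auto.
- destruct (Ht s) as [n1 H1], (Ht t) as [n2 H2]. exists (n1 + n2).
  split; intros m Hm; [apply H1 in Hm|apply H2 in Hm]; lia.
- destruct (Ht s) as [n1 H1], (Ht t) as [n2 H2]. exists (n1 + n2).
  split; intros m Hm; [apply H1 in Hm|apply H2 in Hm]; lia.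
- exists (n1 + n2). split; [apply (@vars1_below_mono φ n1)|apply (@vars1_below_mono ψ n2)]; auto; lia.
- exists (S m + n). split; [lia|]. apply (@vars1_below_mono φ n); auto; lia.
Qed.

Lemma fo_sat_below D (e1 e1' e2 : nat -> M) φ n : vars1_below φ n ->
  (forall m, m < n -> e1 m = e1' m) -> (fo_sat D e1 e2 φ <-> fo_sat D e1' e2 φ).
Proof.
assert (Ht : forall t e1 e1', (forall m, t = Var1 _ m -> m < n) -> (forall m, m < n -> e1 m = e1' m) ->
  eval e1 e2 t = eval e1' e2 t).
{ intros t a a' H H'. destruct t; simpl; auto. }
revert e1 e1'. induction φ; simpl; intros e1 e1' Hn He.
- rewrite (Ht s e1 e1'), (Ht t e1 e1'); tauto.
- rewrite (Ht s e1 e1'), (Ht t e1 e1'); tauto.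
- rewrite (IHφ e1 e1'); tauto.
- rewrite (IHφ1 e1 e1'), (IHφ2 e1 e1'); tauto.
- destruct Hn as [_ Hn]. split; intros H a Ha; specialize (H a Ha).
  + rewrite <- (IHφ (upd e1 n0 a) (upd e1' n0 a)); auto.
    intros m Hm. unfold upd. destruct (Nat.eqb m n0); auto.
  + rewrite (IHφ (upd e1 n0 a) (upd e1' n0 a)); auto.
    intros m Hm. unfold upd. destruct (Nat.eqb m n0); auto.
Qed.

Lemma vars1_below_cut α φ n : vars1_below φ n -> vars1_below (cut_fo α φ) n.
Proof.
assert (Ht : forall t, (forall m, t = Var1 _ m -> m < n) -> forall m, cut_term α t = Var1 _ m -> m < n).
{ intros t H m. destruct t; simpl; auto; discriminate. }
induction φ; simpl; intuition eauto.
Qed.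

(** Löwenheim-Skolem for one formula: the club of [β] closed under witnesses. *)
Lemma Cl_reflection α φ (e2 : nat -> M) : inaccessible α ->
  (forall a, fo_occurs φ (Par1 a) -> a ∈ Vh α) -> (forall k, e2 k ⊆ Vh α) ->
  Cl α (fun β => forall e1, (forall n, e1 n ∈ Vh β) ->
    (fo_sat (Vh β) e1 (fun k => e2 k ∩ Vh β) (cut_fo β φ) <->
     fo_sat (Vh α) e1 e2 (cut_fo α φ))).
Proof.
intros Ha Hp He. assert (Hl := regular_limit (proj1 Ha)). assert (Hr := proj1 Ha).
assert (Hm : forall β, β ∈ α -> Vh β ⊆ Vh α).
{ intros β Hb. apply V_mono. exact (proj1 (proj1 Hl) β Hb). }
induction φ as [s t|s t|φ IH|φ IH1 ψ IH2|n φ IH]; simpl in Hp.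
- eapply Cl_mono; [|apply (Cl_and Hr (@Cl_term α s e2 Ha (fun a E => Hp a (or_introl E)) He)
    (@Cl_term α t e2 Ha (fun a E => Hp a (or_intror E)) He))].
  simpl. intros β Hb Hlb [H1 H2] e1 He1.
  destruct (H1 e1 He1) as [_ [H3 ->]], (H2 e1 He1) as [H4 [_ ->]].
  apply (@stable_mem α); auto; [exact (proj1 Hlb)|exact (Hm β Hb)].
- eapply Cl_mono; [|apply (Cl_and Hr (Cl_and Hr (@Cl_term α s e2 Ha (fun a E => Hp a (or_introl E)) He)
    (@Cl_term α t e2 Ha (fun a E => Hp a (or_intror E)) He))
    (@Cl_term_distinct α s t e2 Ha (fun a E => Hp a (or_introl E)) (fun a E => Hp a (or_intror E)) He))].
  simpl. intros β Hb Hlb [[H1 H2] H3] e1 He1.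
  destruct (H1 e1 He1) as [_ [H4 ->]], (H2 e1 He1) as [_ [H5 ->]].
  apply (@stable_eq α); auto; [exact (proj1 Hlb)|exact (Hm β Hb)|]. apply H3.
  intro n. apply (Hm β Hb); auto.
- eapply Cl_mono; [|exact (IH Hp)]. simpl. intros β Hb Hlb H e1 He1.
  rewrite (H e1 He1). tauto.
- eapply Cl_mono; [|exact (Cl_and Hr (IH1 (fun a E => Hp a (or_introl E))) (IH2 (fun a E => Hp a (or_intror E))))].
  simpl. intros β Hb Hlb [H1 H2] e1 He1. rewrite (H1 e1 He1), (H2 e1 He1). tauto.
- destruct (vars1_bound φ) as [N HN].
  pose (Bad := fun e1 a => ~ fo_sat (Vh α) (upd e1 n a) e2 (cut_fo α φ)).
  assert (HBad : forall e1 e1' a, (forall m, m < N -> e1 m = e1' m) -> Bad e1 a -> Bad e1' a).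
  { intros e1 e1' a H HB. unfold Bad in *. intro H'. apply HB.
    refine (proj1 (fo_sat_below (Vh α) e2 (vars1_below_cut α HN) _) H').
    intros m Hm'. unfold upd. destruct (Nat.eqb m n); auto. symmetry. auto. }
  (* Tarski-Vaught: some stage below α contains a counterexample for every tuple from V_i that has
     one at all. *)
  assert (H : forall i, i ∈ α -> exists j, j ∈ α /\ forall e1, (forall m, m < N -> e1 m ∈ Vh i) ->
    (exists a, a ∈ Vh α /\ Bad e1 a) -> exists a, a ∈ Vh j /\ Bad e1 a).
  { intros i Hi. apply (@tuple_bound M α i N (fun e1 j =>
      (exists a, a ∈ Vh α /\ Bad e1 a) -> exists a, a ∈ Vh j /\ Bad e1 a)); auto.
    - intros e γ γ' Hg Hj Hex. destruct (Hj Hex) as [a [H1 H2]]. exists a. split; auto.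
      exact (V_mono Hg H1).
    - intros e e' γ Hee Hj [a [H1 H2]].
      destruct Hj as [a' [H3 H4]]; eauto.
      exists a. split; auto. apply (@HBad e'); auto. intros m Hm'. symmetry. auto.
    - intro e. destruct (classic (exists a, a ∈ Vh α /\ Bad e a)) as [[a [H1 H2]]|Hn].
      + destruct (V_rank Hl H1) as [j [Hj Haj]]. exists j. eauto.
      + exists i. tauto. }
  destruct (choice_on empty H) as [g Hg].
  assert (Hgc : closed g α) by (intros i Hi; apply Hg; auto).
  eapply Cl_mono; [|exact (Cl_and Hr (IH Hp) (Cl_closed Hgc))]. simpl.
  intros β Hb Hlb [HI Hc] e1 He1.
  assert (Hupd : forall a, a ∈ Vh β -> forall m, upd e1 n a m ∈ Vh β).
  { intros a Haa m. unfold upd. destruct (Nat.eqb m n); auto. }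
  split; intros Hs a Haa.
  + apply NNPP. intro HB.
    (* As β is a limit, the finitely many relevant entries of the assignment lie in a common V_i
       with i < β. *)
    assert (Hi : exists i, i ∈ β /\ forall m, m < N -> e1 m ∈ Vh i).
    { clear - Hlb He1. induction N as [|N [i [Hi IH]]].
      - exists empty. split; [exact (limit_num_in 0 Hlb)|lia].
      - destruct (V_rank Hlb (He1 N)) as [j [Hj HNj]].
        destruct (ordinal_max (proj1 Hlb) Hi Hj) as [μ [H0 [H1 H2]]].
        exists μ. split; auto. intros m Hm.
        destruct (Nat.eq_dec m N) as [->|]; [exact (V_mono H2 HNj)|].
        apply (V_mono H1). apply IH. lia. }
    destruct Hi as [i [Hi Hie]].
    destruct (proj2 (Hg i (ordinal_trans (proj1 Hl) Hb Hi)) e1 Hie) as [a' [H1 H2]].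
    { exists a. split; auto. }
    apply H2. assert (Ha' : a' ∈ Vh β).
    { apply (@V_mono M (g i) β); auto. apply (proj1 (proj1 Hlb)). auto. }
    apply HI; auto.
  + apply HI; auto. apply Hs. apply (Hm β); auto.
Qed.

End FirstOrder.

(** * Tuples of moves and the first-order formulas that test them *)

Section Sequences.
Context {M : ZFC}.
Implicit Types (x y z u v w X Y α β γ δ ζ η κ : M) (t s : term M) (φ ψ : fo M).

(** The base v is an accumulator, so that a formula can build the tuple with one running variable;
    the last entry of the list ends up outermost. *)
Fixpoint tuple v (l : list M) : M :=
  match l with nil => v | x :: l => tuple (opair x v) l end.

Lemma tuple_app v l x : tuple v (l ++ x :: nil) = opair x (tuple v l).
Proof. revert v. induction l as [|y l IH]; intro v; simpl; auto. Qed.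

(** The entries are peeled off from the outside; lists of different lengths would make a limit stage
    equal to an ordered pair. *)
Lemma tuple_inj α β l l' : limit α -> limit β ->
  tuple (Vh α) l = tuple (Vh β) l' -> α = β /\ l = l'.
Proof.
intros Ha Hb. revert l'. induction l as [|x l IH] using rev_ind; intro l';
  destruct l' as [|x' l' _] using rev_ind; rewrite ?tuple_app; simpl; intro E.
- split; auto. apply V_inj; auto; [exact (proj1 Ha)|exact (proj1 Hb)].
- destruct (V_limit_not_opair Ha E).
- symmetry in E. destruct (V_limit_not_opair Hb E).
- apply opair_inj in E. destruct E as [-> E]. apply IH in E. destruct E as [-> ->]. auto.
Qed.

Lemma V_tuple α v l : limit α -> v ∈ Vh α -> Forall (fun x => x ∈ Vh α) l -> tuple v l ∈ Vh α.
Proof.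
intro Ha. revert v. induction l as [|x l IH]; intros v Hv Hl; simpl; auto.
inversion Hl; subst. apply IH; auto. apply V_opair; auto.
Qed.

Definition cutl β (l : list M) : list M := map (fun x => x ∩ Vh β) l.

Lemma cutl_app β l l' : cutl β (l ++ l') = cutl β l ++ cutl β l'.
Proof. apply map_app. Qed.

Lemma V_tuple_cut α β l : limit α -> β ∈ α -> tuple (Vh β) (cutl β l) ∈ Vh α.
Proof.
intros Hl Hb. apply V_tuple; auto; [apply V_in; auto|].
apply Forall_forall. intros x Hx. apply in_map_iff in Hx. destruct Hx as [y [<- _]].
apply (@V_sub M α (Vh β)); [apply V_in; auto|apply cut_sub].
Qed.

(** * First-order formulas *)

Definition Imp φ ψ : fo M := Not (And φ (Not ψ)).
Definition Or φ ψ : fo M := Not (And (Not φ) (Not ψ)).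
Definition Iff φ ψ : fo M := And (Imp φ ψ) (Imp ψ φ).
Definition Ex1 n φ : fo M := Not (All1 n (Not φ)).
Definition V n : term M := Var1 M n.

Lemma sat_Imp D e1 e2 φ ψ : fo_sat D e1 e2 (Imp φ ψ) <-> (fo_sat D e1 e2 φ -> fo_sat D e1 e2 ψ).
Proof. simpl. tauto. Qed.
Lemma sat_Or D e1 e2 φ ψ : fo_sat D e1 e2 (Or φ ψ) <-> (fo_sat D e1 e2 φ \/ fo_sat D e1 e2 ψ).
Proof. simpl. tauto. Qed.
Lemma sat_Iff D e1 e2 φ ψ : fo_sat D e1 e2 (Iff φ ψ) <-> (fo_sat D e1 e2 φ <-> fo_sat D e1 e2 ψ).
Proof. simpl. tauto. Qed.
Lemma sat_Ex1 D e1 e2 n φ : fo_sat D e1 e2 (Ex1 n φ) <-> exists a, a ∈ D /\ fo_sat D (upd e1 n a) e2 φ.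
Proof.
simpl. split.
- intro H. apply NNPP. intro Hn. apply H. intros a Ha Hs. eauto.
- intros [a [Ha Hs]] H. exact (H a Ha Hs).
Qed.

Definition not_var1 t : Prop := match t with Var1 _ _ => False | _ => True end.
Definition value (e2 : nat -> M) t : M := eval (fun _ => empty) e2 t.

Lemma eval_not_var1 e1 e2 t : not_var1 t -> eval e1 e2 t = value e2 t.
Proof. destruct t; simpl; tauto. Qed.

Lemma not_var1_cut α t : not_var1 t -> not_var1 (cut_term α t).
Proof. destruct t; simpl; tauto. Qed.

(** While tuples are built, first-order variables act as registers: 0 holds the stage, 1 the tuple
    so far, 2 the entry to be added, and 3 to 5 are scratch. *)
Definition is_pair n : fo M := All1 5 (Iff (Mem (V 5) (V 4)) (Or (Eq (V 5) (V 2)) (Eq (V 5) (V n)))).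

(** Sets the first-order variable [1] to the ordered pair of the variables [2] and [1]. *)
Definition with_opair φ : fo M :=
  All1 3 (Imp (All1 4 (Iff (Mem (V 4) (V 3)) (Or (is_pair 2) (is_pair 1))))
   (All1 1 (Imp (Eq (V 1) (V 3)) φ))).

Fixpoint tuple_in (l : list (term M)) (T : term M) : fo M :=
  match l with
  | nil => Mem (V 1) T
  | t :: l => All1 2 (Imp (All1 3 (Iff (Mem (V 3) (V 2)) (And (Mem (V 3) t) (Mem (V 3) (V 0)))))
      (with_opair (tuple_in l T)))
  end.

Definition cofinal_fo t : fo M :=
  All1 0 (Ex1 1 (And (Mem (V 1) t) (Mem (V 0) (V 1)))).
Definition accum_fo t : fo M :=
  All1 1 (Imp (Mem (V 1) (V 0))
    (Ex1 2 (And (Mem (V 2) t) (And (Mem (V 2) (V 0)) (Mem (V 1) (V 2)))))).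
(** Stages are recognised by membership in the parameter [tV], which spares a first-order definition
    of the hierarchy. The last quantifier copies the stage into register 1 as the base of the
    tuple. *)
Definition leaf_fo (tV tR : term M) (l : list (term M)) : fo M :=
  let d := last l (Par1 empty) in
  And (cofinal_fo d)
    (All1 0 (Imp (Mem (V 0) tV) (Imp (accum_fo d) (All1 1 (Imp (Eq (V 1) (V 0)) (tuple_in l tR)))))).
(** The stage in register 0 is guessed; for the intended [tW], membership in it forces the guess to
    be V_β for the β in register 2. *)
Definition hit_fo (tZ tW : term M) (l : list (term M)) : fo M :=
  Ex1 2 (And (Mem (V 2) tZ) (Ex1 0 (All1 1 (Imp (Eq (V 1) (V 0)) (with_opair (tuple_in l tW)))))).

Definition cofinal D d : Prop := forall x, x ∈ D -> exists w, w ∈ D /\ w ∈ d /\ x ∈ w.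
(** The same condition as [cofinal] with the arguments exchanged: [cofinal] is applied to the whole
    domain, [accum] to a stage inside it. Having D cofinal in V_α is thus the instance at α of the
    condition imposed on the smaller β. *)
Definition accum d v : Prop := forall y, y ∈ v -> exists w, w ∈ d /\ w ∈ v /\ y ∈ w.

Section Semantics.
Variables (α : M) (e2 : nat -> M).
Hypothesis Hα : limit α.
Let D := Vh α.

Lemma D_trans x y : x ∈ D -> y ∈ x -> y ∈ D.
Proof. apply V_trans, Hα. Qed.

Lemma sat_is_pair e1 n : n = 1 \/ n = 2 -> e1 4 ∈ D -> e1 2 ∈ D -> e1 n ∈ D ->
  (fo_sat D e1 e2 (is_pair n) <-> e1 4 = pair (e1 2) (e1 n)).
Proof.
intros Hn H4 H2 H1. unfold is_pair. cbn [fo_sat].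
assert (E : forall w, upd e1 5 w n = e1 n) by (intro w; destruct Hn as [-> | ->]; reflexivity).
transitivity (forall w, w ∈ D -> (w ∈ e1 4 <-> w = e1 2 \/ w = e1 n)).
{ split; intros H w Hw; specialize (H w Hw).
  - rewrite sat_Iff, sat_Or in H. cbn in H. rewrite E in H. exact H.
  - rewrite sat_Iff, sat_Or. cbn. rewrite E. exact H. }
split.
- intro H. apply extensionality. intro w. rewrite pairP. split; intro Hw.
  + apply H; auto. exact (D_trans H4 Hw).
  + apply H; auto. destruct Hw as [-> | ->]; auto.
- intros -> w _. rewrite pairP. tauto.
Qed.

Lemma sat_with_opair e1 φ : e1 1 ∈ D -> e1 2 ∈ D ->
  let p := opair (e1 2) (e1 1) in
  fo_sat D e1 e2 (with_opair φ) <-> fo_sat D (upd (upd e1 3 p) 1 p) e2 φ.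
Proof.
intros H1 H2 p. unfold with_opair.
assert (Hp : p ∈ D) by (apply V_opair; auto).
assert (Hs : forall q, q ∈ D ->
  (fo_sat D (upd e1 3 q) e2 (All1 4 (Iff (Mem (V 4) (V 3)) (Or (is_pair 2) (is_pair 1)))) <-> q = p)).
{ intros q Hq. cbn [fo_sat].
  transitivity (forall w, w ∈ D -> (w ∈ q <-> w = pair (e1 2) (e1 2) \/ w = pair (e1 2) (e1 1))).
  - assert (HP : forall w n, w ∈ D -> n = 1 \/ n = 2 -> e1 n ∈ D ->
      (fo_sat D (upd (upd e1 3 q) 4 w) e2 (is_pair n) <-> w = pair (e1 2) (e1 n))).
    { intros w n Hw Hn Hen. rewrite sat_is_pair; auto; destruct Hn as [-> | ->]; cbn; auto; tauto. }
    split; intros H w Hw; specialize (H w Hw).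
    + rewrite sat_Iff, sat_Or, !HP in H; auto.
    + rewrite sat_Iff, sat_Or, !HP; auto.
  - unfold p. split.
    + intro H. apply extensionality. intro w. unfold opair. rewrite pairP. split; intro Hw.
      * apply H; auto. exact (D_trans Hq Hw).
      * apply H; auto. destruct Hw as [-> | ->]; apply V_pair; auto.
    + intros -> w _. unfold opair. rewrite pairP. tauto. }
cbn [fo_sat]. split.
- intro H. specialize (H p Hp). rewrite sat_Imp, Hs in H; auto. specialize (H eq_refl).
  specialize (H p Hp). rewrite sat_Imp in H. apply H. reflexivity.
- intros H q Hq. rewrite sat_Imp, Hs; auto. intros -> r Hr. rewrite sat_Imp. cbn. intros ->. exact H.
Qed.

Lemma sat_tuple_in l T e1 : Forall not_var1 l -> not_var1 T -> e1 0 ∈ D -> e1 1 ∈ D ->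
  (fo_sat D e1 e2 (tuple_in l T) <->
   tuple (e1 1) (map (fun t => value e2 t ∩ e1 0) l) ∈ value e2 T).
Proof.
intros Hl HT. revert e1. induction Hl as [|t l Ht Hl IH]; intros e1 H0 H1.
- cbn. rewrite (eval_not_var1 _ _ HT). tauto.
- cbn [tuple_in]. pose (c := value e2 t ∩ e1 0).
  assert (Hc : c ∈ D).
  { apply (V_sub H0). apply cut_sub. }
  assert (Hs : forall q, q ∈ D -> (fo_sat D (upd e1 2 q) e2
     (All1 3 (Iff (Mem (V 3) (V 2)) (And (Mem (V 3) t) (Mem (V 3) (V 0))))) <-> q = c)).
  { intros q Hq. cbn [fo_sat].
    transitivity (forall w, w ∈ D -> (w ∈ q <-> w ∈ value e2 t /\ w ∈ e1 0)).
    - split; intros H w Hw; specialize (H w Hw).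
      + rewrite sat_Iff in H. cbn in H. rewrite (eval_not_var1 _ _ Ht) in H. exact H.
      + rewrite sat_Iff. cbn. rewrite (eval_not_var1 _ _ Ht). exact H.
    - split.
      + intro H. apply extensionality. intro w. unfold c. rewrite sepP. split; intro Hw.
        * apply H; auto. exact (D_trans Hq Hw).
        * apply H; auto. exact (D_trans H0 (proj2 Hw)).
      + intros -> w _. unfold c. rewrite sepP. tauto. }
  assert (Hgo : fo_sat D (upd e1 2 c) e2 (with_opair (tuple_in l T)) <->
    tuple (e1 1) (map (fun t => value e2 t ∩ e1 0) (t :: l)) ∈ value e2 T).
  { rewrite sat_with_opair; auto. cbn. rewrite IH; cbn; auto; [tauto|].
    apply V_opair; auto. }
  cbn [fo_sat]. split.
  + intro H. specialize (H c Hc). rewrite sat_Imp, Hs in H; auto. apply Hgo. auto.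
  + intros H q Hq. rewrite sat_Imp, Hs; auto. intros ->. apply Hgo. auto.
Qed.

Lemma sat_cofinal e1 t : not_var1 t ->
  (fo_sat D e1 e2 (cofinal_fo t) <-> cofinal D (value e2 t)).
Proof.
intro Ht. unfold cofinal_fo, cofinal. cbn [fo_sat].
split; intros H x Hx; specialize (H x Hx).
- rewrite sat_Ex1 in H. destruct H as [w [Hw H]]. cbn in H.
  rewrite (eval_not_var1 _ _ Ht) in H. eauto.
- rewrite sat_Ex1. destruct H as [w [Hw H]]. exists w. cbn.
  rewrite (eval_not_var1 _ _ Ht). auto.
Qed.

Lemma sat_accum e1 t : not_var1 t -> e1 0 ∈ D ->
  (fo_sat D e1 e2 (accum_fo t) <-> accum (value e2 t) (e1 0)).
Proof.
intros Ht H0. unfold accum_fo, accum. cbn [fo_sat]. split.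
- intros H y Hy. assert (HyD := D_trans H0 Hy). specialize (H y HyD).
  rewrite sat_Imp, sat_Ex1 in H. destruct (H Hy) as [w [Hw Hs]]. cbn in Hs.
  rewrite (eval_not_var1 _ _ Ht) in Hs. exists w. tauto.
- intros H y Hy. rewrite sat_Imp, sat_Ex1. cbn. intro Hy0.
  destruct (H y Hy0) as [w [H1 [H2 H3]]]. exists w.
  rewrite (eval_not_var1 _ _ Ht). split; auto. exact (D_trans H0 H2).
Qed.

Definition leaf R h : Prop :=
  let d := last h empty in
  cofinal D d /\ forall β, β ∈ α -> limit β -> accum d (Vh β) -> tuple (Vh β) (cutl β h) ∈ R.

Lemma sat_leaf e1 tV tR l : Forall not_var1 l -> not_var1 tR -> not_var1 tV ->
  (forall v, v ∈ D -> (v ∈ value e2 tV <-> exists β, β ∈ α /\ limit β /\ v = Vh β)) ->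
  (fo_sat D e1 e2 (leaf_fo tV tR l) <-> leaf (value e2 tR) (map (value e2) l)).
Proof.
intros Hl HR HV HVV.
assert (Hd : not_var1 (last l (Par1 empty))).
{ clear - Hl. induction Hl as [|t l Ht Hl IH]; simpl; auto. destruct l; auto. }
assert (Ed : last (map (value e2) l) empty = value e2 (last l (Par1 empty))).
{ clear. induction l as [|t l IH]; simpl; auto. destruct l; auto. }
unfold leaf_fo, leaf. cbn zeta. cbn [fo_sat]. rewrite sat_cofinal, Ed; auto.
apply and_iff_compat_l.
assert (Hstep : forall v, v ∈ D -> (fo_sat D (upd e1 0 v) e2 (All1 1 (Imp (Eq (V 1) (V 0)) (tuple_in l tR))) <->
  tuple v (map (fun t => value e2 t ∩ v) l) ∈ value e2 tR)).
{ intros v Hv. cbn [fo_sat]. transitivity (fo_sat D (upd (upd e1 0 v) 1 v) e2 (tuple_in l tR)).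
  - split.
    + intro H. specialize (H v Hv). rewrite sat_Imp in H. apply H. reflexivity.
    + intros H w Hw. rewrite sat_Imp. cbn. intros ->. exact H.
  - rewrite sat_tuple_in; auto. cbn. tauto. }
split.
- intros H β Hb Hlb Hac. assert (HvD : Vh β ∈ D) by (apply V_in; auto).
  specialize (H (Vh β) HvD). rewrite !sat_Imp, Hstep, sat_accum in H; auto.
  unfold cutl. rewrite map_map. apply H; auto. cbn.
  rewrite (eval_not_var1 _ _ HV), HVV; eauto.
- intros H v Hv. rewrite !sat_Imp, Hstep, sat_accum; auto. cbn.
  rewrite (eval_not_var1 _ _ HV), HVV; auto. intros [β [Hb [Hlb ->]]] Hac.
  specialize (H β Hb Hlb Hac). unfold cutl in H. rewrite map_map in H. exact H.
Qed.

Lemma sat_hit e1 tZ tW l : Forall not_var1 l -> not_var1 tZ -> not_var1 tW ->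
  (fo_sat D e1 e2 (hit_fo tZ tW l) <->
   exists β v, β ∈ D /\ v ∈ D /\ β ∈ value e2 tZ /\
     tuple (opair β v) (map (fun t => value e2 t ∩ v) l) ∈ value e2 tW).
Proof.
intros Hl HZ HW. unfold hit_fo. rewrite sat_Ex1.
assert (Hstep : forall β v, β ∈ D -> v ∈ D ->
  (fo_sat D (upd (upd e1 2 β) 0 v) e2 (All1 1 (Imp (Eq (V 1) (V 0)) (with_opair (tuple_in l tW)))) <->
  tuple (opair β v) (map (fun t => value e2 t ∩ v) l) ∈ value e2 tW)).
{ intros β v Hb Hv. cbn [fo_sat].
  transitivity (fo_sat D (upd (upd (upd e1 2 β) 0 v) 1 v) e2 (with_opair (tuple_in l tW))).
  - split.
    + intro H. specialize (H v Hv). rewrite sat_Imp in H. apply H. reflexivity.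
    + intros H w Hw. rewrite sat_Imp. cbn. intros ->. exact H.
  - rewrite sat_with_opair; auto. cbn. rewrite sat_tuple_in; auto; cbn; [tauto|].
    apply V_opair; auto. }
split.
- intros [β [Hb [HbZ H]]]. rewrite sat_Ex1 in H. destruct H as [v [Hv H]].
  rewrite Hstep in H; auto. cbn in HbZ. rewrite (eval_not_var1 _ _ HZ) in HbZ. eauto 6.
- intros [β [v [Hb [Hv [HbZ H]]]]]. exists β. split; auto. split.
  + cbn. rewrite (eval_not_var1 _ _ HZ). exact HbZ.
  + rewrite sat_Ex1. exists v. split; auto. apply Hstep; auto.
Qed.

End Semantics.

(** * Restriction and occurrences *)

Lemma cut_tuple_in β l T : cut_fo β (tuple_in l T) = tuple_in (map (cut_term β) l) (cut_term β T).
Proof.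
induction l as [|t l IH]; cbn; [reflexivity|]. rewrite IH. reflexivity.
Qed.

Lemma cut_leaf β tV tR l :
  cut_fo β (leaf_fo tV tR l) = leaf_fo (cut_term β tV) (cut_term β tR) (map (cut_term β) l).
Proof.
assert (E : last (map (cut_term β) l) (Par1 empty) = cut_term β (last l (Par1 empty))).
{ induction l as [|t l IH]; simpl; auto. destruct l; auto. }
unfold leaf_fo. cbn zeta. rewrite E. cbn. rewrite cut_tuple_in. reflexivity.
Qed.

Lemma cut_hit β tZ tW l :
  cut_fo β (hit_fo tZ tW l) = hit_fo (cut_term β tZ) (cut_term β tW) (map (cut_term β) l).
Proof. cbn. rewrite cut_tuple_in. reflexivity. Qed.

Lemma cut_cofinal β t : cut_fo β (cofinal_fo t) = cofinal_fo (cut_term β t).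
Proof. reflexivity. Qed.

Lemma occurs_tuple_in l T s : not_var1 s -> fo_occurs (tuple_in l T) s -> s = T \/ In s l.
Proof.
intro Hs. induction l as [|t l IH]; cbn.
- intros [<-|<-]; auto.
- intro H. repeat (destruct H as [H|H]); subst; try (destruct Hs); auto; apply IH in H; tauto.
Qed.

Lemma last_in (A : Type) (l : list A) (d : A) : last l d = d \/ In (last l d) l.
Proof.
induction l as [|x l IH]; simpl; auto. destruct l; auto. destruct IH; auto.
Qed.

Lemma occurs_leaf tV tR l s : not_var1 s -> fo_occurs (leaf_fo tV tR l) s ->
  s = tV \/ s = tR \/ s = Par1 empty \/ In s l.
Proof.
intros Hs H. assert (Hla := last_in l (Par1 empty)). unfold leaf_fo in H. cbn zeta in H.
set (d := last l (Par1 empty)) in *. cbn in H.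
assert (Hd : d = s -> s = Par1 empty \/ In s l) by (intros <-; auto).
repeat (destruct H as [H|H]); try (subst s; destruct Hs; fail); auto.
all: try (apply Hd in H; tauto).
apply occurs_tuple_in in H; tauto.
Qed.

Lemma occurs_hit tZ tW l s : not_var1 s -> fo_occurs (hit_fo tZ tW l) s ->
  s = tZ \/ s = tW \/ In s l.
Proof.
intros Hs H. cbn in H.
repeat (destruct H as [H|H]); try (subst s; destruct Hs; fail); auto.
apply occurs_tuple_in in H; tauto.
Qed.

Lemma occurs_cofinal t s : not_var1 s -> fo_occurs (cofinal_fo t) s -> s = t.
Proof.
intros Hs H. cbn in H.
repeat (destruct H as [H|H]); try (subst s; destruct Hs; fail); auto.
Qed.

Lemma V_eq m n : V m = V n <-> m = n.
Proof. unfold V. split; [intros [= E]; exact E|congruence]. Qed.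

Lemma not_var1_V t n : not_var1 t -> t = V n <-> False.
Proof. intro Ht. split; [intros ->; exact Ht|tauto]. Qed.

Lemma free1_tuple_in l T n : Forall not_var1 l -> not_var1 T ->
  fo_free1 (tuple_in l T) n -> n = 0 \/ n = 1.
Proof.
intros Hl HT. induction Hl as [|t l Ht Hl IH]; cbn.
- rewrite V_eq, (not_var1_V n HT). lia.
- change (Var1 M n) with (V n). rewrite !V_eq, (not_var1_V n Ht). intro H.
  destruct (classic (fo_free1 (tuple_in l T) n)) as [Hf|Hf]; [auto|].
  assert (E : fo_free1 (tuple_in l T) n <-> False) by tauto. rewrite E in H. lia.
Qed.

Lemma free1_leaf tV tR l n : Forall not_var1 l -> not_var1 tV -> not_var1 tR ->
  ~ fo_free1 (leaf_fo tV tR l) n.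
Proof.
intros Hl HV HR. assert (Hd : not_var1 (last l (Par1 empty))).
{ clear - Hl. induction Hl as [|t l Ht Hl IH]; simpl; auto. destruct l; auto. }
assert (Hf := @free1_tuple_in l tR n Hl HR).
unfold leaf_fo. cbn zeta. set (d := last l (Par1 empty)) in *. cbn.
change (Var1 M n) with (V n). rewrite !V_eq, (not_var1_V n Hd), (not_var1_V n HV).
intro H. destruct (classic (fo_free1 (tuple_in l tR) n)) as [Hf'|Hf'].
- apply Hf in Hf'. intuition lia.
- assert (E : fo_free1 (tuple_in l tR) n <-> False) by tauto. rewrite E in H. lia.
Qed.

Lemma free1_hit tZ tW l n : Forall not_var1 l -> not_var1 tZ -> not_var1 tW ->
  ~ fo_free1 (hit_fo tZ tW l) n.
Proof.
intros Hl HZ HW. assert (Hf := @free1_tuple_in l tW n Hl HW). cbn.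
change (Var1 M n) with (V n). rewrite !V_eq, (not_var1_V n HZ).
intro H. destruct (classic (fo_free1 (tuple_in l tW) n)) as [Hf'|Hf'].
- apply Hf in Hf'. intuition lia.
- assert (E : fo_free1 (tuple_in l tW) n <-> False) by tauto. rewrite E in H. lia.
Qed.

Lemma free1_cofinal t n : not_var1 t -> ~ fo_free1 (cofinal_fo t) n.
Proof.
intros Ht. cbn. change (Var1 M n) with (V n). rewrite !V_eq, (not_var1_V n Ht). lia.
Qed.

End Sequences.

Lemma predicate_ext (A : Type) (P Q : A -> Prop) : (forall x, P x <-> Q x) -> P = Q.
Proof.
intro H. apply functional_extensionality. intro x. apply propositional_extensionality, H.
Qed.

Lemma Finite_iff_list (A : Type) (P : A -> Prop) :
  Finite_sets.Finite A P <-> exists l, forall x, P x -> In x l.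
Proof.
split.
- intro H. induction H as [|B H [l IH] x Hx].
  + exists nil. intros x Hx. destruct Hx.
  + exists (x :: l). intros y Hy. destruct Hy as [y Hy|y Hy].
    * right. apply IH. exact Hy.
    * left. destruct Hy. reflexivity.
- intros [l H]. revert P H. induction l as [|a l IH]; intros P H.
  + replace P with (Ensembles.Empty_set A); [constructor|].
    apply predicate_ext. intro x. split; [intros []|intro Hx; destruct (H x Hx)].
  + assert (HF : Finite_sets.Finite A (fun x => P x /\ x <> a)).
    { apply IH. intros x [Hx Hne]. destruct (H x Hx); [congruence|assumption]. }
    destruct (classic (P a)) as [Ha|Ha].
    * replace P with (Ensembles.Add A (fun x => P x /\ x <> a) a).
      -- constructor; [exact HF|]. intros [_ Hne]. exact (Hne eq_refl).
      -- apply predicate_ext. intro x. split.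
         ++ intros [y [Hy _]|y []]; auto.
         ++ intro Hx. destruct (classic (x = a)) as [->|Hne]; [right; constructor|left; split; auto].
    * replace P with (fun x => P x /\ x <> a); [exact HF|].
      apply predicate_ext. intro x. split; [tauto|]. intro Hx. split; [auto|congruence].
Qed.

(** * Restriction of formulas at well-behaved ordinals *)

Section Restriction.
Context {M : ZFC}.
Implicit Types (x y z u v w X Y α β γ δ ζ η κ ξ : M) (φ : formula M) (p : bool).

(** * Polarities *)

Definition is_PS p κ η φ : Prop := if p then is_Pi κ η φ else is_Sigma κ η φ.
Definition quants p ks φ : formula M := if p then alls2 ks φ else exs2 ks φ.
Definition big p ξ (ψ : M -> formula M) : formula M := if p then BigAnd ξ ψ else BigOr ξ ψ.

Scheme is_Pi_min := Minimality for is_Pi Sort Prop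
with is_Sigma_min := Minimality for is_Sigma Sort Prop.

Lemma is_PS_ind κ (Q : bool -> M -> formula M -> Prop) :
  (forall p (φ : fo M), (forall a, fo_occurs φ (Par1 a) -> a ∈ Vh κ) ->
    (forall A, fo_occurs φ (Par2 A) -> A ⊆ Vh κ) -> Q p empty (FO φ)) ->
  (forall p ζ ks ψ, is_PS (negb p) κ ζ ψ -> Q (negb p) ζ ψ -> Q p (succ ζ) (quants p ks ψ)) ->
  (forall p ξ ψ, limit ξ -> (forall ζ, ζ ∈ ξ -> is_PS p κ ζ (ψ ζ)) ->
    (forall ζ, ζ ∈ ξ -> Q p ζ (ψ ζ)) -> finitary2 (big p ξ ψ) -> Q p ξ (big p ξ ψ)) ->
  forall p η φ, is_PS p κ η φ -> Q p η φ.
Proof.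
intros H0 HS HL p η φ H. destruct p.
- apply (@is_Pi_min M κ (Q true) (Q false)); auto.
  + intros ξ ks ψ. apply (HS true).
  + intros ξ ψ. apply (HL true).
  + intros ξ ks ψ. apply (HS false).
  + intros ξ ψ. apply (HL false).
- apply (@is_Sigma_min M κ (Q true) (Q false)); auto.
  + intros ξ ks ψ. apply (HS true).
  + intros ξ ψ. apply (HL true).
  + intros ξ ks ψ. apply (HS false).
  + intros ξ ψ. apply (HL false).
Qed.

Lemma is_PS_zero p κ (φ : fo M) : (forall a, fo_occurs φ (Par1 a) -> a ∈ Vh κ) ->
  (forall A, fo_occurs φ (Par2 A) -> A ⊆ Vh κ) -> is_PS p κ empty (FO φ).
Proof. destruct p; constructor; auto. Qed.

Lemma is_PS_succ p κ ζ ks ψ : is_PS (negb p) κ ζ ψ -> is_PS p κ (succ ζ) (quants p ks ψ).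
Proof. destruct p; constructor; auto. Qed.

Lemma is_PS_limit p κ ξ ψ : limit ξ -> (forall ζ, ζ ∈ ξ -> is_PS p κ ζ (ψ ζ)) ->
  finitary2 (big p ξ ψ) -> is_PS p κ ξ (big p ξ ψ).
Proof. destruct p; constructor; auto. Qed.

Lemma is_PS_ordinal p κ η φ : is_PS p κ η φ -> ordinal η.
Proof.
apply (@is_PS_ind κ (fun p η φ => ordinal η)); clear.
- intros. apply ordinal_empty.
- intros. apply ordinal_succ; auto.
- intros p ξ ψ H _ _ _. exact (proj1 H).
Qed.

Lemma free2_quants p ks ψ k : free2 (quants p ks ψ) k <-> ~ In k ks /\ free2 ψ k.
Proof.
destruct p; unfold quants, alls2, exs2; induction ks as [|j ks IH]; simpl; try tauto;
  rewrite IH; intuition.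
Qed.

Lemma par2_quants p ks ψ A : par2 (quants p ks ψ) A <-> par2 ψ A.
Proof.
destruct p; unfold quants, alls2, exs2; induction ks as [|j ks IH]; simpl; try tauto.
Qed.

Lemma free1_quants p ks ψ n : free1 (quants p ks ψ) n <-> free1 ψ n.
Proof.
destruct p; unfold quants, alls2, exs2; induction ks as [|j ks IH]; simpl; try tauto.
Qed.

Lemma free2_big p ξ ψ k : free2 (big p ξ ψ) k <-> exists ζ, ζ ∈ ξ /\ free2 (ψ ζ) k.
Proof. destruct p; simpl; tauto. Qed.

Lemma par2_big p ξ ψ A : par2 (big p ξ ψ) A <-> exists ζ, ζ ∈ ξ /\ par2 (ψ ζ) A.
Proof. destruct p; simpl; tauto. Qed.

Lemma free1_big p ξ ψ n : free1 (big p ξ ψ) n <-> exists ζ, ζ ∈ ξ /\ free1 (ψ ζ) n.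
Proof. destruct p; simpl; tauto. Qed.

Lemma cut_quants α p ks ψ : cut α (quants p ks ψ) = quants p ks (cut α ψ).
Proof.
destruct p; unfold quants, alls2, exs2; induction ks as [|j ks IH]; simpl; congruence.
Qed.

Lemma cut_big α p ξ ψ : cut α (big p ξ ψ) = big p ξ (fun ζ => cut α (ψ ζ)).
Proof. destruct p; reflexivity. Qed.

Lemma finitary2_by φ φ' (f : M -> M) : finitary2 φ ->
  (forall k, free2 φ' k -> free2 φ k) ->
  (forall A, par2 φ' A -> exists P, par2 φ P /\ A = f P) -> finitary2 φ'.
Proof.
intros [H1 H2] Hf Hp. apply Finite_iff_list in H1, H2.
destruct H1 as [l1 H1], H2 as [l2 H2]. split; apply Finite_iff_list.
- exists l1. auto.
- exists (map f l2). intros A HA. destruct (Hp A HA) as [P [HP ->]]. apply in_map. auto.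
Qed.

(** * Truth of the restriction *)

(** When [X] is the set of ordinals [F^κ_ξ(α)], [rsat X α] is truth in [V_α] of the
    restriction to [α], computed without collapsing the index sets. *)
Fixpoint rsat X α (e1 e2 : nat -> M) φ : Prop :=
  match φ with
  | FO φ => fo_sat (Vh α) e1 e2 (cut_fo α φ)
  | All2 k φ => forall A, A ⊆ Vh α -> rsat X α e1 (upd e2 k A) φ
  | Ex2 k φ => exists A, A ⊆ Vh α /\ rsat X α e1 (upd e2 k A) φ
  | BigAnd ξ ψ => forall ζ, ζ ∈ ξ -> ζ ∈ X -> rsat X α e1 e2 (ψ ζ)
  | BigOr ξ ψ => exists ζ, ζ ∈ ξ /\ ζ ∈ X /\ rsat X α e1 e2 (ψ ζ)
  end.

(** Restriction leaves first-order parameters unchanged, so those in the surviving conjuncts and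
    disjuncts must already belong to V_α. *)
Fixpoint params_in X α φ : Prop :=
  match φ with
  | FO φ => forall a, fo_occurs φ (Par1 a) -> a ∈ Vh α
  | All2 _ φ | Ex2 _ φ => params_in X α φ
  | BigAnd ξ ψ | BigOr ξ ψ => forall ζ, ζ ∈ ξ -> ζ ∈ X -> params_in X α (ψ ζ)
  end.

(** A bound on the levels that, unlike the pair of [is_Pi] and [is_Sigma], is inherited
    along every way of splitting a block of quantifiers. *)
Fixpoint level_le φ η : Prop :=
  match φ with
  | FO _ => True
  | All2 _ φ | Ex2 _ φ => level_le φ η
  | BigAnd ξ ψ | BigOr ξ ψ =>
    limit ξ /\ (ξ = η \/ ξ ∈ η) /\ forall ζ, ζ ∈ ξ -> level_le (ψ ζ) ζ
  end.

Lemma level_le_quants p ks φ η : level_le (quants p ks φ) η <-> level_le φ η.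
Proof.
destruct p; unfold quants, alls2, exs2; induction ks as [|j ks IH]; simpl; tauto.
Qed.

Lemma level_le_succ φ ζ : level_le φ (succ ζ) <-> level_le φ ζ.
Proof.
induction φ as [φ|k φ IH|k φ IH|ξ ψ IH|ξ ψ IH]; simpl; try tauto;
  rewrite in_succ; split; intros [H1 [H2 H3]]; split; auto; split; auto;
  try (destruct H2 as [->|H2]; [destruct (limit_not_succ H1)|]); tauto.
Qed.

Lemma is_PS_level p κ η φ : is_PS p κ η φ -> level_le φ η.
Proof.
apply (@is_PS_ind κ (fun p η φ => level_le φ η)); clear.
- intros. exact I.
- intros p ζ ks ψ _ IH. rewrite level_le_quants, level_le_succ. exact IH.
- intros p ξ ψ Hl _ IH _. destruct p; simpl; auto.
Qed.

Lemma params_in_quants X α p ks φ : params_in X α (quants p ks φ) <-> params_in X α φ.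
Proof.
destruct p; unfold quants, alls2, exs2; induction ks as [|j ks IH]; simpl; tauto.
Qed.

Lemma params_in_big X α p ξ ψ :
  params_in X α (big p ξ ψ) <-> forall ζ, ζ ∈ ξ -> ζ ∈ X -> params_in X α (ψ ζ).
Proof. destruct p; simpl; tauto. Qed.

(** Below κ the restriction keeps all indices. When the level is a subset of X, discarding the
    indices outside X discards nothing. *)
Lemma sat_cut_rsat X α e1 φ η : η ⊆ X -> level_le φ η -> ordinal η ->
  forall e2, sat (Vh α) e1 e2 (cut α φ) <-> rsat X α e1 e2 φ.
Proof.
revert η. induction φ as [φ|k φ IH|k φ IH|ξ ψ IH|ξ ψ IH]; simpl; intros η HX Hle Ho e2.
- tauto.
- split; intros H A HA; apply (IH η); auto.
- split; intros [A [HA H]]; exists A; split; auto; apply (IH η); auto.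
- destruct Hle as [Hl [Hle Hlz]].
  assert (Hs : ξ ⊆ η).
  { intros w Hw. destruct Hle as [->|Hle]; auto. exact (ordinal_trans Ho Hle Hw). }
  assert (Hrec : forall ζ, ζ ∈ ξ -> (sat (Vh α) e1 e2 (cut α (ψ ζ)) <-> rsat X α e1 e2 (ψ ζ))).
  { intros ζ Hz. apply (IH ζ ζ); auto.
    - intros w Hw. apply HX, Hs. exact (ordinal_trans (proj1 Hl) Hz Hw).
    - exact (ordinal_in (proj1 Hl) Hz). }
  split; intros H ζ Hz; [intros _|]; apply Hrec; auto.
- destruct Hle as [Hl [Hle Hlz]].
  assert (Hs : ξ ⊆ η).
  { intros w Hw. destruct Hle as [->|Hle]; auto. exact (ordinal_trans Ho Hle Hw). }
  assert (Hrec : forall ζ, ζ ∈ ξ -> (sat (Vh α) e1 e2 (cut α (ψ ζ)) <-> rsat X α e1 e2 (ψ ζ))).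
  { intros ζ Hz. apply (IH ζ ζ); auto.
    - intros w Hw. apply HX, Hs. exact (ordinal_trans (proj1 Hl) Hz Hw).
    - exact (ordinal_in (proj1 Hl) Hz). }
  split.
  + intros [ζ [Hz H]]. exists ζ. split; auto. split; auto. apply Hrec; auto.
  + intros [ζ [Hz [_ H]]]. exists ζ. split; auto. apply Hrec; auto.
Qed.

Lemma sat_rsat_quants X α e1 p ks φ φ' :
  (forall e2, sat (Vh α) e1 e2 φ' <-> rsat X α e1 e2 φ) ->
  forall e2, sat (Vh α) e1 e2 (quants p ks φ') <-> rsat X α e1 e2 (quants p ks φ).
Proof.
intro H. destruct p; unfold quants, alls2, exs2; induction ks as [|j ks IH]; simpl; auto; intro e2.
- split; intros HA A Hs; apply IH; auto.
- split; intros [A [Hs HA]]; exists A; split; auto; apply IH; auto.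
Qed.

(** * Good restriction points *)

(** These conditions let the collapse of X carry zero, successors and limits in X to zero,
    successors and limits. *)
Record index_closed Ω X : Prop := {
  index_sub : X ⊆ Ω;
  index_empty : empty ∈ X;
  index_pred : forall ζ, succ ζ ∈ X -> ζ ∈ X;
  index_succ : forall ζ, ζ ∈ X -> succ ζ ∈ Ω -> succ ζ ∈ X }.

(** All the sets F^κ_η(α) with η in X are initial segments of one set, so that their collapses fit
    together. *)
Definition coherent (b : M -> M -> M -> M) κ α X : Prop :=
  forall η, η ∈ X -> Fcan b κ η α = X ∩ η.

Lemma cut_occurs α (φ : fo M) t : fo_occurs (cut_fo α φ) t -> exists s, fo_occurs φ s /\ t = cut_term α s.
Proof.
induction φ; simpl; firstorder eauto.
Qed.

Lemma cut_FO_params α (φ : fo M) :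
  (forall a, fo_occurs φ (Par1 a) -> a ∈ Vh α) ->
  (forall a, fo_occurs (cut_fo α φ) (Par1 a) -> a ∈ Vh α) /\
  (forall A, fo_occurs (cut_fo α φ) (Par2 A) -> exists P, fo_occurs φ (Par2 P) /\ A = P ∩ Vh α).
Proof.
intro H. split.
- intros a Ha. apply cut_occurs in Ha. destruct Ha as [[n|a'|k|A] [Hs E]]; simpl in E; try discriminate.
  injection E as ->. auto.
- intros A Ha. apply cut_occurs in Ha. destruct Ha as [[n|a'|k|P] [Hs E]]; simpl in E; try discriminate.
  injection E as ->. eauto.
Qed.

Lemma free2_cut α φ k : free2 (cut α φ) k <-> free2 φ k.
Proof.
assert (Hfo : forall φ : fo M, fo_occurs (cut_fo α φ) (Var2 M k) <-> fo_occurs φ (Var2 M k)).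
{ assert (Ht : forall t, cut_term α t = Var2 M k <-> t = Var2 M k).
  { intro t; destruct t; simpl; split; auto; discriminate. }
  induction φ0; simpl; rewrite ?Ht; tauto. }
induction φ as [φ|j φ IH|j φ IH|ξ ψ IH|ξ ψ IH]; simpl; try rewrite IH; try tauto; auto;
  split; intros [ζ [Hz H]]; exists ζ; split; auto; apply IH; auto.
Qed.

Lemma par2_cut α φ A : par2 (cut α φ) A -> exists P, par2 φ P /\ A = P ∩ Vh α.
Proof.
induction φ as [φ|j φ IH|j φ IH|ξ ψ IH|ξ ψ IH]; simpl; auto.
- intro Ha. apply cut_occurs in Ha. destruct Ha as [[n|a'|k|P] [Hs E]]; simpl in E; try discriminate.
  injection E as ->. eauto.
- intros [ζ [Hz H]]. destruct (IH ζ H) as [P [HP ->]]. eauto.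
- intros [ζ [Hz H]]. destruct (IH ζ H) as [P [HP ->]]. eauto.
Qed.

Lemma is_PS_cut X α p κ' η φ : is_PS p κ' η φ -> η ⊆ X -> params_in X α φ -> is_PS p α η (cut α φ).
Proof.
revert p η φ. apply (@is_PS_ind κ' (fun p η φ => η ⊆ X -> params_in X α φ -> is_PS p α η (cut α φ))).
- intros p φ _ _ _ Hp. apply is_PS_zero.
  + apply (cut_FO_params Hp).
  + intros A HA. destruct (proj2 (cut_FO_params Hp) A HA) as [P [_ ->]]. apply cut_sub.
- intros p ζ ks ψ _ IH Hs Hp. rewrite cut_quants. apply is_PS_succ.
  rewrite params_in_quants in Hp. apply IH; auto. intros w Hw. apply Hs, in_succ. auto.
- intros p ξ ψ Hl _ IH Hfin Hs Hp. rewrite params_in_big in Hp.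
  assert (Hf : finitary2 (cut α (big p ξ ψ))).
  { apply (@finitary2_by (big p ξ ψ) _ (fun P => P ∩ Vh α)); auto.
    - intros k. apply free2_cut.
    - intros A. apply par2_cut. }
  rewrite cut_big in *. apply is_PS_limit; auto. intros ζ Hz. apply IH; auto.
  intros w Hw. apply Hs. exact (ordinal_trans (proj1 Hl) Hz Hw).
Qed.

Section Point.
Variables (b : M -> M -> M -> M) (κ α Ω X : M).
Hypothesis (Hκ : limit κ) (HΩ : ordinal Ω) (HX : index_closed Ω X) (HF : coherent b κ α X).

Lemma index_ordinal η : η ∈ X -> ordinal η.
Proof. intro H. exact (ordinal_in HΩ (index_sub HX H)). Qed.

Lemma small_index_sub η : η ∈ X -> η ∈ κ -> η ⊆ X.
Proof.
intros H1 H2 w Hw. assert (E := HF H1). unfold Fcan in E.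
destruct (excluded_middle_informative (η ∈ κ)); [|contradiction].
rewrite E in Hw. apply sepP in Hw. tauto.
Qed.

Lemma fcan_collapse η : η ∈ X -> fcan b κ η α = collapse X η.
Proof. intro H. unfold fcan. rewrite (HF H). apply ot_inter. apply index_ordinal; auto. Qed.

Lemma in_Fcan η ζ : η ∈ X -> (ζ ∈ Fcan b κ η α <-> ζ ∈ X /\ ζ ∈ η).
Proof. intro H. rewrite (HF H), sepP. tauto. Qed.

Lemma pican_collapse η ζ : η ∈ X -> ζ ∈ η -> pican b κ η α ζ = collapse X ζ.
Proof.
intros H Hz. unfold pican. rewrite (HF H). apply collapse_inter; auto. apply index_ordinal; auto.
Qed.

Lemma in_fcan η ζ : η ∈ X -> (ζ ∈ fcan b κ η α <-> exists η', η' ∈ X /\ η' ∈ η /\ ζ = collapse X η').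
Proof.
intro H. rewrite (fcan_collapse H), in_collapse. split; intros [y [H1 [H2 H3]]]; exists y; auto.
Qed.

Lemma collapse_limit λ : λ ∈ X -> limit λ -> limit (collapse X λ).
Proof.
intros Hx Hl. split; [apply ordinal_collapse; exact (proj1 Hl)|]. split.
- intro E. assert (H : collapse X empty ∈ collapse X λ).
  { apply collapse_mem; [exact (limit_num_in 0 Hl)|apply (index_empty HX)]. }
  rewrite E in H. exact (emptyP H).
- intros y Hy. apply in_collapse in Hy. destruct Hy as [z [Hz [HzX ->]]].
  rewrite <- collapse_succ; auto. assert (Hs := proj2 (proj2 Hl) z Hz).
  apply collapse_mem; auto. apply (index_succ HX); auto.
  exact (ordinal_trans HΩ (index_sub HX Hx) Hs).
Qed.

Lemma restr_rsat η φ φ' : restr b κ α η φ φ' -> η ∈ X -> level_le φ η ->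
  forall e1 e2, sat (Vh α) e1 e2 φ' <-> rsat X α e1 e2 φ.
Proof.
induction 1 as [ξ φ Hξ|ζ ks ψ ψ' Hk H IH|ζ ks ψ ψ' Hk H IH
  |ξ ψ χ Hk Hl H IH Hw|ξ ψ χ Hk Hl H IH Hw]; intros HxX Hle e1.
- apply (@sat_cut_rsat X α e1 φ ξ); auto.
  + apply small_index_sub; auto.
  + apply index_ordinal; auto.
- apply (@sat_rsat_quants X α e1 true). apply IH; [apply (index_pred HX); auto|].
  apply level_le_succ, (level_le_quants true ks). exact Hle.
- apply (@sat_rsat_quants X α e1 false). apply IH; [apply (index_pred HX); auto|].
  apply level_le_succ, (level_le_quants false ks). exact Hle.
- intro e2. simpl in Hle. destruct Hle as [_ [_ Hle]].
  assert (Hrec : forall η, η ∈ X -> η ∈ ξ ->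
    (sat (Vh α) e1 e2 (χ (collapse X η)) <-> rsat X α e1 e2 (ψ η))).
  { intros η He1 He2. apply (IH (collapse X η) η); auto.
    - apply in_fcan; eauto.
    - apply in_Fcan; auto.
    - apply pican_collapse; auto. }
  simpl. split.
  + intros Hs η He1 He2. apply Hrec; auto. apply Hs. apply in_fcan; eauto.
  + intros Hs ζ Hz. apply in_fcan in Hz; auto. destruct Hz as [η [H1 [H2 ->]]].
    apply Hrec; auto.
- intro e2. simpl in Hle. destruct Hle as [_ [_ Hle]].
  assert (Hrec : forall η, η ∈ X -> η ∈ ξ ->
    (sat (Vh α) e1 e2 (χ (collapse X η)) <-> rsat X α e1 e2 (ψ η))).
  { intros η He1 He2. apply (IH (collapse X η) η); auto.
    - apply in_fcan; eauto.
    - apply in_Fcan; auto.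
    - apply pican_collapse; auto. }
  simpl. split.
  + intros [ζ [Hz Hs]]. apply in_fcan in Hz; auto. destruct Hz as [η [H1 [H2 ->]]].
    exists η. split; auto. split; auto. apply Hrec; auto.
  + intros [η [H1 [H2 Hs]]]. exists (collapse X η). split; [apply in_fcan; eauto|].
    apply Hrec; auto.
Qed.

(** Below κ the cut formula works; from κ on the restriction is built along the formula. The last
    two conclusions carry the finiteness of variables and parameters through limit levels. *)
Lemma restr_exists p η φ : is_PS p κ η φ -> η ∈ X -> params_in X α φ ->
  exists φ', restr b κ α η φ φ' /\ is_PS p α (collapse X η) φ' /\
    (forall k, free2 φ' k -> free2 φ k) /\
    (forall A, par2 φ' A -> exists P, par2 φ P /\ A = P ∩ Vh α).
Proof.
assert (Hsmall : forall p η φ, η ∈ κ -> is_PS p κ η φ -> η ∈ X -> params_in X α φ ->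
  exists φ', restr b κ α η φ φ' /\ is_PS p α (collapse X η) φ' /\
    (forall k, free2 φ' k -> free2 φ k) /\
    (forall A, par2 φ' A -> exists P, par2 φ P /\ A = P ∩ Vh α)).
{ clear p η φ. intros p η φ Hk H HeX Hp. assert (Hs := small_index_sub HeX Hk).
  exists (cut α φ). split; [apply restr_small; auto|].
  rewrite collapse_transitive; auto; [|apply index_ordinal; auto].
  split; [exact (is_PS_cut H Hs Hp)|]. split; [intro k; apply free2_cut|intro A; apply par2_cut]. }
revert p η φ. apply (@is_PS_ind κ (fun p η φ => η ∈ X -> params_in X α φ -> exists φ',
  restr b κ α η φ φ' /\ is_PS p α (collapse X η) φ' /\
    (forall k, free2 φ' k -> free2 φ k) /\
    (forall A, par2 φ' A -> exists P, par2 φ P /\ A = P ∩ Vh α))).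
- intros p φ H1 H2 HeX Hp. apply Hsmall; auto; [exact (limit_num_in 0 Hκ)|].
  apply is_PS_zero; auto.
- intros p ζ ks ψ H IH HeX Hp. destruct (classic (succ ζ ∈ κ)) as [Hk|Hk].
  { apply Hsmall; auto. apply is_PS_succ; auto. }
  assert (Hks := ordinal_not_in (index_ordinal HeX) (proj1 Hκ) Hk).
  assert (HzX := index_pred HX HeX). rewrite params_in_quants in Hp.
  destruct (IH HzX Hp) as [φ' [H1 [H2 [H3 H4]]]].
  exists (quants p ks φ'). split; [|split; [|split]].
  + destruct p; constructor; auto.
  + rewrite collapse_succ; auto. apply is_PS_succ; auto.
  + intros k. rewrite !free2_quants. intuition.
  + intros A. rewrite par2_quants. intro HA. destruct (H4 A HA) as [P HP].
    exists P. rewrite par2_quants. exact HP.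
- intros p ξ ψ Hl H IH Hfin HeX Hp. destruct (classic (ξ ∈ κ)) as [Hk|Hk].
  { apply Hsmall; auto. apply is_PS_limit; auto. }
  assert (Hks := ordinal_not_in (index_ordinal HeX) (proj1 Hκ) Hk).
  rewrite params_in_big in Hp.
  (* The conjuncts of the restriction are indexed by collapsed ordinals. The collapse is injective
     on X, so τ determines η and one formula can be chosen for each τ. *)
  assert (Hch : forall τ, τ ∈ fcan b κ ξ α -> exists φ', forall η, η ∈ X -> η ∈ ξ -> τ = collapse X η ->
    restr b κ α η (ψ η) φ' /\ is_PS p α (collapse X η) φ' /\
    (forall k, free2 φ' k -> free2 (ψ η) k) /\
    (forall A, par2 φ' A -> exists P, par2 (ψ η) P /\ A = P ∩ Vh α)).
  { intros τ Ht. apply in_fcan in Ht; auto. destruct Ht as [η [H1 [H2 ->]]].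
    destruct (IH η H2 H1 (Hp η H2 H1)) as [φ' Hφ']. exists φ'.
    intros η' H1' H2' E. apply collapse_inj in E; auto using index_ordinal. subst η'. exact Hφ'. }
  destruct (choice_on (BigAnd ξ ψ) Hch) as [χ Hχ].
  assert (Hchi : forall η, η ∈ X -> η ∈ ξ ->
    restr b κ α η (ψ η) (χ (collapse X η)) /\ is_PS p α (collapse X η) (χ (collapse X η)) /\
    (forall k, free2 (χ (collapse X η)) k -> free2 (ψ η) k) /\
    (forall A, par2 (χ (collapse X η)) A -> exists P, par2 (ψ η) P /\ A = P ∩ Vh α)).
  { intros η H1 H2. apply Hχ; auto. apply in_fcan; eauto. }
  assert (Hfree : forall k, free2 (big p (fcan b κ ξ α) χ) k -> free2 (big p ξ ψ) k).
  { intros k. rewrite !free2_big. intros [τ [Ht Hk']]. apply in_fcan in Ht; auto.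
    destruct Ht as [η [H1 [H2 ->]]]. exists η. split; auto. apply (Hchi η H1 H2). auto. }
  assert (Hpar : forall A, par2 (big p (fcan b κ ξ α) χ) A -> exists P, par2 (big p ξ ψ) P /\ A = P ∩ Vh α).
  { intros A. rewrite par2_big. intros [τ [Ht Hk']]. apply in_fcan in Ht; auto.
    destruct Ht as [η [H1 [H2 ->]]]. destruct (proj2 (proj2 (proj2 (Hchi η H1 H2))) A Hk') as [P [HP ->]].
    exists P. rewrite par2_big. eauto. }
  assert (HPS : forall τ, τ ∈ fcan b κ ξ α -> is_PS p α τ (χ τ)).
  { intros τ Ht. apply in_fcan in Ht; auto. destruct Ht as [η [H1 [H2 ->]]]. apply Hchi; auto. }
  assert (Hr : forall ζ η, ζ ∈ fcan b κ ξ α -> η ∈ Fcan b κ ξ α -> pican b κ ξ α η = ζ ->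
       restr b κ α η (ψ η) (χ ζ)).
  { intros ζ η _ Hη <-. apply in_Fcan in Hη; auto. rewrite pican_collapse; try tauto.
    apply Hchi; tauto. }
  exists (big p (fcan b κ ξ α) χ). split; [|split; [|split]]; auto.
  + destruct p; constructor; auto.
  + rewrite <- (fcan_collapse HeX). apply is_PS_limit; auto.
    * rewrite (fcan_collapse HeX). apply collapse_limit; auto.
    * exact (finitary2_by Hfin Hfree Hpar).
Qed.

Lemma models_restr_rsat p η φ : is_PS p κ η φ -> η ∈ X -> params_in X α φ ->
  below_card_succ (collapse X η) α ->
  (models_restr b κ α η φ <-> rsat X α (fun _ => empty) (fun _ => empty) φ).
Proof.
intros H HeX Hp Hc. split.
- intros [φ' [H1 [_ H2]]].
  exact (proj1 (restr_rsat H1 HeX (is_PS_level H) _ _) H2).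
- intro Hs. destruct (restr_exists H HeX Hp) as [φ' [H1 [H2 _]]].
  exists φ'. split; auto. split.
  + exists (collapse X η). split; auto. destruct p; auto.
  + exact (proj2 (restr_rsat H1 HeX (is_PS_level H) _ _) Hs).
Qed.

End Point.
End Restriction.

(** * Clubs of well-behaved ordinals, truth at leaves, and substitution *)

Section Clubs.
Context {M : ZFC}.
Implicit Types (x y z u v w X Y α β γ δ ζ η κ ξ Ω : M) (φ : formula M) (p : bool) (c : M -> M).

Definition covers κ c Ω : Prop :=
  (forall i, i ∈ κ -> c i ∈ Ω) /\ forall y, y ∈ Ω -> exists i, i ∈ κ /\ c i = y.

Lemma covers_repl κ c Ω : covers κ c Ω -> repl c κ = Ω.
Proof.
intros [H1 H2]. apply extensionality. intro z. rewrite replP. split.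
- intros [y [Hy ->]]. auto.
- intro Hz. destruct (H2 z Hz) as [i [Hi <-]]. eauto.
Qed.

Lemma index_closed_full Ω : ordinal Ω -> Ω <> empty -> index_closed Ω Ω.
Proof.
intros Ho He. constructor; auto.
- apply ordinal_empty_in; auto.
- intros ζ Hz. exact (ordinal_trans Ho Hz (succ_self ζ)).
Qed.

(** Skolem functions on Ω become functions on the indices, so c[α] is closed under them for club
    many α. *)
Lemma Cl_choice κ c Ω (Q : M -> M -> Prop) : regular κ -> covers κ c Ω ->
  (forall η, η ∈ Ω -> exists y, y ∈ Ω /\ Q η y) ->
  Cl κ (fun α => forall η, η ∈ repl c α -> exists y, y ∈ repl c α /\ Q η y).
Proof.
intros Hk [H1 H2] HQ.
assert (H : forall i, i ∈ κ -> exists j, j ∈ κ /\ Q (c i) (c j)).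
{ intros i Hi. destruct (HQ (c i) (H1 i Hi)) as [y [Hy Hq]]. destruct (H2 y Hy) as [j [Hj <-]]. eauto. }
destruct (choice_on empty H) as [g Hg].
eapply Cl_mono; [|apply (@Cl_closed M κ g); intros i Hi; apply Hg; auto].
intros α Ha Hl Hc η He. apply replP in He. destruct He as [i [Hi ->]].
exists (c (g i)). split; [apply replP; eauto|]. apply Hg.
exact (ordinal_trans (regular_ordinal Hk) Ha Hi).
Qed.

Lemma Cl_index_closed κ c Ω : regular κ -> ordinal Ω -> Ω <> empty -> covers κ c Ω ->
  Cl κ (fun α => index_closed Ω (repl c α)).
Proof.
intros Hk Ho He Hcv. assert (Hcv' := Hcv). destruct Hcv' as [H1 H2].
destruct (H2 empty (ordinal_empty_in Ho He)) as [i0 [Hi0 E0]].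
assert (Hp : forall η, η ∈ Ω -> exists y, y ∈ Ω /\ forall ζ, η = succ ζ -> y = ζ).
{ intros η Hη. destruct (classic (exists ζ, η = succ ζ)) as [[ζ ->]|Hn].
  - exists ζ. split; [exact (ordinal_trans Ho Hη (succ_self ζ))|]. intros ζ' E. apply succ_inj; auto.
  - exists η. split; auto. intros ζ E. destruct Hn. eauto. }
assert (Hs : forall η, η ∈ Ω -> exists y, y ∈ Ω /\ (succ η ∈ Ω -> y = succ η)).
{ intros η Hη. destruct (classic (succ η ∈ Ω)) as [Hi|Hn]; eauto. exists η. tauto. }
eapply Cl_mono; [|apply (Cl_and Hk (Cl_and Hk (Cl_choice Hk Hcv Hp) (Cl_choice Hk Hcv Hs)) (Cl_tail Hi0))].
intros α Ha Hl [[H3 H4] H5]. constructor.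
- intros w Hw. apply replP in Hw. destruct Hw as [i [Hi ->]]. apply H1.
  exact (ordinal_trans (regular_ordinal Hk) Ha Hi).
- apply replP. eauto.
- intros ζ Hz. destruct (H3 _ Hz) as [y [Hy E]]. rewrite (E ζ eq_refl) in Hy. exact Hy.
- intros ζ Hz Hsz. destruct (H4 _ Hz) as [y [Hy E]]. rewrite (E Hsz) in Hy. exact Hy.
Qed.

(** For a fixed η ≥ κ, the bijection and c both enumerate η along κ, so their images of α agree
    inside η on a club; for η < κ it suffices that c[α] covers η. A diagonal intersection over the
    indices of the η finishes the proof. *)
Lemma Cl_coherent b κ c Ω : canonical_bijections b -> regular κ -> ordinal Ω -> covers κ c Ω ->
  (forall η, η ∈ Ω -> below_card_succ η κ) ->
  Cl κ (fun α => coherent b κ α (repl c α)).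
Proof.
intros Hb Hk Ho [H1 H2] Hbelow. assert (Hko := regular_ordinal Hk).
assert (H : forall i, i ∈ κ -> Cl κ (fun α => Fcan b κ (c i) α = repl c α ∩ c i)).
{ intros i Hi. set (η := c i). assert (Hη : η ∈ Ω) by (apply H1; auto).
  assert (Hηo := ordinal_in Ho Hη).
  assert (Hidx : forall y, y ∈ η -> exists j, j ∈ κ /\ c j = y).
  { intros y Hy. apply H2. exact (ordinal_trans Ho Hη Hy). }
  unfold Fcan. destruct (excluded_middle_informative (η ∈ κ)) as [Hin|Hn].
  - destruct (choice_on empty Hidx) as [f Hf].
    destruct (proj2 (proj2 Hk) η f Hin) as [γ [Hg HG]]; [intros y Hy; apply Hf; auto|].
    eapply Cl_mono; [|exact (Cl_tail Hg)]. intros α Ha Hl Hga.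
    apply extensionality. intro z. rewrite sepP. split; [|tauto]. intro Hz. split; auto.
    apply replP. exists (f z). split; [|symmetry; apply Hf; auto].
    apply (ordinal_trans (proj1 Hl) Hga). auto.
  - assert (Hsub := ordinal_not_in Hηo Hko Hn).
    destruct (proj1 Hb κ η Hk Hsub (Hbelow η Hη)) as [B1 [_ B3]].
    assert (Hf1 : forall j, j ∈ κ -> exists k, k ∈ κ /\ c k = b κ η j).
    { intros j Hj. apply Hidx. auto. }
    assert (Hf2 : forall j, j ∈ κ -> exists k, k ∈ κ /\ (c j ∈ η -> b κ η k = c j)).
    { intros j Hj. destruct (classic (c j ∈ η)) as [Hc|Hc].
      - destruct (B3 _ Hc) as [k [Hk' E]]. eauto.
      - exists j. tauto. }
    destruct (choice_on empty Hf1) as [f1 F1]. destruct (choice_on empty Hf2) as [f2 F2].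
    eapply Cl_mono; [|apply (Cl_and Hk (@Cl_closed M κ f1 (fun j Hj => proj1 (F1 j Hj)))
      (@Cl_closed M κ f2 (fun j Hj => proj1 (F2 j Hj))))].
    intros α Ha Hl [C1 C2]. apply extensionality. intro z. rewrite sepP, !replP.
    assert (Hak : forall j, j ∈ α -> j ∈ κ) by (intros j Hj; exact (ordinal_trans Hko Ha Hj)).
    split.
    + intros [j [Hj ->]]. split; auto. exists (f1 j). split; auto. symmetry. apply F1. auto.
    + intros [[j [Hj ->]] Hz]. exists (f2 j). split; auto. symmetry. apply F2; auto. }
eapply Cl_mono; [|exact (Cl_diag Hk H)]. intros α Ha Hl Hd η Hη.
apply replP in Hη. destruct Hη as [i [Hi ->]]. auto.
Qed.

Lemma Cl_fo_params κ (φ : fo M) : inaccessible κ ->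
  (forall a, fo_occurs φ (Par1 a) -> a ∈ Vh κ) ->
  Cl κ (fun α => forall a, fo_occurs φ (Par1 a) -> a ∈ Vh α).
Proof.
intro Hk. assert (Hr := proj1 Hk).
assert (Ht : forall t : term M, (forall a, t = Par1 a -> a ∈ Vh κ) ->
  Cl κ (fun α => forall a, t = Par1 a -> a ∈ Vh α)).
{ intros t H. destruct t as [n|a|k|A]; try (eapply Cl_mono; [|exact (Cl_limit κ)]; discriminate).
  eapply Cl_mono; [|exact (Cl_V_mem Hk (H a eq_refl))]. intros α _ _ Ha a' [= <-]. exact Ha. }
induction φ as [s t|s t|φ IH|φ IH1 ψ IH2|n φ IH]; simpl; intro H; auto.
- eapply Cl_mono; [|apply (Cl_and Hr (Ht s (fun a E => H a (or_introl E))) (Ht t (fun a E => H a (or_intror E))))]. simpl. intros α _ _ [H1 H2] a [E|E]; auto.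
- eapply Cl_mono; [|apply (Cl_and Hr (Ht s (fun a E => H a (or_introl E))) (Ht t (fun a E => H a (or_intror E))))]. simpl. intros α _ _ [H1 H2] a [E|E]; auto.
- eapply Cl_mono; [|apply (Cl_and Hr (IH1 (fun a E => H a (or_introl E))) (IH2 (fun a E => H a (or_intror E))))]. simpl. intros α _ _ [H1 H2] a [E|E]; auto.
Qed.

(** At a limit level there may be κ many conjuncts; only those with an index below α matter at α, so
    a diagonal intersection suffices. *)
Lemma Cl_params_in κ c p η φ : inaccessible κ -> is_PS p κ η φ ->
  (forall y, y ∈ η -> exists i, i ∈ κ /\ c i = y) ->
  Cl κ (fun α => params_in (repl c α) α φ).
Proof.
intros Hk H. assert (Hr := proj1 Hk). revert p η φ H.
apply (@is_PS_ind M κ (fun p η φ => (forall y, y ∈ η -> exists i, i ∈ κ /\ c i = y) ->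
  Cl κ (fun α => params_in (repl c α) α φ))).
- intros p φ H _ _. apply Cl_fo_params; auto.
- intros p ζ ks ψ _ IH Hc. eapply Cl_mono; [|apply IH].
  + intros α _ _. rewrite params_in_quants. auto.
  + intros y Hy. apply Hc, in_succ. auto.
- intros p ξ ψ Hl _ IH _ Hc.
  assert (H : forall i, i ∈ κ -> Cl κ (fun α => c i ∈ ξ -> params_in (repl c α) α (ψ (c i)))).
  { intros i Hi. destruct (classic (c i ∈ ξ)) as [Hci|Hn].
    - eapply Cl_mono; [|apply (IH (c i) Hci)]; auto.
      intros y Hy. apply Hc. exact (ordinal_trans (proj1 Hl) Hci Hy).
    - eapply Cl_mono; [|exact (Cl_limit κ)]. tauto. }
  eapply Cl_mono; [|exact (Cl_diag Hr H)]. intros α _ _ Hd. rewrite params_in_big.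
  intros ζ Hz Hx. apply replP in Hx. destruct Hx as [i [Hi ->]]. auto.
Qed.

Lemma sat_rsat_top κ Ω p η φ : is_PS p κ η φ -> η ⊆ Ω -> forall e1 e2,
  sat (Vh κ) e1 e2 φ <-> rsat Ω κ e1 e2 φ.
Proof.
revert p η φ.
apply (@is_PS_ind M κ (fun p η φ => η ⊆ Ω -> forall e1 e2,
  sat (Vh κ) e1 e2 φ <-> rsat Ω κ e1 e2 φ)).
- intros _ φ _ H _ e1 e2. simpl. revert e1.
  assert (Ht : forall t e1, (forall A, t = Par2 A -> A ⊆ Vh κ) ->
    eval e1 e2 (cut_term κ t) = eval e1 e2 t).
  { intros t e1 Ht. destruct t as [n|a|k|A]; simpl; auto. apply cut_of_sub. exact (Ht A eq_refl). }
  induction φ as [s t|s t|φ IH|φ IH1 ψ IH2|n φ IH]; simpl in *; intro e1.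
  + rewrite (Ht s), (Ht t); [tauto|intros A E; apply (H A); auto..].
  + rewrite (Ht s), (Ht t); [tauto|intros A E; apply (H A); auto..].
  + rewrite IH; [tauto|exact H].
  + rewrite IH1, IH2; [tauto|intros A E; apply (H A); auto..].
  + split; intros Hs a Ha; apply (IH H); auto.
- intros p ζ ks ψ _ IH Hs e1 e2. apply sat_rsat_quants. apply IH.
  intros w Hw. apply Hs, in_succ. auto.
- intros p ξ ψ Hl _ IH _ Hs e1 e2.
  assert (Hr : forall ζ, ζ ∈ ξ -> (sat (Vh κ) e1 e2 (ψ ζ) <-> rsat Ω κ e1 e2 (ψ ζ))).
  { intros ζ Hz. apply IH; auto. intros w Hw. apply Hs. exact (ordinal_trans (proj1 Hl) Hz Hw). }
  destruct p; simpl.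
  + split; intros H ζ Hz; [intros _|]; apply Hr; auto.
  + split.
    * intros [ζ [Hz H]]. exists ζ. split; auto. split; auto. apply Hr; auto.
    * intros [ζ [Hz [_ H]]]. exists ζ. split; auto. apply Hr; auto.
Qed.

(** * Formulas all of whose leaves imply a statement *)

Fixpoint leaves (P : fo M -> Prop) φ : Prop :=
  match φ with
  | FO φ => P φ
  | All2 _ φ | Ex2 _ φ => leaves P φ
  | BigAnd ξ ψ | BigOr ξ ψ => ξ <> empty /\ forall ζ, ζ ∈ ξ -> leaves P (ψ ζ)
  end.

Lemma leaves_quants P p ks φ : leaves P (quants p ks φ) <-> leaves P φ.
Proof.
destruct p; unfold quants, alls2, exs2; induction ks as [|j ks IH]; simpl; tauto.
Qed.

Lemma leaves_big P p ξ ψ :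
  leaves P (big p ξ ψ) <-> ξ <> empty /\ forall ζ, ζ ∈ ξ -> leaves P (ψ ζ).
Proof. destruct p; simpl; tauto. Qed.

Lemma leaves_mono (P Q : fo M -> Prop) φ : (forall ψ, P ψ -> Q ψ) -> leaves P φ -> leaves Q φ.
Proof.
intro H. induction φ; simpl; auto; intros [H1 H2]; split; auto.
Qed.

Lemma leaves_quants_sat D e1 (T : Prop) p ks φ : (forall e2, sat D e1 e2 φ -> T) ->
  forall e2, sat D e1 e2 (quants p ks φ) -> T.
Proof.
intro H. destruct p; unfold quants, alls2, exs2; induction ks as [|j ks IH]; simpl; auto; intros e2 Hs.
- apply (IH (upd e2 j empty)). apply Hs. intros w Hw. destruct (emptyP Hw).
- destruct Hs as [A [_ Hs]]. exact (IH _ Hs).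
Qed.

(** This must work for an α not known to lie in any club. A true restriction has a true leaf,
    because quantifiers range over inhabited domains and no conjunction is empty, and every true
    leaf yields T. *)
Lemma leaves_restr b κ α Ω (T : Prop) e1 η φ φ' : canonical_bijections b -> regular κ -> ordinal Ω ->
  (forall η, η ∈ Ω -> below_card_succ η κ) -> α ∈ κ -> empty ∈ α ->
  restr b κ α η φ φ' -> η ∈ Ω ->
  leaves (fun ψ => forall e2, fo_sat (Vh α) e1 e2 (cut_fo α ψ) -> T) φ ->
  forall e2, sat (Vh α) e1 e2 φ' -> T.
Proof.
intros Hb Hk Ho Hbelow Hak Ha0.
(* Without coherence it is still known that F^κ_ξ(α) is a subset of ξ and contains the image of
   0. *)
assert (HF : forall ξ, κ ⊆ ξ -> ξ ∈ Ω -> (forall η, η ∈ Fcan b κ ξ α -> η ∈ ξ) /\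
  exists η, η ∈ Fcan b κ ξ α).
{ intros ξ Hs Hx. unfold Fcan. destruct (excluded_middle_informative (ξ ∈ κ)) as [Hin|_].
  - destruct (mem_irrefl (Hs _ Hin)).
  - destruct (proj1 Hb κ ξ Hk Hs (Hbelow ξ Hx)) as [B _]. split.
    + intros τ He. apply replP in He. destruct He as [i [Hi ->]]. apply B.
      exact (ordinal_trans (regular_ordinal Hk) Hak Hi).
    + exists (b κ ξ empty). apply replP. eauto. }
induction 1 as [ξ φ Hξ|ζ ks ψ ψ' Hs H IH|ζ ks ψ ψ' Hs H IH
  |ξ ψ χ Hs Hl H IH Hw|ξ ψ χ Hs Hl H IH Hw]; intros Hx Hle e2.
- clear Hx Hξ. revert e2. induction φ as [φ|k φ IH|k φ IH|ξ' ψ IH|ξ' ψ IH]; simpl in *; intros e2 Hsat.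
  + exact (Hle _ Hsat).
  + apply (IH Hle (upd e2 k empty)). apply Hsat. intros w Hw. destruct (emptyP Hw).
  + destruct Hsat as [A [_ Hsat]]. exact (IH Hle _ Hsat).
  + destruct Hle as [Hne Hle]. destruct (empty_or_inhabited ξ') as [->|[ζ Hz]]; [tauto|].
    exact (IH ζ (Hle ζ Hz) e2 (Hsat ζ Hz)).
  + destruct Hle as [Hne Hle]. destruct Hsat as [ζ [Hz Hsat]]. exact (IH ζ (Hle ζ Hz) e2 Hsat).
- apply (@leaves_quants_sat (Vh α) e1 T true ks). apply IH.
  + exact (ordinal_trans Ho Hx (succ_self ζ)).
  + exact (proj1 (leaves_quants _ true ks ψ) Hle).
- apply (@leaves_quants_sat (Vh α) e1 T false ks). apply IH.
  + exact (ordinal_trans Ho Hx (succ_self ζ)).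
  + exact (proj1 (leaves_quants _ false ks ψ) Hle).
- simpl in *. intro Hsat. destruct (HF ξ Hs Hx) as [H1 [η Hη]].
  assert (Hz : pican b κ ξ α η ∈ fcan b κ ξ α) by (apply in_ot; eauto).
  apply (IH _ η Hz Hη eq_refl) with (e2 := e2); auto.
  + exact (ordinal_trans Ho Hx (H1 η Hη)).
  + apply Hle. auto.
- simpl in *. intros [ζ [Hz Hsat]]. destruct (HF ξ Hs Hx) as [H1 _].
  assert (Hz' := Hz). apply in_ot in Hz'. destruct Hz' as [η [Hη ->]].
  apply (IH _ η Hz Hη eq_refl) with (e2 := e2); auto.
  + exact (ordinal_trans Ho Hx (H1 η Hη)).
  + apply Hle. auto.
Qed.

(** * Substitution *)

Lemma upd_same (A : M) e k B : upd (upd e k A) k B = upd e k B.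
Proof.
apply functional_extensionality. intro m. unfold upd. destruct (Nat.eqb m k); auto.
Qed.

Lemma upd_swap (A : M) e j k B : j <> k -> upd (upd e j A) k B = upd (upd e k B) j A.
Proof.
intro H. apply functional_extensionality. intro m. unfold upd.
destruct (Nat.eqb_spec m k), (Nat.eqb_spec m j); auto. congruence.
Qed.

Lemma rsat_subst X α e1 (z : nat) (S : M) φ : forall e2,
  rsat X α e1 e2 (subst2 z S φ) <-> rsat X α e1 (upd e2 z (S ∩ Vh α)) φ.
Proof.
assert (Ht : forall t e1 e2, eval e1 e2 (cut_term α (subst2_term z S t)) =
  eval e1 (upd e2 z (S ∩ Vh α)) (cut_term α t)).
{ intros t a e2. destruct t as [n|a'|k|A]; simpl; auto. unfold upd. destruct (Nat.eqb k z); auto. }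
induction φ as [φ|k φ IH|k φ IH|ξ ψ IH|ξ ψ IH]; simpl; intro e2.
- revert e1. induction φ as [s t|s t|φ IH|φ IH1 ψ IH2|n φ IH]; simpl; intro e1; rewrite ?Ht; try tauto.
  + rewrite IH. tauto.
  + rewrite IH1, IH2. tauto.
  + split; intros H a Ha; apply IH; auto.
- destruct (Nat.eqb_spec k z) as [->|Hn]; simpl.
  + split; intros H A HA; specialize (H A HA); rewrite upd_same in *; auto.
  + split; intros H A HA; specialize (H A HA).
    * rewrite upd_swap; auto. apply IH. auto.
    * apply IH. rewrite upd_swap; auto.
- destruct (Nat.eqb_spec k z) as [->|Hn]; simpl.
  + split; intros [A [HA H]]; exists A; rewrite upd_same in *; auto.
  + split; intros [A [HA H]]; exists A; split; auto.
    * rewrite upd_swap; auto. apply IH. auto.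
    * apply IH. rewrite upd_swap; auto.
- split; intros H ζ H1 H2; apply IH; auto.
- split; intros [ζ [H1 [H2 H]]]; exists ζ; split; auto; split; auto; apply IH; auto.
Qed.

Lemma subst_occurs (z : nat) (S : M) (φ : fo M) t : fo_occurs (subst2_fo z S φ) t ->
  exists s, fo_occurs φ s /\ t = subst2_term z S s.
Proof. induction φ; simpl; firstorder eauto. Qed.

Lemma subst2_term_cases (z : nat) (S : M) t :
  (t = Var2 M z /\ subst2_term z S t = Par2 S) \/ subst2_term z S t = t.
Proof.
destruct t as [n|a|k|A]; simpl; auto. destruct (Nat.eqb_spec k z) as [->|]; auto.
Qed.

Lemma subst_fo_params (z : nat) (S : M) (φ : fo M) :
  (forall a, fo_occurs (subst2_fo z S φ) (Par1 a) -> fo_occurs φ (Par1 a)) /\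
  (forall A, fo_occurs (subst2_fo z S φ) (Par2 A) -> fo_occurs φ (Par2 A) \/ A = S).
Proof.
split.
- intros a H. apply subst_occurs in H. destruct H as [s [H E]].
  destruct (subst2_term_cases z S s) as [[-> E']|E']; rewrite E' in E; [discriminate|]. subst. auto.
- intros a H. apply subst_occurs in H. destruct H as [s [H E]].
  destruct (subst2_term_cases z S s) as [[-> E']|E']; rewrite E' in E; [|subst; auto]. injection E. auto.
Qed.

Lemma free2_subst (z : nat) (S : M) φ k : free2 (subst2 z S φ) k -> free2 φ k.
Proof.
induction φ as [φ|j φ IH|j φ IH|ξ ψ IH|ξ ψ IH]; simpl.
- intro H. apply subst_occurs in H. destruct H as [s [H E]].
  destruct (subst2_term_cases z S s) as [[-> E']|E']; rewrite E' in E; [discriminate|]. subst. auto.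
- destruct (Nat.eqb j z); simpl; tauto.
- destruct (Nat.eqb j z); simpl; tauto.
- intros [ζ [H1 H2]]. eauto.
- intros [ζ [H1 H2]]. eauto.
Qed.

Lemma par2_subst (z : nat) (S : M) φ A : par2 (subst2 z S φ) A -> par2 φ A \/ A = S.
Proof.
induction φ as [φ|j φ IH|j φ IH|ξ ψ IH|ξ ψ IH]; simpl.
- apply subst_fo_params.
- destruct (Nat.eqb j z); simpl; tauto.
- destruct (Nat.eqb j z); simpl; tauto.
- intros [ζ [H1 H2]]. apply IH in H2. destruct H2; eauto.
- intros [ζ [H1 H2]]. apply IH in H2. destruct H2; eauto.
Qed.

Lemma params_in_subst X α (z : nat) (S : M) φ : params_in X α φ -> params_in X α (subst2 z S φ).
Proof.
induction φ as [φ|j φ IH|j φ IH|ξ ψ IH|ξ ψ IH]; simpl; auto.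
- intros H a Ha. apply H. apply subst_fo_params in Ha. auto.
- destruct (Nat.eqb j z); simpl; auto.
- destruct (Nat.eqb j z); simpl; auto.
Qed.

Lemma subst2_quants (z : nat) (S : M) p ks φ :
  subst2 z S (quants p ks φ) = quants p ks φ \/
  subst2 z S (quants p ks φ) = quants p ks (subst2 z S φ).
Proof.
destruct p; unfold quants, alls2, exs2; induction ks as [|j ks IH]; simpl; auto;
  destruct (Nat.eqb j z); auto; destruct IH as [->| ->]; auto.
Qed.

Lemma is_PS_subst κ (z : nat) (S : M) p η φ : S ⊆ Vh κ -> is_PS p κ η φ -> is_PS p κ η (subst2 z S φ).
Proof.
intro HS. revert p η φ. apply (@is_PS_ind M κ (fun p η φ => is_PS p κ η (subst2 z S φ))).
- intros p φ H1 H2. apply is_PS_zero.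
  + intros a Ha. apply subst_fo_params in Ha. auto.
  + intros A HA. apply subst_fo_params in HA. destruct HA as [HA| ->]; [exact (H2 A HA)|exact HS].
- intros p ζ ks ψ H IH. destruct (subst2_quants z S p ks ψ) as [-> | ->]; apply is_PS_succ; auto.
- intros p ξ ψ Hl H IH Hfin.
  replace (subst2 z S (big p ξ ψ)) with (big p ξ (fun ζ => subst2 z S (ψ ζ))) by (destruct p; reflexivity).
  apply is_PS_limit; auto.
  destruct Hfin as [F1 F2]. apply Finite_iff_list in F1, F2. destruct F1 as [l1 F1], F2 as [l2 F2].
  split; apply Finite_iff_list.
  + exists l1. intros k. rewrite free2_big. intros [ζ [Hz Hk]]. apply F1. rewrite free2_big.
    apply free2_subst in Hk. eauto.
  + exists (S :: l2). intros A. rewrite par2_big. intros [ζ [Hz Hk]]. apply par2_subst in Hk.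
    destruct Hk as [Hk| ->]; [right|left; reflexivity]. apply F2. rewrite par2_big. eauto.
Qed.

End Clubs.

(** * The game and the formulas expressing it *)

Definition op (m : bool) (P Q : Prop) : Prop := if m then P /\ Q else P \/ Q.
Definition pol (p : bool) (P : Prop) : Prop := if p then P else ~ P.

#[global] Instance op_proper m : Morphisms.Proper (iff ==> iff ==> iff)%signature (op m).
Proof. intros P P' HP Q Q' HQ. destruct m; simpl; tauto. Qed.

#[global] Instance pol_proper p : Morphisms.Proper (iff ==> iff)%signature (pol p).
Proof. intros P P' HP. destruct p; simpl; tauto. Qed.

Lemma op_iff m T P Q : (P <-> Q) -> (op m T P <-> op m T Q).
Proof. destruct m; simpl; tauto. Qed.

(** With [op_ex], this pulls a statement sitting at all leaves out through quantifiers and index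
    sets; inhabited domains are essential for it. *)
Lemma op_all (A : Type) m (dom P : A -> Prop) T : (exists a, dom a) ->
  ((forall a, dom a -> op m T (P a)) <-> op m T (forall a, dom a -> P a)).
Proof.
intros [x0 Hx]. destruct m; simpl.
- split; [|intuition]. intro H. split; [exact (proj1 (H x0 Hx))|]. intros x Hd. apply H. auto.
- split; [|intuition]. intro H. destruct (classic T) as [|Hn]; auto. right.
  intros x Hd. destruct (H x Hd); tauto.
Qed.

Lemma op_ex (A : Type) m (dom P : A -> Prop) T : (exists a, dom a) ->
  ((exists a, dom a /\ op m T (P a)) <-> op m T (exists a, dom a /\ P a)).
Proof. intros [x0 Hx]. destruct m; simpl; firstorder. Qed.

Section Game.
Context {M : ZFC}.
Implicit Types (x y z u v w X Y α β γ δ ζ η κ ξ Ω : M) (φ : formula M) (p : bool) (c : M -> M).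

(** [c] need not be injective; a position records the least index of an ordinal. *)
Definition least_index c i : Prop := forall j, j ∈ i -> c j <> c i.

Lemma least_index_exists α c j : ordinal α -> j ∈ α ->
  exists i, i ∈ α /\ c i = c j /\ least_index c i.
Proof.
intros Ho Hj. destruct (@mem_least M (fun i => i ∈ α /\ c i = c j) j (conj Hj eq_refl)) as [i [[H1 H2] H3]].
exists i. split; auto. split; auto. intros k Hk E. apply (H3 k Hk). split.
- exact (ordinal_trans Ho H1 Hk).
- congruence.
Qed.

Lemma least_index_le c i j : ordinal i -> ordinal j -> c i = c j -> least_index c i -> i = j \/ i ∈ j.
Proof.
intros Hi Hj E H. destruct (ordinal_trichotomy Hi Hj) as [|[|Hji]]; auto.
destruct (H j Hji). auto.
Qed.

(** In a successor move, B codes a whole block of quantifiers and D is a candidate club. The index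
    of 0 is not a legal move, since the position would then reach its leaf with an index as last
    entry instead of a D. *)
Definition game_step c α R η (rec : forall y, y ∈ η -> list M -> Prop) (h : list M) : Prop :=
  (η = empty /\ leaf α R h) \/
  (exists ζ (H : ζ ∈ η), η = succ ζ /\ forall B D, B ⊆ Vh α -> D ⊆ Vh α ->
     ~ rec ζ H (h ++ B :: D :: nil)) \/
  (limit η /\ forall i (H : c i ∈ η), i ∈ α -> least_index c i -> c i <> empty ->
     rec (c i) H (h ++ i :: nil)).

(** The position [h] is won by the player who is not to move; passing through a limit
    level keeps the turn, passing through a successor level changes it. *)
Definition game c α R : M -> list M -> Prop :=
  Fix (@foundation M) (fun _ => list M -> Prop) (@game_step c α R).

Lemma game_eq c α R η h : game c α R η h <-> @game_step c α R η (fun y _ => game c α R y) h.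
Proof.
unfold game. rewrite Fix_eq; [reflexivity|].
intros x f g H. replace g with f; [reflexivity|].
apply functional_extensionality_dep. intro y. apply functional_extensionality_dep. auto.
Qed.

Lemma game_zero c α R h : game c α R empty h <-> leaf α R h.
Proof.
rewrite game_eq. unfold game_step. split.
- intros [[_ H]|[[ζ [H _]]|[H _]]]; auto.
  + destruct (emptyP H).
  + destruct (limit_not_empty H).
- auto.
Qed.

Lemma game_succ c α R ζ h : game c α R (succ ζ) h <->
  forall B D, B ⊆ Vh α -> D ⊆ Vh α -> ~ game c α R ζ (h ++ B :: D :: nil).
Proof.
rewrite game_eq. unfold game_step. split.
- intros [[H _]|[[ζ' [_ [E H]]]|[H _]]].
  + destruct (succ_not_empty H).
  + apply succ_inj in E. subst. auto.
  + destruct (limit_not_succ H).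
- intro H. right; left. exists ζ, (succ_self ζ). auto.
Qed.

Lemma game_limit c α R η h : limit η -> (game c α R η h <->
  forall i, i ∈ α -> c i ∈ η -> least_index c i -> c i <> empty -> game c α R (c i) (h ++ i :: nil)).
Proof.
intro Hl. rewrite game_eq. unfold game_step. split.
- intros [[-> _]|[[ζ' [_ [-> H]]]|[_ H]]].
  + destruct (limit_not_empty Hl).
  + destruct (limit_not_succ Hl).
  + auto.
- auto 6.
Qed.

(** * Formulas expressing the game *)

Definition opf (m : bool) (φ ψ : fo M) : fo M := if m then And φ ψ else Or φ ψ.

Lemma fo_sat_ext2 D (e1 e2 e2' : nat -> M) (φ : fo M) :
  (forall k, fo_occurs φ (Var2 M k) -> e2 k = e2' k) -> (fo_sat D e1 e2 φ <-> fo_sat D e1 e2' φ).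
Proof.
assert (Ht : forall e1 t, (forall k, t = Var2 M k -> e2 k = e2' k) -> eval e1 e2 t = eval e1 e2' t).
{ intros e t H. destruct t; simpl; auto. }
revert e1. induction φ as [s t|s t|φ IH|φ IH1 ψ IH2|n φ IH]; simpl; intros e1 H.
- rewrite (Ht e1 s), (Ht e1 t); [tauto|auto..].
- rewrite (Ht e1 s), (Ht e1 t); [tauto|auto..].
- rewrite IH; [tauto|auto].
- rewrite IH1, IH2; [tauto|auto..].
- split; intros Hs a Ha; apply (IH (upd e1 n a) H); auto.
Qed.

Lemma cut_fo_Var2 α (φ : fo M) k : fo_occurs (cut_fo α φ) (Var2 M k) -> fo_occurs φ (Var2 M k).
Proof.
intro H. apply cut_occurs in H. destruct H as [s [H E]]. destruct s; simpl in E; try discriminate. congruence.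
Qed.

(** Cutting this set to V_α gives the corresponding set for α, so one parameter is correct at every
    α. *)
Definition Vstages κ : M := repl (@Vh M) (sep (@limit M) κ).

Lemma Vstages_cut κ α v : ordinal κ -> ordinal α -> α ⊆ κ -> 
  (v ∈ Vstages κ ∩ Vh α <-> exists β, β ∈ α /\ limit β /\ v = Vh β).
Proof.
intros Hk Ha Hs. unfold Vstages. rewrite sepP, replP. split.
- intros [[β [Hb ->]] Hin]. apply sepP in Hb. destruct Hb as [Hb Hl]. exists β. split; auto.
  apply (ordinal_in_V Ha (proj1 Hl)). apply (@V_sub M α (Vh β)); auto. apply ordinal_sub_V. exact (proj1 Hl).
- intros [β [Hb [Hl ->]]]. split; [|apply V_in; auto]. exists β. rewrite sepP. auto.
Qed.

Definition e0 : nat -> M := fun _ => empty.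
Definition item α e2 (t : term M) : M := value e2 (cut_term α t).

Section Formulas.
Variables (κ Ω : M) (c : M -> M) (m : bool) (θ : fo M) (tR : term M) (n0 : nat) (pars : list M).
Hypothesis (Hκ : limit κ) (HΩ : ordinal Ω) (Hc : covers κ c Ω).
Hypothesis (Hθ1 : forall a, fo_occurs θ (Par1 a) -> a ∈ Vh κ)
  (Hθ2 : forall k, fo_occurs θ (Var2 M k) -> k < n0)
  (Hθp : forall A, fo_occurs θ (Par2 A) -> In A pars)
  (Hθf : forall n, ~ fo_free1 θ n).
Hypothesis (HR : second_order tR) (HR2 : forall k, tR = Var2 M k -> k < n0)
  (HRp : forall A, tR = Par2 A -> In A pars).
Hypothesis (Hpars : forall A, In A pars -> A ⊆ Vh κ) (HV : In (Vstages κ) pars).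

Definition game_point α : Prop :=
  limit α /\ α ⊆ κ /\ index_closed Ω (repl c α).

Definition terms_below n (l : list (term M)) : Prop :=
  Forall (fun t => not_var1 t /\ (forall k, t = Var2 M k -> k < n) /\
    (forall a, t = Par1 a -> a ∈ Vh κ) /\ forall A, t = Par2 A -> In A pars) l.

(** Free second-order variables stay below n, which makes n and n+1 fresh for the next move. Fixing
    the finite list [pars] in advance guarantees finitely many parameters at limits. The clause on
    leaves is the input of [leaves_restr]. *)
Definition expresses p n η l φ : Prop :=
  is_PS p κ η φ /\ (forall n, ~ free1 φ n) /\ (forall k, free2 φ k -> k < n) /\
  (forall A, par2 φ A -> In A pars) /\
  leaves (fun ψ => m = true -> ψ = θ \/ exists χ, ψ = And θ χ) φ /\
  forall α e2, game_point α ->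
    (rsat (repl c α) α e0 e2 φ <->
     op m (fo_sat (Vh α) e0 e2 (cut_fo α θ))
       (pol p (game c α (item α e2 tR) η (map (item α e2) l)))).

Lemma terms_below_app n n' l l' : n <= n' -> terms_below n l -> terms_below n' l' -> terms_below n' (l ++ l').
Proof.
intros Hn Hl Hl'. apply Forall_app. split; auto.
eapply Forall_impl; [|exact Hl]. simpl. intros t [H1 [H2 H3]]. split; auto. split; auto.
intros k E. apply H2 in E. lia.
Qed.

Lemma item_upd α e2 t n A n' : (forall k, t = Var2 M k -> k < n) -> n <= n' ->
  item α (upd e2 n' A) t = item α e2 t.
Proof.
intros H Hn. destruct t as [k|a|k|B]; simpl; auto. unfold item, value. simpl. unfold upd.
destruct (Nat.eqb_spec k n'); auto. specialize (H k eq_refl). lia.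
Qed.

Lemma items_upd α e2 l n A n' : terms_below n l -> n <= n' ->
  map (item α (upd e2 n' A)) l = map (item α e2) l.
Proof.
intros Hl Hn. apply map_ext_in. intros t Ht. apply item_upd with (n := n); auto.
apply (proj1 (Forall_forall _ _) Hl t Ht).
Qed.

Lemma sat_theta_upd α e1 e2 n A : n0 <= n ->
  (fo_sat (Vh α) e1 (upd e2 n A) (cut_fo α θ) <-> fo_sat (Vh α) e1 e2 (cut_fo α θ)).
Proof.
intro Hn. apply fo_sat_ext2. intros k Hk. apply cut_fo_Var2 in Hk. apply Hθ2 in Hk.
unfold upd. destruct (Nat.eqb_spec k n); auto. lia.
Qed.

Lemma expresses_zero p n l : n0 <= n -> terms_below n l -> exists φ, expresses p n empty l φ.
Proof.
intros Hn Hl.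
pose (lf := leaf_fo (Par2 (Vstages κ)) tR l).
pose (lit := if p then lf else Not lf).
assert (Hlo : forall s, fo_occurs lit s <-> fo_occurs lf s) by (intro s; unfold lit; destruct p; reflexivity).
assert (HRn : not_var1 tR) by (destruct tR; simpl in *; auto).
assert (Hln : Forall not_var1 l) by (eapply Forall_impl; [|exact Hl]; simpl; tauto).
assert (Hocc : forall s, fo_occurs (opf m θ lit) s <-> fo_occurs θ s \/ fo_occurs lf s).
{ intro s. rewrite <- Hlo. destruct m; reflexivity. }
assert (Hin : forall s, In s l -> (forall k, s = Var2 M k -> k < n) /\
    (forall a, s = Par1 a -> a ∈ Vh κ) /\ forall A, s = Par2 A -> In A pars).
{ intros s Hs. apply (proj1 (Forall_forall _ _) Hl s Hs). }
exists (FO (opf m θ lit)). split; [|split; [|split; [|split; [|split]]]].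
- assert (Hpp : forall A, fo_occurs (opf m θ lit) (Par2 A) -> In A pars).
  { intros A HA. apply Hocc in HA. destruct HA as [HA|HA]; auto.
    apply occurs_leaf in HA; [|exact I]. destruct HA as [[= ->]|[HA|[HA|HA]]]; auto; try discriminate.
    apply (Hin _ HA). reflexivity. }
  apply is_PS_zero.
  + intros a Ha. apply Hocc in Ha. destruct Ha as [Ha|Ha]; auto.
    apply occurs_leaf in Ha; [|exact I]. destruct Ha as [[=]|[Ha|[[= ->]|Ha]]].
    * rewrite <- Ha in HR. destruct HR.
    * apply V_empty_in. auto.
    * apply (Hin _ Ha). reflexivity.
  + intros A HA. apply Hpars. auto.
- intros k Hk. simpl in Hk.
  assert (Hk' : fo_free1 θ k \/ fo_free1 lf k).
  { unfold lit in Hk. destruct m, p; exact Hk. }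
  destruct Hk' as [Hk'|Hk']; [exact (Hθf Hk')|].
  apply (@free1_leaf M (Par2 (Vstages κ)) tR l k); auto. exact I.
- intros k Hk. simpl in Hk. apply Hocc in Hk. destruct Hk as [Hk|Hk].
  + apply Hθ2 in Hk. lia.
  + apply occurs_leaf in Hk; [|exact I]. destruct Hk as [Hk|[Hk|[Hk|Hk]]]; try discriminate.
    * assert (k < n0) by auto. lia.
    * apply (Hin _ Hk). reflexivity.
- intros A HA. simpl in HA. apply Hocc in HA. destruct HA as [HA|HA]; auto.
  apply occurs_leaf in HA; [|exact I]. destruct HA as [[= ->]|[HA|[HA|HA]]]; auto; try discriminate.
  apply (Hin _ HA). reflexivity.
- simpl. intros Em. right. exists lit. unfold opf. rewrite Em. reflexivity.
- intros α e2 [Hla [Has Hic]]. simpl. rewrite game_zero.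
  assert (Hlf : fo_sat (Vh α) e0 e2 (cut_fo α lf) <-> leaf α (item α e2 tR) (map (item α e2) l)).
  { unfold lf. rewrite cut_leaf, sat_leaf; auto.
    - unfold item. rewrite map_map. reflexivity.
    - apply Forall_map. eapply Forall_impl; [|exact Hln]. intro t. apply not_var1_cut.
    - apply not_var1_cut; auto.
    - exact I.
    - intros v _. unfold value. simpl. apply Vstages_cut; auto; [exact (proj1 Hκ)|exact (proj1 Hla)]. }
  rewrite <- Hlf. unfold lit. destruct m, p; simpl; try tauto.
Qed.

(** The two quantifiers of a move are read as one quantifier over pairs, so θ is pulled out in one
    step. *)
Lemma expresses_succ p n ζ l : n0 <= n -> terms_below n l ->
  (forall n' l', n0 <= n' -> terms_below n' l' -> exists φ, expresses (negb p) n' ζ l' φ) ->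
  exists φ, expresses p n (succ ζ) l φ.
Proof.
intros Hn Hl IH.
destruct (IH (S (S n)) (l ++ Var2 M n :: Var2 M (S n) :: nil)) as [ψ [H1 [H2 [H3 [H4 [H5 H6]]]]]].
{ lia. }
{ apply (@terms_below_app n); auto.
  apply Forall_cons; [|apply Forall_cons; [|apply Forall_nil]];
    (split; [exact I|]; split; [intros k [= <-]; lia|]; split; discriminate). }
exists (quants p (n :: S n :: nil) ψ). split; [|split; [|split; [|split; [|split]]]].
- apply is_PS_succ. exact H1.
- intros k. rewrite free1_quants. apply H2.
- intros k. rewrite free2_quants. intros [Hk Hf]. apply H3 in Hf. simpl in Hk. lia.
- intros A. rewrite par2_quants. apply H4.
- rewrite leaves_quants. exact H5.
- intros α e2 Ha. rewrite game_succ.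
  assert (Hrec : forall B D, rsat (repl c α) α e0 (upd (upd e2 n B) (S n) D) ψ <->
    op m (fo_sat (Vh α) e0 e2 (cut_fo α θ))
      (pol (negb p) (game c α (item α e2 tR) ζ (map (item α e2) l ++ B :: D :: nil)))).
  { intros B D. rewrite H6; auto. rewrite !sat_theta_upd; try lia.
    rewrite !(@item_upd _ _ tR n0); try lia; auto.
    rewrite map_app, (@items_upd _ _ l n), (@items_upd _ _ l n); auto.
    replace (map (item α (upd (upd e2 n B) (S n) D)) (Var2 M n :: Var2 M (S n) :: nil)) with (B :: D :: nil); [reflexivity|].
    unfold item, value. simpl. unfold upd.
    rewrite Nat.eqb_refl. destruct (Nat.eqb_spec n (S n)); [lia|]. rewrite Nat.eqb_refl. reflexivity. }
  assert (Hne : exists x : M * M, fst x ⊆ Vh α /\ snd x ⊆ Vh α).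
  { exists (empty, empty). simpl. split; intros w Hw; destruct (emptyP Hw). }
  destruct p; simpl.
  + transitivity (forall x : M * M, fst x ⊆ Vh α /\ snd x ⊆ Vh α ->
      op m (fo_sat (Vh α) e0 e2 (cut_fo α θ)) (~ game c α (item α e2 tR) ζ (map (item α e2) l ++ fst x :: snd x :: nil))).
    * split.
      -- intros H [B D] [HB HD]. apply Hrec. apply H; auto.
      -- intros H B HB D HD. apply Hrec. apply (H (B, D)); auto.
    * rewrite op_all; auto. apply op_iff. split.
      -- intros H B D HB HD. apply (H (B, D)); auto.
      -- intros H [B D] [HB HD]. apply H; auto.
  + transitivity (exists x : M * M, (fst x ⊆ Vh α /\ snd x ⊆ Vh α) /\
      op m (fo_sat (Vh α) e0 e2 (cut_fo α θ)) (game c α (item α e2 tR) ζ (map (item α e2) l ++ fst x :: snd x :: nil))).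
    * split.
      -- intros [B [HB [D [HD H]]]]. exists (B, D). split; auto. apply Hrec in H. exact H.
      -- intros [[B D] [[HB HD] H]]. exists B. split; auto. exists D. split; auto. apply Hrec. exact H.
    * rewrite op_ex; auto. apply op_iff. split.
      -- intros [[B D] [[HB HD] H]] Hall. exact (Hall B D HB HD H).
      -- intro H. apply NNPP. intro Hn'. apply H. intros B D HB HD HG. apply Hn'. exists (B, D). auto.
Qed.

Lemma expresses_limit p n η l : n0 <= n -> terms_below n l -> limit η -> η ∈ Ω ->
  (forall ζ, ζ ∈ η -> forall n' l', n0 <= n' -> terms_below n' l' -> exists φ, expresses p n' ζ l' φ) ->
  exists φ, expresses p n η l φ.
Proof.
intros Hn Hl Hlim HηΩ IH.
(* The conjunct of index [0] carries no information beyond [θ]. *)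
pose (z := if m then (if p then θ else And θ (Not θ)) else (if p then Or θ (Not θ) else θ)).
assert (Hzo : forall s, fo_occurs z s -> fo_occurs θ s).
{ intro s. unfold z. destruct m, p; simpl; tauto. }
assert (Hch : forall ζ, ζ ∈ η -> exists ψ,
  (ζ = empty -> ψ = FO z) /\
  (ζ <> empty -> exists i, i ∈ κ /\ c i = ζ /\ least_index c i /\ expresses p n ζ (l ++ Par1 i :: nil) ψ)).
{ intros ζ Hz. destruct (classic (ζ = empty)) as [He|He].
  - exists (FO z). tauto.
  - destruct (proj2 Hc ζ (ordinal_trans HΩ HηΩ Hz)) as [j [Hj Ej]].
    destruct (@least_index_exists κ c j (proj1 Hκ) Hj) as [i [Hi [Ei Hli]]].
    destruct (IH ζ Hz n (l ++ Par1 i :: nil)) as [ψ Hψ]; auto.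
    { apply (@terms_below_app n); auto. apply Forall_cons; [|apply Forall_nil].
      split; [exact I|]. split; [discriminate|]. split; [|discriminate].
      intros a [= <-]. apply ordinal_sub_V; auto. exact (proj1 Hκ). }
    exists ψ. split; [tauto|]. intros _. exists i. split; auto. split; [congruence|auto]. }
destruct (choice_on (FO θ) Hch) as [ψ Hψ].
assert (H0 : empty ∈ η) by exact (limit_num_in 0 Hlim).
assert (Hzero : ψ empty = FO z) by (apply (Hψ empty H0); reflexivity).
assert (Hcases : forall (Q : formula M -> Prop), Q (FO z) ->
  (forall ζ i ψ, expresses p n ζ (l ++ Par1 i :: nil) ψ -> Q ψ) -> forall ζ, ζ ∈ η -> Q (ψ ζ)).
{ intros Q Q0 Q1 ζ Hz. destruct (classic (ζ = empty)) as [->|He]; [rewrite Hzero; exact Q0|].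
  destruct (proj2 (Hψ ζ Hz) He) as [i [_ [_ [_ Hi]]]]. exact (Q1 _ _ _ Hi). }
assert (Hf2 : forall ζ, ζ ∈ η -> forall k, free2 (ψ ζ) k -> k < n).
{ apply (Hcases (fun φ => forall k, free2 φ k -> k < n)).
  - intros k Hk. apply Hzo, Hθ2 in Hk. lia.
  - intros ζ i χ [_ [_ [H _]]]. exact H. }
assert (Hp2 : forall ζ, ζ ∈ η -> forall A, par2 (ψ ζ) A -> In A pars).
{ apply (Hcases (fun φ => forall A, par2 φ A -> In A pars)).
  - intros A HA. apply Hzo in HA. auto.
  - intros ζ i χ [_ [_ [_ [H _]]]]. exact H. }
exists (big p η ψ). split; [|split; [|split; [|split; [|split]]]].
- apply is_PS_limit; auto.
  + intros ζ Hz. destruct (classic (ζ = empty)) as [->|He].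
    * rewrite Hzero. apply is_PS_zero; intros a Ha; apply Hzo in Ha; auto.
      intros w Hw. apply (Hpars (Hθp Ha)); auto.
    * destruct (proj2 (Hψ ζ Hz) He) as [i [_ [_ [_ Hi]]]]. exact (proj1 Hi).
  + split; apply Finite_iff_list.
    * exists (seq 0 n). intros k. rewrite free2_big. intros [ζ [Hz Hk]]. apply Hf2 in Hk; auto.
      apply in_seq. lia.
    * exists pars. intros A. rewrite par2_big. intros [ζ [Hz HA]]. exact (Hp2 ζ Hz A HA).
- intros k. rewrite free1_big. intros [ζ [Hz Hk]]. revert ζ Hz Hk.
  apply (Hcases (fun φ => ~ free1 φ k)).
  + simpl. unfold z. specialize (@Hθf k). destruct m, p; simpl; tauto.
  + intros ζ i χ [_ [H _]]. apply H.
- intros k. rewrite free2_big. intros [ζ [Hz Hk]]. exact (Hf2 ζ Hz k Hk).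
- intros A. rewrite par2_big. intros [ζ [Hz Hk]]. exact (Hp2 ζ Hz A Hk).
- rewrite leaves_big. split; [exact (proj1 (proj2 Hlim))|].
  apply (Hcases (fun φ => leaves _ φ)).
  + simpl. intro Em. unfold z. rewrite Em. destruct p; eauto.
  + intros ζ i χ [_ [_ [_ [_ [H _]]]]]. exact H.
- intros α e2 Ha. rewrite game_limit; auto. destruct Ha as [Hla [Has Hic]].
  assert (Hg : game_point α) by (split; auto).
  set (T := fo_sat (Vh α) e0 e2 (cut_fo α θ)).
  pose (G := fun ζ => if excluded_middle_informative (ζ = empty) then True else
     forall i, i ∈ α -> c i = ζ -> least_index c i ->
       game c α (item α e2 tR) ζ (map (item α e2) l ++ i :: nil)).
  assert (Hrec : forall ζ, ζ ∈ η -> ζ ∈ repl c α ->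
    (rsat (repl c α) α e0 e2 (ψ ζ) <-> op m T (pol p (G ζ)))).
  { intros ζ Hz HzX. unfold G. destruct (excluded_middle_informative (ζ = empty)) as [->|He].
    - rewrite Hzero. simpl. unfold z, T. destruct m, p; simpl; tauto.
    - destruct (proj2 (Hψ ζ Hz) He) as [i [Hi [Ei [Hli Hex]]]].
      assert (Hex' := proj2 (proj2 (proj2 (proj2 (proj2 Hex)))) α e2 Hg).
      rewrite Hex'. apply op_iff. rewrite map_app.
      change (map (item α e2) (Par1 i :: nil)) with (i :: nil).
      assert (Hio : ordinal i) by exact (ordinal_in (proj1 Hκ) Hi).
      (* The parameter i was chosen as the least index in κ. As ζ has some index below α, the least
         one is below α too, so the same i is right at every α. *)
      assert (Hia : i ∈ α).
      { apply replP in HzX. destruct HzX as [j [Hj Ej]].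
        destruct (@least_index_le c i j) as [->|Hij]; auto.
        - exact (ordinal_in (proj1 Hla) Hj).
        - congruence.
        - exact (ordinal_trans (proj1 Hla) Hj Hij). }
      assert (HG : game c α (item α e2 tR) ζ (map (item α e2) l ++ i :: nil) <->
        forall i, i ∈ α -> c i = ζ -> least_index c i ->
          game c α (item α e2 tR) ζ (map (item α e2) l ++ i :: nil)).
      { split; [|auto]. intros HG j Hj Ej Hlj.
        assert (Hjo : ordinal j) by exact (ordinal_in (proj1 Hla) Hj).
        destruct (@least_index_le c i j) as [->|Hij]; auto; [congruence|].
        destruct (Hlj i Hij). congruence. }
      destruct p; simpl; [exact HG|]. rewrite HG. reflexivity. }
  assert (Hne : exists ζ, ζ ∈ η /\ ζ ∈ repl c α).
  { exists empty. split; auto. exact (index_empty Hic). }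
  assert (HG : (forall ζ, ζ ∈ η /\ ζ ∈ repl c α -> G ζ) <->
    forall i, i ∈ α -> c i ∈ η -> least_index c i -> c i <> empty ->
      game c α (item α e2 tR) (c i) (map (item α e2) l ++ i :: nil)).
  { split.
    - intros H i Hi Hci Hli He. assert (HGi : G (c i)) by (apply H; split; [auto|apply replP; eauto]).
      unfold G in HGi. destruct (excluded_middle_informative (c i = empty)); [contradiction|]. auto.
    - intros H ζ [Hz HzX]. unfold G. destruct (excluded_middle_informative (ζ = empty)); auto.
      intros i Hi <- Hli. auto. }
  destruct p; simpl.
  + rewrite <- HG, <- op_all; auto. split.
    * intros H ζ [Hz HzX]. apply (proj1 (Hrec ζ Hz HzX)). exact (H ζ Hz HzX).
    * intros H ζ Hz HzX. apply (proj2 (Hrec ζ Hz HzX)). exact (H ζ (conj Hz HzX)).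
  + transitivity (exists ζ, (ζ ∈ η /\ ζ ∈ repl c α) /\ op m T (~ G ζ)).
    * split.
      -- intros [ζ [Hz [HzX H]]]. exists ζ. split; auto. exact (proj1 (Hrec ζ Hz HzX) H).
      -- intros [ζ [[Hz HzX] H]]. exists ζ. split; auto. split; auto. exact (proj2 (Hrec ζ Hz HzX) H).
    * rewrite op_ex; auto. apply op_iff. rewrite <- HG. split.
      -- intros [ζ [Hz Hn']] H. exact (Hn' (H ζ Hz)).
      -- intro H. apply NNPP. intro Hn'. apply H. intros ζ Hz. apply NNPP. eauto.
Qed.

Lemma expresses_exists η : η ∈ Ω -> forall p n l, n0 <= n -> terms_below n l ->
  exists φ, expresses p n η l φ.
Proof.
induction (foundation η) as [η _ IH]. intros HηΩ p n l Hn Hl.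
destruct (ordinal_cases (ordinal_in HΩ HηΩ)) as [->|[[ζ [_ ->]]|Hlim]].
- apply expresses_zero; auto.
- apply expresses_succ; auto. intros n' l' Hn' Hl'. apply IH; auto.
  + apply succ_self.
  + exact (ordinal_trans HΩ HηΩ (succ_self ζ)).
- apply expresses_limit; auto. intros ζ Hz n' l' Hn' Hl'. apply IH; auto.
  exact (ordinal_trans HΩ HηΩ Hz).
Qed.

End Formulas.
End Game.

(** * Coding arbitrary formulas by games *)

Section Coding.
Context {M : ZFC}.
Implicit Types (x y z u v w X Y α β γ δ ζ η κ ξ Ω : M) (φ : formula M) (p : bool) (c : M -> M) (h l : list M).

(** * Coding blocks of second-order variables *)

Definition decode (k : nat) B : M := sep (fun y => opair (num k) y ∈ B) (union (union B)).

Lemma in_decode k B y : y ∈ decode k B <-> opair (num k) y ∈ B.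
Proof.
unfold decode. rewrite sepP. split; [tauto|]. intro H. split; auto.
rewrite unionP. exists (pair (num k) y). rewrite pairP. split; auto.
rewrite unionP. exists (opair (num k) y). split; auto. apply pairP. auto.
Qed.

Lemma decode_cut β k B : limit β -> decode k (B ∩ Vh β) = decode k B ∩ Vh β.
Proof.
intro Hl. apply extensionality. intro y. rewrite sepP, !in_decode, sepP, V_opair; auto.
split; [tauto|]. intros [H1 H2]. split; auto. split; auto.
apply ordinal_sub_V; [exact (proj1 Hl)|]. apply limit_num_in. auto.
Qed.

Definition encode α (ks : list nat) (f : nat -> M) : M :=
  sep (fun q => exists k y, In k ks /\ y ∈ f k /\ q = opair (num k) y) (Vh α).

Lemma decode_encode α ks f k : limit α -> f k ⊆ Vh α -> In k ks -> decode k (encode α ks f) = f k.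
Proof.
intros Hl Hf Hk. apply extensionality. intro y. rewrite in_decode. unfold encode. rewrite sepP. split.
- intros [_ [k' [y' [_ [Hy E]]]]]. apply opair_inj in E. destruct E as [E ->].
  apply num_inj in E. subst. exact Hy.
- intro Hy. split; [|eauto 6]. apply V_opair; auto. split; auto.
  apply ordinal_sub_V; [exact (proj1 Hl)|]. apply limit_num_in. auto.
Qed.

Definition overlay (e2 : nat -> M) (ks : list nat) (f : nat -> M) : nat -> M :=
  fun k => if in_dec Nat.eq_dec k ks then f k else e2 k.

(** A block is a single simultaneous choice f. For either polarity it appears here as a universal
    choice, which matches the player to move in the game. *)
Lemma pol_quants X α e1 p ks φ : forall e2,
  pol p (rsat X α e1 e2 (quants p ks φ)) <->
  forall f, (forall k, f k ⊆ Vh α) -> pol p (rsat X α e1 (overlay e2 ks f) φ).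
Proof.
induction ks as [|j ks IH]; intro e2.
- assert (E : forall f, overlay e2 nil f = e2) by reflexivity.
  replace (quants p nil φ) with φ by (destruct p; reflexivity).
  split; [intros H f _; rewrite E; exact H|]. intro H.
  specialize (H (fun _ => empty)). rewrite E in H. apply H. intros k w Hw. destruct (emptyP Hw).
- transitivity (forall A, A ⊆ Vh α -> pol p (rsat X α e1 (upd e2 j A) (quants p ks φ))).
  { destruct p; simpl; [tauto|]. split.
    - intros H A HA Hs. apply H. eauto.
    - intros H [A [HA Hs]]. exact (H A HA Hs). }
  split.
  + intros H f Hf. specialize (H (f j) (Hf j)). rewrite IH in H. specialize (H f Hf).
    replace (overlay e2 (j :: ks) f) with (overlay (upd e2 j (f j)) ks f); auto.
    apply functional_extensionality. intro k. unfold overlay, upd.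
    destruct (in_dec Nat.eq_dec k (j :: ks)) as [H1|H1], (in_dec Nat.eq_dec k ks) as [H2|H2]; simpl in *; auto.
    * destruct (Nat.eqb_spec k j) as [->|]; auto. intuition congruence.
    * tauto.
    * destruct (Nat.eqb_spec k j) as [->|]; auto. tauto.
  + intros H A HA. apply IH. intros f Hf.
    (* A variable repeated in the block takes the value of its innermost quantifier, so the value at
       j is A only if j does not recur in [ks]. *)
    specialize (H (overlay (upd (fun _ => empty) j A) ks f)).
    replace (overlay (upd e2 j A) ks f) with
      (overlay e2 (j :: ks) (overlay (upd (fun _ => empty) j A) ks f)).
    * apply H. intros k. unfold overlay. destruct (in_dec Nat.eq_dec k ks); [apply Hf|].
      unfold upd. destruct (Nat.eqb k j); auto. intros w Hw. destruct (emptyP Hw).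
    * apply functional_extensionality. intro k. unfold overlay, upd.
      destruct (in_dec Nat.eq_dec k (j :: ks)) as [H1|H1], (in_dec Nat.eq_dec k ks) as [H2|H2]; simpl in *; auto.
      -- destruct (Nat.eqb_spec k j) as [->|]; auto. intuition congruence.
      -- tauto.
      -- destruct (Nat.eqb_spec k j) as [->|]; auto. tauto.
Qed.

(** * Leaves *)

Lemma cofinal_Cl_accum α D : inaccessible α -> cofinal (Vh α) D ->
  Cl α (fun β => accum D (Vh β)).
Proof.
intros Ha HD. assert (Hl := regular_limit (proj1 Ha)).
assert (H : forall i, i ∈ α -> exists j, j ∈ α /\ forall y, y ∈ Vh i ->
  exists k, k ∈ j /\ exists w, w ∈ D /\ w ∈ Vh k /\ y ∈ w).
{ intros i Hi.
  destruct (@choice_on M M empty (Vh i) (fun y k => k ∈ α /\ exists w, w ∈ D /\ w ∈ Vh k /\ y ∈ w)) as [f Hf].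
  { intros y Hy. destruct (HD y) as [w [Hw [HwD Hyw]]].
    - apply (@V_mono M i α); auto. exact (proj1 (proj1 Hl) i Hi).
    - destruct (V_rank Hl Hw) as [k [Hk Hwk]]. eauto 6. }
  destruct (V_bound (F := f) Ha Hi) as [j [Hj HG]]; [intros y Hy; apply Hf; auto|].
  exists j. split; auto. intros y Hy. exists (f y). split; auto. apply Hf; auto. }
destruct (choice_on empty H) as [g Hg].
exists g. split; [intros i Hi; apply Hg; auto|].
intros β Hb Hlb Hc y Hy. destruct (V_rank Hlb Hy) as [i [Hi Hyi]].
destruct (proj2 (Hg i (ordinal_trans (proj1 Hl) Hb Hi)) y Hyi) as [k [Hk [w [H1 [H2 H3]]]]].
exists w. split; auto. split; auto.
apply (@V_mono M k β); auto. apply (proj1 (proj1 Hlb)).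
exact (ordinal_trans (proj1 Hlb) (Hc i Hi) Hk).
Qed.

(** A closure function g turned into a second-order object: V_β can be a limit of these stages only
    if β is closed under g. *)
Definition closure_stages α (g : M -> M) : M := repl (@Vh M) (sep (fun γ => limit γ /\ closed g γ) α).

Lemma closure_stages_sub α g : closure_stages α g ⊆ Vh α.
Proof.
intros w Hw. apply replP in Hw. destruct Hw as [γ [Hg ->]]. apply sepP in Hg. apply V_in. tauto.
Qed.

Lemma closure_stages_cofinal α g : regular α -> omega M ∈ α -> closed g α ->
  cofinal (Vh α) (closure_stages α g).
Proof.
intros Ha Hw Hg x Hx. destruct (V_rank (regular_limit Ha) Hx) as [β [Hb Hxb]].
destruct (closed_unbounded Ha Hw Hg Hb) as [γ [H1 [H2 [H3 H4]]]].
exists (Vh γ). split; [apply V_in; auto|]. split.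
- apply replP. exists γ. rewrite sepP. auto.
- apply (@V_mono M β γ); auto. exact (proj1 (proj1 H2) β H4).
Qed.

Lemma closure_stages_accum α g β : ordinal β -> accum (closure_stages α g) (Vh β) -> closed g β.
Proof.
intros Hb Hac i Hi. destruct (Hac i) as [w [H1 [H2 H3]]]; [apply ordinal_sub_V; auto|].
apply replP in H1. destruct H1 as [γ [Hg ->]]. apply sepP in Hg. destruct Hg as [_ [Hl Hc]].
assert (Hio := ordinal_in Hb Hi).
assert (Hgb : γ ∈ β).
{ apply (ordinal_in_V Hb (proj1 Hl)). apply (V_sub H2). apply ordinal_sub_V. exact (proj1 Hl). }
apply (ordinal_trans Hb Hgb). apply Hc. apply (ordinal_in_V (proj1 Hl) Hio). exact H3.
Qed.

Definition agrees α R (Lf : M -> list M -> Prop) h : Prop :=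
  exists β0, β0 ∈ α /\ forall β, β ∈ α -> limit β -> β0 ∈ β -> forall l,
    (tuple (Vh β) (cutl β (h ++ l)) ∈ R <-> Lf β (cutl β (h ++ l))).

(** [dec] reads an assignment off a position. Commuting with cuts lets reflection of the assignment
    follow from cutting the moves. *)
Definition cut_compatible (dec : list M -> nat -> M) : Prop :=
  forall β, limit β -> forall h k, dec (cutl β h) k = dec h k ∩ Vh β.

Lemma cutl_id α h : (forall x, In x h -> x ⊆ Vh α) -> cutl α h = h.
Proof.
intro H. unfold cutl. transitivity (map (fun x => x) h); [|apply map_id].
apply map_ext_in. intros x Hx. apply cut_of_sub. exact (H x Hx).
Qed.

Lemma dec_sub α dec h k : limit α -> cut_compatible dec -> (forall x, In x h -> x ⊆ Vh α) ->
  dec h k ⊆ Vh α.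
Proof.
intros Hl Hd Hh. rewrite <- (cutl_id Hh), Hd; auto. apply cut_sub.
Qed.

Lemma firstn_exact h l n : length h = n -> firstn n (h ++ l) = h.
Proof.
intro H. rewrite firstn_app, firstn_all2, <- H, Nat.sub_diag; [|lia]. apply app_nil_r.
Qed.

Lemma nth_exact h x l n d : length h = n -> nth n (h ++ x :: l) d = x.
Proof. intros <-. rewrite app_nth2, Nat.sub_diag; auto. Qed.

Lemma length_cutl β h : length (cutl β h) = length h.
Proof. apply length_map. Qed.

(** On a club of β the code R gives the constant truth value of ψ in V_α. If ψ has the wanted value,
    the stages of this club form a winning D; conversely, every cofinal D has an accumulation stage
    V_β with β in the club. *)
Lemma leaf_codes q n dec (ψ : fo M) : cut_compatible dec ->
  exists Lf, forall α X, inaccessible α -> omega M ∈ α ->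
    (forall a, fo_occurs ψ (Par1 a) -> a ∈ Vh α) ->
    forall R h, length h = n -> (forall x, In x h -> x ⊆ Vh α) -> agrees α R Lf h ->
    (pol q (rsat X α e0 (dec h) (FO ψ)) <-> exists D, D ⊆ Vh α /\ leaf α R (h ++ D :: nil)).
Proof.
intro Hd. exists (fun β l => pol q (fo_sat (Vh β) e0 (dec (firstn n l)) (cut_fo β ψ))).
intros α X Ha Hw Hp R h Hn Hh [β0 [Hb0 HA]]. simpl.
assert (Hl := regular_limit (proj1 Ha)).
assert (HC : Cl α (fun β => β0 ∈ β /\ forall D,
   (tuple (Vh β) (cutl β (h ++ D :: nil)) ∈ R <-> pol q (fo_sat (Vh α) e0 (dec h) (cut_fo α ψ))))).
{ eapply Cl_mono; [|apply (Cl_and (proj1 Ha) (Cl_tail Hb0)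
    (@Cl_reflection M α ψ (dec h) Ha Hp (fun k => @dec_sub α dec h k Hl Hd Hh)))].
  simpl. intros β Hb Hlb [H1 H2]. split; auto. intro D. rewrite (HA β Hb Hlb H1).
  rewrite cutl_app, firstn_exact; [|rewrite length_cutl; auto].
  replace (dec (cutl β h)) with (fun k => dec h k ∩ Vh β) by (apply functional_extensionality; intro k; rewrite Hd; auto).
  rewrite H2; [reflexivity|]. intro m. apply V_empty_in. auto. }
split.
- intro Hs. destruct HC as [g [Hg HC]].
  exists (closure_stages α g). split; [apply closure_stages_sub|].
  unfold leaf. rewrite last_last. split; [apply closure_stages_cofinal; auto; exact (proj1 Ha)|].
  intros β Hb Hlb Hac. apply (HC β Hb Hlb); auto.
  apply (@closure_stages_accum α g β); auto. exact (proj1 Hlb).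
- intros [D [HD [Hcof HL]]]. rewrite last_last in Hcof, HL.
  destruct (Cl_meets (proj1 Ha) Hw (Cl_and (proj1 Ha) HC (cofinal_Cl_accum Ha Hcof)) Hb0)
    as [β [Hb [Hlb [_ [[H1 H2] H3]]]]].
  apply (H2 D). apply HL; auto.
Qed.

(** * Every formula is coded by a leaf test *)

Section Codes.
Variables (κ Ω : M) (c : M -> M).
Hypothesis (HΩ : ordinal Ω).

Definition code_point α φ : Prop :=
  inaccessible α /\ omega M ∈ α /\ index_closed Ω (repl c α) /\ params_in (repl c α) α φ.

(** The test [Lf] is chosen before α, so that one set R serves V_κ and its traces serve the V_α. *)
Definition codes p n dec φ η' : Prop :=
  exists Lf, forall α, code_point α φ -> forall R h, length h = n ->
    (forall x, In x h -> x ⊆ Vh α) -> agrees α R Lf h ->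
    (pol p (rsat (repl c α) α e0 (dec h) φ) <-> game c α R η' h).

(** Levels below [ω] may be raised: a first-order leaf cannot be coded at level [0]. *)
Definition lifts η η' : Prop :=
  η' <> empty /\ (η' = η \/ (η' ∈ omega M /\ η ∈ η')).

Lemma pol_negb p P : pol p P <-> ~ pol (negb p) P.
Proof. destruct p; simpl; tauto. Qed.

Lemma agrees_app α R Lf h l : agrees α R Lf h -> agrees α R Lf (h ++ l).
Proof.
intros [β0 [Hb0 H]]. exists β0. split; auto. intros β Hb Hlb H0 l'.
rewrite <- app_assoc. apply H; auto.
Qed.

Lemma in_app_sub α h l : (forall x, In x h -> x ⊆ Vh α) -> (forall x, In x l -> x ⊆ Vh α) ->
  forall x, In x (h ++ l) -> x ⊆ Vh α.
Proof. intros H1 H2 x Hx. apply in_app_or in Hx. destruct Hx; eauto. Qed.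

Lemma cut_compatible_firstn n dec : cut_compatible dec -> cut_compatible (fun l => dec (firstn n l)).
Proof. intros Hd β Hl h k. unfold cutl. rewrite firstn_map. apply Hd. auto. Qed.

(** Place n of the position is the B of the current move; the D at place n+1 is not read as an
    assignment. *)
Definition dec_block n dec ks : list M -> nat -> M :=
  fun l => overlay (dec (firstn n l)) ks (fun k => decode k (nth n l empty)).

Lemma cut_compatible_block n dec ks : cut_compatible dec -> cut_compatible (dec_block n dec ks).
Proof.
intros Hd β Hl h k. unfold dec_block, overlay. destruct (in_dec Nat.eq_dec k ks).
- rewrite <- decode_cut; auto. f_equal. unfold cutl.
  rewrite <- (map_nth (fun x => x ∩ Vh β)). f_equal.
  apply extensionality. intro w. rewrite sepP. split; [|tauto]. intro Hw. destruct (emptyP Hw).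
- unfold cutl. rewrite firstn_map. apply Hd. auto.
Qed.

Lemma pol_quants_block X α p ks φ n dec h l : limit α -> length h = n ->
  (pol p (rsat X α e0 (dec h) (quants p ks φ)) <->
   forall B, B ⊆ Vh α -> pol p (rsat X α e0 (dec_block n dec ks (h ++ B :: l)) φ)).
Proof.
intros Hl Hn. rewrite pol_quants. split.
- intros H B HB. unfold dec_block. rewrite firstn_exact, nth_exact; auto. apply H.
  intros k y Hy. apply in_decode in Hy. apply HB in Hy. apply V_opair in Hy; tauto.
- intros H f Hf. specialize (H (encode α ks f)).
  replace (overlay (dec h) ks f) with (dec_block n dec ks (h ++ encode α ks f :: l)).
  + apply H. intros w Hw. apply sepP in Hw. tauto.
  + apply functional_extensionality. intro k. unfold dec_block. rewrite firstn_exact, nth_exact; auto.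
    unfold overlay. destruct (in_dec Nat.eq_dec k ks); auto. apply decode_encode; auto. exact (Hf k).
Qed.

(** The test is taken for the opposite polarity: the matrix has the wanted value for B iff no D
    passes. This turns the D of the test into a move of the same player as B, and no further level
    is spent. *)
Lemma codes_leaf p n dec ks (ψ : fo M) : cut_compatible dec ->
  codes p n dec (quants p ks (FO ψ)) (succ empty).
Proof.
intro Hd. destruct (@leaf_codes (negb p) (S n) (dec_block n dec ks) ψ) as [Lf HL].
{ apply cut_compatible_block; auto. }
exists Lf. intros α [Ha [Hw [_ Hp]]] R h Hn Hh HA. rewrite params_in_quants in Hp.
assert (Hl := regular_limit (proj1 Ha)).
rewrite game_succ, (@pol_quants_block _ _ _ _ _ n _ _ nil); auto.
assert (Hrec : forall B, B ⊆ Vh α -> (pol p (rsat (repl c α) α e0 (dec_block n dec ks (h ++ B :: nil)) (FO ψ)) <->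
  ~ exists D, D ⊆ Vh α /\ leaf α R ((h ++ B :: nil) ++ D :: nil))).
{ intros B HB. rewrite pol_negb. rewrite (HL α (repl c α) Ha Hw Hp R); [reflexivity|..].
  - rewrite length_app. simpl. lia.
  - apply in_app_sub; auto. intros x [<-|[]]. exact HB.
  - apply agrees_app. auto. }
split.
- intros H B D HB HD. rewrite game_zero. intro Hlf. apply (proj1 (Hrec B HB) (H B HB)).
  exists D. rewrite <- app_assoc. auto.
- intros H B HB. apply Hrec; auto. intros [D [HD Hlf]]. rewrite <- app_assoc in Hlf.
  apply (H B D HB HD). rewrite game_zero. exact Hlf.
Qed.

Lemma codes_succ p n dec ks ψ ζ' : cut_compatible dec ->
  codes (negb p) (S (S n)) (dec_block n dec ks) ψ ζ' ->
  codes p n dec (quants p ks ψ) (succ ζ').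
Proof.
intros Hd [Lf HL]. exists Lf. intros α [Ha [Hw [Hic Hp]]] R h Hn Hh HA.
rewrite params_in_quants in Hp. assert (Hl := regular_limit (proj1 Ha)).
rewrite game_succ.
assert (Hrec : forall B D, B ⊆ Vh α -> D ⊆ Vh α ->
  (pol p (rsat (repl c α) α e0 (dec_block n dec ks (h ++ B :: D :: nil)) ψ) <->
   ~ game c α R ζ' (h ++ B :: D :: nil))).
{ intros B D HB HD. rewrite pol_negb, (HL α (conj Ha (conj Hw (conj Hic Hp))) R); [reflexivity|..].
  - rewrite length_app. simpl. lia.
  - apply in_app_sub; auto. intros x [<-|[<-|[]]]; auto.
  - apply agrees_app. auto. }
split.
- intros H B D HB HD. apply Hrec; auto.
  rewrite (@pol_quants_block _ _ _ _ _ n _ _ (D :: nil)) in H; auto.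
(* The formula does not depend on the D of this move, so the empty set serves as one. *)
- intros H. rewrite (@pol_quants_block _ _ _ _ _ n _ _ (empty :: nil)); auto.
  intros B HB. assert (HE : @empty M ⊆ Vh α) by (intros w Hw'; destruct (emptyP Hw')).
  apply Hrec; auto.
Qed.

Lemma codes_FO (ψ : fo M) m : forall p n dec, cut_compatible dec -> codes p n dec (FO ψ) (num (S m)).
Proof.
induction m as [|m IH]; intros p n dec Hd.
- replace (FO ψ) with (quants p nil (FO ψ)) by (destruct p; reflexivity). apply codes_leaf; auto.
- replace (FO ψ) with (quants p nil (FO ψ)) by (destruct p; reflexivity). apply codes_succ; auto.
  apply IH. apply cut_compatible_block; auto.
Qed.

Lemma in_omega_succ ζ : ζ ∈ omega M -> succ ζ ∈ omega M.
Proof. rewrite !in_omega. intros [n ->]. exists (S n). reflexivity. Qed.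

Lemma omega_cases η : η ∈ omega M -> η <> empty -> exists ζ, ζ ∈ omega M /\ η = succ ζ.
Proof.
rewrite in_omega. intros [[|n] ->] He; simpl in *; [tauto|].
exists (num n). rewrite in_omega. eauto.
Qed.

(** On ordinals this is 1+ζ: it is injective and maps a limit η onto its nonzero elements, which are
    the legal indices at a limit level. *)
Definition raise ζ : M := if excluded_middle_informative (ζ ∈ omega M) then succ ζ else ζ.

Lemma raise_inj ζ ζ' : raise ζ = raise ζ' -> ζ = ζ'.
Proof.
assert (Hp : forall ζ, succ ζ ∈ omega M -> ζ ∈ omega M).
{ intros τ Ht. exact (ordinal_trans ordinal_omega Ht (succ_self τ)). }
unfold raise. destruct (excluded_middle_informative (ζ ∈ omega M)) as [H1|H1];
  destruct (excluded_middle_informative (ζ' ∈ omega M)) as [H2|H2]; intro E; auto.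
- apply succ_inj; auto.
- subst ζ'. destruct H2. apply in_omega_succ; auto.
- subst ζ. destruct H1. apply in_omega_succ; auto.
Qed.

Lemma raise_lifts ζ : lifts ζ (raise ζ).
Proof.
unfold raise, lifts. destruct (excluded_middle_informative (ζ ∈ omega M)) as [H|H].
- split; [apply succ_not_empty|]. right. split; [apply in_omega_succ; auto|apply succ_self].
- split; auto. intros ->. apply H. apply in_omega. exists 0. reflexivity.
Qed.

(** The index played at place n stays visible in the position, so the tests for all conjuncts or
    disjuncts are merged into one that first reads this index. *)
Lemma codes_limit p n dec η (ψ : M -> formula M) : cut_compatible dec -> limit η -> η ∈ Ω ->
  (forall ζ, ζ ∈ η -> codes p (S n) (fun l => dec (firstn n l)) (ψ ζ) (raise ζ)) ->
  codes p n dec (big p η ψ) η.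
Proof.
intros Hd Hlim HηΩ Hcodes.
destruct (choice_on (fun _ _ => True) Hcodes) as [Lf HL].
(* The inverse of [raise] on η recovers the subformula from the level named by the move. *)
pose (src := fun τ => epsilon (inhabits empty) (fun ζ => ζ ∈ η /\ raise ζ = τ)).
assert (Hsrc : forall ζ, ζ ∈ η -> src (raise ζ) = ζ).
{ intros ζ Hz. apply raise_inj.
  apply (epsilon_spec (inhabits empty) (fun ζ' => ζ' ∈ η /\ raise ζ' = raise ζ)). eauto. }
exists (fun β l => Lf (src (c (nth n l empty))) β l).
intros α [Ha [Hw [Hic Hp]]] R h Hn Hh [β0 [Hb0 HA]]. rewrite params_in_big in Hp.
assert (Hl := regular_limit (proj1 Ha)).
assert (Hrec : forall ζ i, ζ ∈ η -> ζ ∈ repl c α -> i ∈ α -> c i = raise ζ ->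
  (pol p (rsat (repl c α) α e0 (dec h) (ψ ζ)) <-> game c α R (c i) (h ++ i :: nil))).
{ intros ζ i Hz HzX Hi Ei. assert (Hio := ordinal_in (proj1 Hl) Hi).
  rewrite Ei, <- (HL ζ Hz α (conj Ha (conj Hw (conj Hic (Hp ζ Hz HzX)))) R).
  - rewrite firstn_exact; auto. reflexivity.
  - rewrite length_app. simpl. lia.
  - apply in_app_sub; auto. intros x [<-|[]] w Hw'. apply ordinal_sub_V; [exact (proj1 Hl)|].
    exact (ordinal_trans (proj1 Hl) Hi Hw').
  (* The new bound exceeds both the old one and i, so that i survives the cut to V_β and the merged
     test selects the right subformula. *)
  - destruct (ordinal_max (proj1 Hl) Hb0 Hi) as [μ [Hm [H1 H2]]].
    exists (succ μ). split; [apply Hl; auto|].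
    intros β Hb Hlb Hmb l. rewrite <- app_assoc. cbn [app].
    assert (Hmb' : μ ∈ β) by exact (ordinal_trans (proj1 Hlb) Hmb (succ_self μ)).
    assert (Hsub : forall γ, ordinal γ -> γ ⊆ μ -> γ ∈ β).
    { intros γ Hg Hs. destruct (ordinal_sub Hg (ordinal_in (proj1 Hlb) Hmb') Hs) as [->|Hgm]; auto.
      exact (ordinal_trans (proj1 Hlb) Hmb' Hgm). }
    rewrite HA; auto; [|apply Hsub; auto; exact (ordinal_in (proj1 Hl) Hb0)].
    rewrite cutl_app. unfold cutl at 2 5. cbn [map].
    rewrite nth_exact; [|rewrite length_cutl; auto].
    rewrite cut_of_mem; [|exact (proj1 Hlb)|apply ordinal_sub_V; [exact (proj1 Hlb)|apply Hsub; auto]].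
    rewrite Ei, Hsrc; auto. reflexivity. }
transitivity (forall ζ, ζ ∈ η -> ζ ∈ repl c α -> pol p (rsat (repl c α) α e0 (dec h) (ψ ζ))).
{ destruct p; simpl; [tauto|]. split.
  - intros H ζ Hz HzX Hs. apply H. eauto.
  - intros H [ζ [Hz [HzX Hs]]]. exact (H ζ Hz HzX Hs). }
rewrite game_limit; auto. split.
- intros H i Hi Hci Hli He.
  assert (HiX : c i ∈ repl c α) by (apply replP; eauto).
  assert (Hex : exists ζ, ζ ∈ η /\ ζ ∈ repl c α /\ c i = raise ζ).
  { destruct (classic (c i ∈ omega M)) as [Ho|Ho].
    - destruct (omega_cases Ho He) as [ζ [Hz E]]. exists ζ. rewrite E in Hci, HiX.
      split; [exact (ordinal_trans (proj1 Hlim) Hci (succ_self ζ))|].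
      split; [exact (index_pred Hic HiX)|]. unfold raise.
      destruct (excluded_middle_informative (ζ ∈ omega M)); tauto.
    - exists (c i). split; auto. split; auto. unfold raise.
      destruct (excluded_middle_informative (c i ∈ omega M)); tauto. }
  destruct Hex as [ζ [Hz [HzX E]]]. apply (Hrec ζ i); auto.
- intros H ζ Hz HzX.
  assert (Hr : raise ζ ∈ η /\ raise ζ ∈ repl c α).
  { unfold raise. destruct (excluded_middle_informative (ζ ∈ omega M)); auto.
    assert (Hs : succ ζ ∈ η) by (apply Hlim; auto). split; auto.
    apply (index_succ Hic); auto. exact (ordinal_trans HΩ HηΩ Hs). }
  destruct Hr as [Hr1 Hr2]. apply replP in Hr2. destruct Hr2 as [j [Hj Ej]].
  destruct (@least_index_exists M α c j (proj1 Hl) Hj) as [i [Hi [Ei Hli]]].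
  assert (E : c i = raise ζ) by congruence.
  apply (Hrec ζ i Hz HzX Hi E). apply H; auto; rewrite E; auto. apply raise_lifts.
Qed.

Lemma is_PS_empty p φ : is_PS p κ empty φ -> exists ψ, φ = FO ψ.
Proof.
intro H. refine (@is_PS_ind M κ (fun p η φ => η = empty -> exists ψ, φ = FO ψ) _ _ _ p empty φ H eq_refl).
- intros q ψ _ _ _. eauto.
- intros q ζ ks ψ _ _ E. destruct (succ_not_empty E).
- intros q η ψ Hl _ _ _ ->. destruct (limit_not_empty Hl).
Qed.

Lemma codes_exist p η φ : is_PS p κ η φ -> η ∈ Ω -> forall η' n dec, lifts η η' ->
  cut_compatible dec -> codes p n dec φ η'.
Proof.
revert p η φ. apply (@is_PS_ind M κ (fun p η φ => η ∈ Ω -> forall η' n dec, lifts η η' ->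
  cut_compatible dec -> codes p n dec φ η')).
- intros p ψ _ _ _ η' n dec [He [->|[Ho _]]] Hd; [tauto|].
  apply in_omega in Ho. destruct Ho as [[|m] ->]; [simpl in He; tauto|]. apply codes_FO; auto.
- intros p ζ ks ψ Hψ IH HΩ' η' n dec [He Hlev] Hd.
  assert (HzΩ : ζ ∈ Ω) by exact (ordinal_trans HΩ HΩ' (succ_self ζ)).
  assert (Hz : exists ζ', η' = succ ζ' /\ ((ζ = empty /\ ζ' = empty) \/ lifts ζ ζ')).
  { destruct Hlev as [->|[Ho Hin]].
    - exists ζ. split; auto. destruct (classic (ζ = empty)); auto. right. split; auto.
    - destruct (omega_cases Ho He) as [ζ' [Ho' ->]]. exists ζ'. split; auto. right.
      assert (Hzz : ζ ∈ ζ').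
      { apply in_succ in Hin. destruct Hin as [Hin|<-]; [|apply succ_self].
        exact (ordinal_trans (ordinal_in ordinal_omega Ho') Hin (succ_self ζ)). }
      split; auto. intros ->. exact (emptyP Hzz). }
  destruct Hz as [ζ' [-> [[-> ->]|Hl]]].
  + destruct (is_PS_empty Hψ) as [χ ->]. apply codes_leaf; auto.
  + apply codes_succ; auto. apply IH; auto. apply cut_compatible_block; auto.
- intros p η ψ Hl Hψ IH _ HηΩ η' n dec [He Hlev] Hd.
  assert (E : η' = η).
  { destruct Hlev as [->|[Ho Hin]]; auto.
    assert (Hin' := ordinal_trans ordinal_omega Ho Hin).
    apply in_omega in Hin'. destruct Hin' as [m ->]. destruct (num_not_limit Hl). }
  subst η'. apply codes_limit; auto. intros ζ Hz. apply IH; auto.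
  + exact (ordinal_trans HΩ HηΩ Hz).
  + apply raise_lifts.
  + apply cut_compatible_firstn; auto.
Qed.

(** Tuples over limit stages decode uniquely, so for them the universal quantifier speaks of just
    one β and l. *)
Definition code_set (Lf : M -> list M -> Prop) : M :=
  sep (fun s => forall β l, limit β -> s = tuple (Vh β) l -> Lf β l) (Vh κ).

Lemma agrees_code_set Lf α h : limit α -> α ⊆ κ -> agrees α (code_set Lf ∩ Vh α) Lf h.
Proof.
intros Hl Hs. exists empty. split; [exact (limit_num_in 0 Hl)|].
intros β Hb Hlb _ l. assert (Hin := V_tuple_cut (h ++ l) Hl Hb).
unfold code_set. rewrite !sepP. split.
- intros [[_ H] _]. apply H; auto.
- intro H. split; auto. split; [exact (V_mono Hs Hin)|].
  intros γ l' Hg E. apply tuple_inj in E; auto. destruct E as [<- <-]. exact H.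
Qed.

End Codes.
End Coding.

(** * Indescribability as reflection of wins, and its definition *)

Section Main.
Context {M : ZFC}.
Implicit Types (x y z u v w X Y α β γ δ ζ η κ ξ Ω : M) (φ : formula M) (p : bool) (c : M -> M) (h l : list M).

(** The initial D carries a club: its cofinality in V_α restricts α. At ξ = 0 it also serves as the
    last move read by the leaf test. *)
Definition win c α ξ R D : Prop := cofinal (Vh α) D /\ game c α R ξ (D :: nil).

(** Indescribability tested only on the formulas expressing [win]. *)
Definition win_reflects c κ ξ (S : M) : Prop :=
  forall R D, R ⊆ Vh κ -> D ⊆ Vh κ -> win c κ ξ R D ->
    exists α, α ∈ S /\ α ∈ κ /\ regular α /\ win c α ξ (R ∩ Vh α) (D ∩ Vh α).

Lemma params_in_top p κ η φ X : is_PS p κ η φ -> params_in X κ φ.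
Proof.
revert p η φ. apply (@is_PS_ind M κ (fun p η φ => params_in X κ φ)).
- intros p φ H _. exact H.
- intros p ζ ks ψ _ IH. apply params_in_quants. exact IH.
- intros p ξ ψ _ _ IH _. apply params_in_big. auto.
Qed.

Lemma closure_stages_reflect κ α g : ordinal α -> cofinal (Vh α) (closure_stages κ g ∩ Vh α) -> closed g α.
Proof.
intros Ha H. apply (@closure_stages_accum M κ g α Ha). intros y Hy.
destruct (H y Hy) as [w [H1 [H2 H3]]]. apply sepP in H2. exists w. tauto.
Qed.

(** The collapsed enumeration maps a subset of α onto the collapsed level, which hence lies below
    α⁺. *)
Lemma collapse_below_card_succ κ α c η Ω : cardinal κ -> cardinal α -> α ∈ κ -> ordinal Ω ->
  (forall i, i ∈ α -> c i ∈ Ω) -> ordinal η ->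
  below_card_succ (collapse (repl c α) η) α.
Proof.
intros Hk Ha Hak HΩ Hc Hη.
destruct (card_succ_exists Hk Ha Hak) as [α' Hα']. exists α'. split; auto.
apply (@surjection_below_card_succ M α α' _ (fun j => collapse (repl c α) (c j))); auto.
- exact (proj1 Ha).
- apply ordinal_collapse; auto.
- intros y Hy. apply in_collapse in Hy. destruct Hy as [z [_ [Hz ->]]].
  apply replP in Hz. destruct Hz as [j [Hj ->]]. eauto.
Qed.

Section Characterization.
Variables (b : M -> M -> M -> M) (κ Ω ξ : M) (c : M -> M).
Hypothesis (Hb : canonical_bijections b) (Hκ : inaccessible κ) (Hω : omega M ∈ κ)
  (Hsucc : exists κ', is_card_succ κ κ') (HΩ : ordinal Ω) (Hc : covers κ c Ω) (Hξ : ξ ∈ Ω).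

Lemma Ω_nonempty : Ω <> empty.
Proof. intro E. rewrite E in Hξ. exact (emptyP Hξ). Qed.

Lemma Ω_below η : η ∈ Ω -> below_card_succ η κ.
Proof.
intro H. destruct Hsucc as [κ' Hκ']. exists κ'. split; auto.
apply (@surjection_below_card_succ M κ κ' η c); auto.
- exact (regular_ordinal (proj1 Hκ)).
- exact (ordinal_in HΩ H).
- intros y Hy. apply Hc. exact (ordinal_trans HΩ H Hy).
Qed.

Lemma Cl_index η : η ∈ Ω -> Cl κ (fun α => η ∈ repl c α).
Proof.
intro H. destruct (proj2 Hc η H) as [i [Hi Ei]].
eapply Cl_mono; [|exact (Cl_tail Hi)]. intros α _ _ Hia. apply replP. eauto.
Qed.

(** The first two clauses control restriction at α; the last two allow the characterization of
    indescribability to be applied at α itself. *)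
Definition nice α : Prop :=
  index_closed Ω (repl c α) /\ coherent b κ α (repl c α) /\ omega M ∈ α /\
  (regular α -> inaccessible α).

Lemma Cl_nice : Cl κ nice.
Proof.
assert (Hr := proj1 Hκ). unfold nice.
repeat (apply Cl_and; [exact Hr| |]).
- apply Cl_index_closed; auto. exact Ω_nonempty.
- apply (@Cl_coherent M b κ c Ω); auto. exact Ω_below.
- apply Cl_tail. exact Hω.
- apply Cl_inaccessible. exact Hκ.
Qed.

Lemma top_point : game_point κ Ω c κ.
Proof.
split; [exact (regular_limit (proj1 Hκ))|]. split; auto.
rewrite (covers_repl Hc). apply index_closed_full; auto. exact Ω_nonempty.
Qed.

Lemma nice_point α : nice α -> α ∈ κ -> regular α -> game_point κ Ω c α.
Proof.
intros Hn Ha Hr. split; [exact (regular_limit Hr)|]. split; [|apply Hn].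
exact (proj1 (regular_ordinal (proj1 Hκ)) α Ha).
Qed.

Lemma nice_models_restr α p η φ : nice α -> α ∈ κ -> regular α -> is_PS p κ η φ ->
  η ∈ repl c α -> params_in (repl c α) α φ ->
  (models_restr b κ α η φ <-> rsat (repl c α) α e0 e0 φ).
Proof.
intros Hn Ha Hr H HηX Hp.
apply (@models_restr_rsat M b κ α Ω (repl c α) (regular_limit (proj1 Hκ)) HΩ (proj1 Hn) (proj1 (proj2 Hn)) p); auto.
apply (@collapse_below_card_succ κ α c η Ω); auto.
- exact (proj1 (proj1 Hκ)).
- exact (proj1 Hr).
- intros i Hi. apply Hc. exact (ordinal_trans (regular_ordinal (proj1 Hκ)) Ha Hi).
- exact (is_PS_ordinal H).
Qed.

Lemma models_rsat p η φ : is_PS p κ η φ -> η ∈ Ω -> (models κ φ <-> rsat Ω κ e0 e0 φ).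
Proof.
intros H Hη. apply (@sat_rsat_top M κ Ω p η φ H (proj1 HΩ η Hη)).
Qed.

(** Indescribability is applied to a formula saying that D wins, with the cofinality of D and of E
    joined to every leaf. *)
Lemma indescribable_win_reflects (S : M) : indescribable b κ ξ S -> win_reflects c κ ξ S.
Proof.
intros [HS Hind] R D HR HD [Hcof Hgame].
assert (Hl := regular_limit (proj1 Hκ)). assert (Hko := proj1 Hl).
(* A function whose closure points are good restriction points; its stages become the parameter
   E. *)
destruct (Cl_and (proj1 Hκ) Cl_nice (Cl_index Hξ)) as [g [Hg Hnice]].
set (E := closure_stages κ g).
assert (HE : E ⊆ Vh κ) by apply closure_stages_sub.
pose (θ := And (cofinal_fo (Par2 D)) (cofinal_fo (Par2 E))).
pose (pars := R :: D :: E :: Vstages κ :: nil).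
assert (HVst : Vstages κ ⊆ Vh κ).
{ intros w Hw. apply replP in Hw. destruct Hw as [β [Hβ ->]]. apply sepP in Hβ. apply V_in. tauto. }
assert (Hθo : forall s : term M, not_var1 s -> fo_occurs θ s -> s = Par2 D \/ s = Par2 E).
{ intros s Hs [H|H]; apply occurs_cofinal in H; auto. }
destruct (@expresses_exists M κ Ω c true θ (Par2 R) 0 pars Hl HΩ Hc) with (η := ξ) (p := true) (n := 0)
  (l := @Par2 M D :: nil) as [φ [H1 [H2 [H3 [H4 [H5 H6]]]]]]; auto.
{ intros a Ha. apply Hθo in Ha; [|exact I]. destruct Ha; discriminate. }
{ intros k Ha. apply Hθo in Ha; [|exact I]. destruct Ha; discriminate. }
{ intros A Ha. apply Hθo in Ha; [|exact I]. unfold pars. simpl. destruct Ha as [[= ->]|[= ->]]; auto. }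
{ intros n [H|H]; revert H; apply free1_cofinal; exact I. }
{ exact I. }
{ discriminate. }
{ intros A [= ->]. left. reflexivity. }
{ intros A [<-|[<-|[<-|[<-|[]]]]]; assumption. }
{ simpl. auto. }
{ apply Forall_cons; [|apply Forall_nil]. split; [exact I|]. split; [discriminate|]. split; [discriminate|].
  intros A [= <-]. simpl. auto. }
assert (Hitem : forall α A, item α e0 (Par2 A) = A ∩ Vh α) by reflexivity.
assert (Hsatθ : forall α e2, limit α -> (fo_sat (Vh α) e0 e2 (cut_fo α θ) <->
   cofinal (Vh α) (D ∩ Vh α) /\ cofinal (Vh α) (E ∩ Vh α))).
{ intros α e2 Hla. unfold θ. cbn [cut_fo fo_sat]. rewrite !cut_cofinal.
  rewrite !sat_cofinal; try exact I. reflexivity. }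
destruct (Hind φ) as [α [HαS [Hαr [φ' [Hres [_ Hmod]]]]]].
- exact H1.
- split; auto. intros k Hk. apply H3 in Hk. lia.
- apply (models_rsat (p := true) H1 Hξ). rewrite <- (covers_repl Hc). apply H6; [exact top_point|].
  cbn [map]. rewrite !Hitem, !cut_of_sub; auto. split; [|exact Hgame].
  apply Hsatθ; auto. rewrite !cut_of_sub; auto. split; auto.
  apply closure_stages_cofinal; auto. exact (proj1 Hκ).
- assert (Hακ : α ∈ κ) by auto. assert (Hαl := regular_limit Hαr).
  (* Whether α is good is still open, so the restriction cannot yet be evaluated; only its leaves
     are used. They put α into the club, after which [restr_rsat] applies. *)
  assert (HcE : cofinal (Vh α) (E ∩ Vh α)).
  { apply (@leaves_restr M b κ α Ω (cofinal (Vh α) (E ∩ Vh α)) e0 ξ φ φ' Hb (proj1 Hκ) HΩ Ω_below Hακ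
      (limit_num_in 0 Hαl) Hres Hξ) with (e2 := e0); [|exact Hmod].
    eapply leaves_mono; [|exact H5]. intros ψ Hψ e2 Hs. destruct (Hψ eq_refl) as [->|[χ ->]].
    - apply Hsatθ in Hs; tauto.
    - destruct Hs as [Hs _]. apply Hsatθ in Hs; tauto. }
  assert (Hcl := closure_stages_reflect (proj1 Hαl) HcE).
  destruct (Hnice α Hακ Hαl Hcl) as [Hn HξX].
  exists α. split; auto. split; auto. split; auto.
  assert (Hrs := proj1 (restr_rsat HΩ (proj1 Hn) (proj1 (proj2 Hn)) Hres HξX (is_PS_level H1) e0 e0) Hmod).
  apply H6 in Hrs; [|apply nice_point; auto]. cbn [map] in Hrs. rewrite !Hitem in Hrs.
  destruct Hrs as [Hr1 Hr2]. apply Hsatθ in Hr1; auto. split; [tauto|exact Hr2].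
Qed.

(** The initial move D is free in the game, so it is chosen as the stages of a club on which
    restriction and coding are correct; reflecting the win then puts α into this club. *)
Lemma win_reflects_indescribable (S : M) : S ⊆ κ -> win_reflects c κ ξ S -> indescribable b κ ξ S.
Proof.
intros HS Hwin. split; auto. intros φ Hφ Hsent Hmod.
assert (Hl := regular_limit (proj1 Hκ)). assert (Hko := proj1 Hl).
apply (models_rsat (p := true) Hφ Hξ) in Hmod.
assert (Hcp : Cl κ (fun α => params_in (repl c α) α φ)).
{ apply (@Cl_params_in M κ c true ξ φ Hκ Hφ). intros y Hy. apply Hc. exact (ordinal_trans HΩ Hξ Hy). }
assert (Hbase := Cl_and (proj1 Hκ) (Cl_and (proj1 Hκ) Cl_nice (Cl_index Hξ)) Hcp).
(* It suffices to find a code [R] whose win is equivalent to the truth of [φ] on a club. *)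
assert (Hkey : exists R P, R ⊆ Vh κ /\ Cl κ P /\
  (forall D, D ⊆ Vh κ -> cofinal (Vh κ) D -> win c κ ξ R D) /\
  (forall α D, α ∈ κ -> regular α -> P α -> D ⊆ Vh α -> win c α ξ (R ∩ Vh α) D ->
     rsat (repl c α) α e0 e0 φ)).
{ destruct (classic (ξ = empty)) as [He|He].
  - assert (Hφ' := Hφ). rewrite He in Hφ'. destruct (@is_PS_empty M κ true φ Hφ') as [ψ ->].
    (* At level 0 no move is left to carry the club of a leaf test. With R = V_κ the test always
       succeeds, and the initial D alone takes α into the club where the first-order sentence
       reflects. *)
    exists (Vh κ), (fun α => fo_sat (Vh α) e0 e0 (cut_fo α ψ)). split; [auto|]. split; [|split].
    + eapply Cl_mono; [|apply (@Cl_reflection M κ ψ e0 Hκ)].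
      * simpl. intros α _ Hla H. specialize (H e0 (fun _ => V_empty_in Hla)).
        replace (fun k => e0 k ∩ Vh α) with (@e0 M) in H; [apply H; exact Hmod|].
        apply functional_extensionality. intro k. symmetry. apply cut_of_sub.
        intros w Hw. destruct (emptyP Hw).
      * apply (@params_in_top true κ ξ (FO ψ) Ω Hφ).
      * intros k w Hw. destruct (emptyP Hw).
    + intros D HD Hcof. split; auto. rewrite He, game_zero. split; [exact Hcof|].
      intros β Hβ Hlb _. apply V_tuple_cut; auto.
    + intros α D _ _ HP _ _. exact HP.
  (* The position already contains the initial D, so decoding starts at place 1; as the formula is a
     sentence, the starting assignment is constant. *)
  - destruct (@codes_exist M κ Ω c HΩ true ξ φ Hφ Hξ ξ 1 (fun _ => e0)) as [Lf HL].
    { split; auto. }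
    { intros β Hlb h k. symmetry. apply cut_of_sub. intros w Hw. destruct (emptyP Hw). }
    assert (HR : code_set κ Lf ⊆ Vh κ) by (intros w Hw; apply sepP in Hw; tauto).
    exists (code_set κ Lf), (fun α => nice α /\ params_in (repl c α) α φ). split; auto. split; [|split].
    + eapply Cl_mono; [|exact Hbase]. intros α _ _ [[Hn _] Hp]. auto.
    + intros D HD Hcof. split; auto. apply (HL κ); auto.
      * split; auto. split; auto. split; [exact (proj2 (proj2 top_point))|]. apply (@params_in_top true κ ξ φ); auto.
      * intros x [<-|[]]. exact HD.
      * rewrite <- (cut_of_sub HR). apply agrees_code_set; auto.
      * rewrite (covers_repl Hc). exact Hmod.
    + intros α D Ha Hr [Hn Hp] HD [_ Hgm]. apply (HL α) in Hgm; auto.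
      * split; [apply Hn; auto|]. split; [apply Hn|]. split; [apply Hn|exact Hp].
      * intros x [<-|[]]. exact HD.
      * apply agrees_code_set; [exact (regular_limit Hr)|exact (proj1 Hko α Ha)]. }
destruct Hkey as [R [P [HR [HP [Htop Hlow]]]]].
destruct (Cl_and (proj1 Hκ) Hbase HP) as [g [Hg Hgood]].
assert (HD := @closure_stages_sub M κ g).
destruct (Hwin R (closure_stages κ g) HR HD) as [α [HαS [Hακ [Hαr Hw]]]].
{ apply Htop; auto. apply closure_stages_cofinal; auto. exact (proj1 Hκ). }
exists α. split; auto. split; auto.
assert (Hαl := regular_limit Hαr).
assert (Hcl := closure_stages_reflect (proj1 Hαl) (proj1 Hw)).
destruct (Hgood α Hακ Hαl Hcl) as [[[Hn HξX] Hp] HPα].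
apply (@nice_models_restr α true ξ φ); auto.
apply (Hlow α _ Hακ Hαr HPα) in Hw; auto. apply cut_sub.
Qed.

Lemma indescribable_iff (S : M) : S ⊆ κ -> (indescribable b κ ξ S <-> win_reflects c κ ξ S).
Proof.
intro HS. split; [apply indescribable_win_reflects|apply win_reflects_indescribable; auto].
Qed.

End Characterization.

(** * Collapsing the indices *)

Section Transfer.
Variables (α Ω : M) (c : M -> M).
Hypothesis (Hα : ordinal α) (HΩ : ordinal Ω) (HX : index_closed Ω (repl c α)).
Let X := repl c α.
Let c' i := collapse X (c i).

(** The game consults c only through zero, membership in a level and equality of values, and
    collapsing X preserves all of these. The stage β may be smaller than α, since wins at β < α are
    compared too. *)
Lemma game_collapse β R η : β ⊆ α -> ordinal β -> η ∈ X ->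
  forall h, game c β R η h <-> game c' β R (collapse X η) h.
Proof.
intros Hβ Hβo. induction (foundation η) as [η _ IH]. intros Hη h.
assert (Ho : forall τ, τ ∈ X -> ordinal τ) by (intros τ; apply (index_ordinal HΩ HX)).
destruct (ordinal_cases (Ho η Hη)) as [->|[[ζ [_ ->]]|Hlim]].
- rewrite collapse_empty, !game_zero. reflexivity.
- assert (Hz := index_pred HX Hη). rewrite collapse_succ, !game_succ; auto.
  split; intros H B D HB HD; specialize (H B D HB HD); [rewrite <- (IH ζ)|rewrite (IH ζ)]; auto using succ_self.
- rewrite !game_limit; auto; [|apply (collapse_limit HΩ HX); auto].
  assert (Hin : forall i, i ∈ α -> c i ∈ X) by (intros i Hi; apply replP; eauto).
  assert (Hli : forall i, i ∈ β -> (least_index c i <-> least_index c' i)).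
  { intros i Hi. split; intros H j Hj E; apply (H j Hj).
    - assert (Hjb : j ∈ β) by exact (ordinal_trans Hβo Hi Hj). apply collapse_inj in E; auto.
    - unfold c'. congruence. }
  assert (Hne : forall i, i ∈ α -> (c i <> empty <-> c' i <> empty)).
  { intros i Hi. split; intros H E; apply H.
    - apply (@collapse_inj M X); auto; [apply ordinal_empty|exact (index_empty HX)|].
      rewrite collapse_empty. exact E.
    - unfold c'. rewrite E. apply collapse_empty. }
  assert (Hm : forall i, i ∈ α -> (c' i ∈ collapse X η <-> c i ∈ η)).
  { intros i Hi. apply collapse_mem_iff; auto. }
  split; intros H i Hi.
  + rewrite (Hm i), <- (Hli i), <- (Hne i); auto. intros H1 H2 H3. apply (IH (c i)); auto.
  + rewrite <- (Hm i), (Hli i), (Hne i); auto. intros H1 H2 H3. apply (IH (c i)); auto.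
    * apply Hm; auto.
    * exact (H i Hi H1 H2 H3).
Qed.

Lemma win_reflects_collapse ξ (S : M) : ξ ∈ X ->
  (win_reflects c' α (collapse X ξ) S <-> win_reflects c α ξ S).
Proof.
intro Hξ.
assert (Hw : forall β R D, β ⊆ α -> ordinal β -> (win c' β (collapse X ξ) R D <-> win c β ξ R D)).
{ intros β R D Hβ Ho. unfold win. rewrite <- game_collapse; auto. reflexivity. }
unfold win_reflects. split; intros H R D HR HD H0;
  (destruct (H R D HR HD) as [β [H1 [H2 [H3 H4]]]]; [apply Hw; auto|]);
  exists β; split; auto; split; auto; split; auto; apply Hw; auto;
  try exact (proj1 Hα β H2); exact (ordinal_in Hα H2).
Qed.

End Transfer.

(** The two new ordinals ξ and ξ+1 get their own indices, and the given enumeration of ξ is moved to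
    successor indices. *)
Lemma covers_succ_succ (b : M -> M -> M -> M) κ ξ : canonical_bijections b -> inaccessible κ -> omega M ∈ κ ->
  below_card_succ ξ κ -> ordinal ξ -> exists c, covers κ c (succ (succ ξ)).
Proof.
intros Hb Hκ Hω Hbelow Hξ. assert (Hl := regular_limit (proj1 Hκ)).
assert (Hf : exists f : M -> M, forall y, y ∈ ξ -> exists i, i ∈ κ /\ f i = y).
{ destruct (classic (ξ ∈ κ)) as [Hin|Hn].
  - exists (fun i => i). intros y Hy. exists y. split; auto. exact (ordinal_trans (proj1 Hl) Hin Hy).
  - exists (b κ ξ). apply (proj1 Hb κ ξ (proj1 Hκ)); auto. apply ordinal_not_in; auto. exact (proj1 Hl). }
destruct Hf as [f Hf].
pose (Q := fun i y => exists j, i = succ j /\ y = f j /\ y ∈ ξ).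
(* Index 0 goes to ξ and index j+1 to [f j] when this lies in ξ; all other indices go to ξ+1. The
   limit ω, which lies in κ, is one of the latter. *)
exists (fun i => if excluded_middle_informative (i = empty) then ξ
  else if excluded_middle_informative (exists y, Q i y) then epsilon (inhabits empty) (Q i) else succ ξ).
split.
- intros i _. rewrite !in_succ.
  destruct (excluded_middle_informative (i = empty)); auto.
  destruct (excluded_middle_informative (exists y, Q i y)) as [H|H]; auto.
  apply (epsilon_spec (inhabits empty)) in H. destruct H as [j [_ [_ H]]]. auto.
- intros y Hy. rewrite !in_succ in Hy. destruct Hy as [[Hy| ->]| ->].
  + destruct (Hf y Hy) as [j [Hj Ej]]. exists (succ j). split; [apply Hl; auto|].
    destruct (excluded_middle_informative (succ j = empty)) as [E|_]; [destruct (succ_not_empty E)|].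
    assert (HQ : exists y, Q (succ j) y) by (exists y, j; auto).
    destruct (excluded_middle_informative (exists y, Q (succ j) y)) as [H|H]; [|contradiction].
    apply (epsilon_spec (inhabits empty)) in H. destruct H as [j' [E [-> _]]].
    apply succ_inj in E. subst j'. exact Ej.
  + exists empty. split; [exact (limit_num_in 0 Hl)|].
    destruct (excluded_middle_informative (@empty M = empty)); tauto.
  + exists (omega M). split; auto.
    destruct (excluded_middle_informative (omega M = empty)) as [E|_].
    * destruct (@emptyP M empty). rewrite <- E at 2. apply in_omega. exists 0. reflexivity.
    * destruct (excluded_middle_informative (exists y, Q (omega M) y)) as [[y [j [E _]]]|H]; auto.
      assert (Hj : j ∈ omega M) by (rewrite E; apply succ_self).
      assert (Hs := in_omega_succ Hj). rewrite <- E in Hs. destruct (mem_irrefl Hs).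
Qed.

(** * The defining formula *)

Section DefiningFormula.
Variables (κ Ω ξ : M) (c : M -> M).
Hypothesis (Hκ : limit κ) (HΩ : ordinal Ω) (Hc : covers κ c Ω) (Hξ : ξ ∈ Ω).

(** Both β and V_β are recorded: β is compared with S, and V_β determines the traces of R and D. *)
Definition win_codes : M := sep (fun s => exists β R D, β ∈ κ /\ regular β /\ win c β ξ R D /\
  s = tuple (opair β (Vh β)) (R :: D :: nil)) (Vh κ).

(* The second-order variables 0, 1 and 2 stand for [S], [R] and [D]. *)
Definition reflected_fo : fo M :=
  Or (Not (cofinal_fo (Var2 M 2))) (hit_fo (Var2 M 0) (Par2 win_codes) (Var2 M 1 :: Var2 M 2 :: nil)).

Lemma sat_reflected α e2 (S : M) : limit α -> α ⊆ κ -> S ⊆ κ -> e2 0 = S ∩ Vh α ->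
  (fo_sat (Vh α) e0 e2 (cut_fo α reflected_fo) <->
   (cofinal (Vh α) (e2 2) -> exists β, β ∈ S /\ β ∈ α /\ regular β /\
      win c β ξ (e2 1 ∩ Vh β) (e2 2 ∩ Vh β))).
Proof.
intros Hl Hs HS E0. unfold reflected_fo.
change (cut_fo α (Or ?a ?b')) with (Or (cut_fo α a) (cut_fo α b')).
rewrite cut_hit. cbn [cut_fo]. rewrite cut_cofinal, sat_Or. cbn [fo_sat].
rewrite sat_cofinal; [|exact I].
rewrite (sat_hit e2 Hl); [|repeat constructor|exact I|exact I].
unfold value. cbn. rewrite E0.
assert (Hiff : (exists β v, β ∈ Vh α /\ v ∈ Vh α /\ β ∈ S ∩ Vh α /\
    opair (e2 2 ∩ v) (opair (e2 1 ∩ v) (opair β v)) ∈ win_codes ∩ Vh α) <->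
  (exists β, β ∈ S /\ β ∈ α /\ regular β /\ win c β ξ (e2 1 ∩ Vh β) (e2 2 ∩ Vh β))).
{ split.
  - intros [β [v [Hβ [Hv [HβS Hin]]]]]. apply sepP in HβS, Hin. destruct HβS as [HβS _]. destruct Hin as [Hin _].
    apply sepP in Hin. destruct Hin as [_ [β' [R [D [H1 [H2 [H3 E]]]]]]]. cbn in E.
    apply opair_inj in E. destruct E as [E1 E]. apply opair_inj in E. destruct E as [E2 E].
    apply opair_inj in E. destruct E as [<- ->]. subst R D.
    exists β. split; auto. split; [|auto]. apply (ordinal_in_V (proj1 Hl)); auto. exact (regular_ordinal H2).
  - intros [β [H1 [H2 [H3 H4]]]].
    assert (HβV : β ∈ Vh α) by (apply ordinal_sub_V; auto; exact (proj1 Hl)).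
    assert (HVβ : Vh β ∈ Vh α) by (apply V_in; auto).
    exists β, (Vh β). rewrite !sepP.
    assert (Hin : opair (e2 2 ∩ Vh β) (opair (e2 1 ∩ Vh β) (opair β (Vh β))) ∈ Vh α).
    { rewrite !V_opair; auto. split; [exact (V_sub HVβ (@cut_sub M _ _))|].
      split; [exact (V_sub HVβ (@cut_sub M _ _))|auto]. }
    split; [exact HβV|]. split; [exact HVβ|]. split; [split; assumption|]. split; [|exact Hin].
    apply sepP. split; [exact (V_mono Hs Hin)|].
    exists β, (e2 1 ∩ Vh β), (e2 2 ∩ Vh β). auto. }
rewrite Hiff. destruct (classic (cofinal (Vh α) (e2 2))); tauto.
Qed.

(** A win is the cofinality of D together with the game. The implication from a win to its
    reflection is thus the negated game or [reflected_fo], which is of Σ type at level ξ;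
    quantifying R and D universally adds one level. *)
Lemma defining_formula : exists Φ, is_Pi κ (succ ξ) Φ /\ (forall n, ~ free1 Φ n) /\
  (forall k, free2 Φ k -> k = 0) /\
  forall α (S : M), game_point κ Ω c α -> S ⊆ κ ->
    (rsat (repl c α) α e0 (upd e0 0 (S ∩ Vh α)) Φ <-> win_reflects c α ξ (S ∩ α)).
Proof.
pose (pars := win_codes :: Vstages κ :: nil).
assert (HVst : Vstages κ ⊆ Vh κ).
{ intros w Hw. apply replP in Hw. destruct Hw as [β [Hβ ->]]. apply sepP in Hβ. apply V_in. tauto. }
assert (Hocc : forall s : term M, not_var1 s -> fo_occurs reflected_fo s ->
  s = Var2 M 2 \/ s = Var2 M 0 \/ s = Par2 win_codes \/ s = Var2 M 1).
{ intros s Hs [H|H].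
  - apply occurs_cofinal in H; auto.
  - apply occurs_hit in H; auto. simpl in H. intuition. }
destruct (@expresses_exists M κ Ω c false reflected_fo (Var2 M 1) 3 pars Hκ HΩ Hc) with (η := ξ) (p := false)
  (n := 3) (l := Var2 M 2 :: nil) as [ψ [H1 [H2 [H3 [_ [_ H6]]]]]]; auto.
{ intros a Ha. apply Hocc in Ha; [|exact I]. intuition discriminate. }
{ intros k Ha. apply Hocc in Ha; [|exact I].
  destruct Ha as [[= ->]|[[= ->]|[Ha|[= ->]]]]; try discriminate; lia. }
{ intros A Ha. apply Hocc in Ha; [|exact I].
  destruct Ha as [Ha|[Ha|[[= ->]|Ha]]]; try discriminate. left. reflexivity. }
{ intros n [H|H]; revert H.
  - apply free1_cofinal. exact I.
  - apply free1_hit; [repeat constructor|exact I|exact I]. }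
{ exact I. }
{ intros k [= <-]. lia. }
{ discriminate. }
{ intros A [<-|[<-|[]]]; [|assumption]. intros w Hw. apply sepP in Hw. tauto. }
{ simpl. auto. }
{ apply Forall_cons; [|apply Forall_nil]. split; [exact I|]. split; [intros k [= <-]; lia|]. split; discriminate. }
exists (quants true (1 :: 2 :: nil) ψ). split; [|split; [|split]].
- apply (@is_PS_succ M true κ ξ). exact H1.
- intros n. rewrite free1_quants. apply H2.
- intros k. rewrite free2_quants. intros [Hk Hf]. apply H3 in Hf. simpl in Hk. lia.
- intros α S Hp HS. destruct Hp as [Hl [Hs Hic]]. assert (Hp : game_point κ Ω c α) by (split; auto).
  refine (iff_trans (@pol_quants M (repl c α) α e0 true (1 :: 2 :: nil) ψ _) _).
  assert (Hrec : forall f, pol true (rsat (repl c α) α e0 (overlay (upd e0 0 (S ∩ Vh α)) (1 :: 2 :: nil) f) ψ) <->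
    (win c α ξ (f 1) (f 2) -> exists β, β ∈ S /\ β ∈ α /\ regular β /\
      win c β ξ (f 1 ∩ Vh β) (f 2 ∩ Vh β))).
  { intro f. cbn [pol]. rewrite H6; auto. cbn [op pol].
    rewrite (@sat_reflected α _ S); auto. cbn. unfold win at 2.
    change (item α (overlay (upd e0 0 (S ∩ Vh α)) (1 :: 2 :: nil) f) (Var2 M 1)) with (f 1).
    change (item α (overlay (upd e0 0 (S ∩ Vh α)) (1 :: 2 :: nil) f) (Var2 M 2)) with (f 2).
    destruct (classic (game c α (f 1) ξ (f 2 :: nil))); tauto. }
  split.
  + intros H R D HR HD Hw.
    specialize (H (fun k => if Nat.eqb k 1 then R else D)). rewrite Hrec in H. cbn in H.
    destruct H as [β [B1 [B2 [B3 B4]]]]; auto.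
    * intros k. destruct (Nat.eqb k 1); assumption.
    * exists β. rewrite sepP. auto.
  + intros H f Hf. apply Hrec. intro Hw.
    destruct (H (f 1) (f 2) (Hf 1) (Hf 2) Hw) as [β [B1 B2]]. apply sepP in B1. exists β. tauto.
Qed.

End DefiningFormula.
End Main.

Theorem theorem5p9 (M : ZFC) (b : M -> M -> M -> M) (κ ξ : M)
  (hb : canonical_bijections b)
  (hκ : inaccessible κ) (hω : mem (omega M) κ)
  (hξ : below_card_succ ξ κ) :
  exists (Φ : formula M) (z : nat) (C : M),
    is_Pi κ (succ ξ) Φ /\
    (forall n, ~ free1 Φ n) /\ (forall k, free2 Φ k -> k = z) /\
    club C κ /\
    forall S : M, (forall x, mem x S -> mem x κ) ->
      (indescribable b κ ξ S <-> models κ (subst2 z S Φ)) /\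
      (forall α : M, mem α C -> regular α ->
         (indescribable b α (fcan b κ ξ α) (sep (fun x => mem x α) S) <->
          models_restr b κ α (succ ξ) (subst2 z S Φ))).
Proof.
assert (Hr := proj1 hκ). assert (Hl := regular_limit Hr).
assert (H := hξ). destruct H as [κ' [Hκ' Hξκ']].
assert (Hξo : ordinal ξ) by exact (ordinal_in (proj1 (proj1 Hκ')) Hξκ').
destruct (covers_succ_succ hb hκ hω hξ Hξo) as [c Hc].
set (Ω := succ (succ ξ)) in *.
assert (HΩ : ordinal Ω) by (repeat apply ordinal_succ; auto).
assert (HξΩ : ξ ∈ Ω) by (unfold Ω; rewrite !in_succ; auto).
assert (HsΩ : succ ξ ∈ Ω) by apply succ_self.
assert (Hsucc : exists κ', is_card_succ κ κ') by eauto.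
destruct (@defining_formula M κ Ω ξ c Hl HΩ Hc HξΩ) as [Φ [H1 [H2 [H3 H4]]]].
assert (Hcp : Cl κ (fun α => params_in (repl c α) α Φ)).
{ apply (@Cl_params_in M κ c true (succ ξ) Φ hκ H1). intros y Hy. apply Hc.
  exact (ordinal_trans HΩ HsΩ Hy). }
destruct (Cl_club Hr hω (Cl_and Hr (Cl_and Hr (Cl_nice hb hκ hω Hsucc HΩ Hc HξΩ) (Cl_index Hc HξΩ))
  (Cl_and Hr (Cl_index Hc HsΩ) Hcp))) as [C [HC HCP]].
exists Φ, 0, C. split; auto. split; auto. split; auto. split; auto.
intros S HS.
assert (HSV : forall w, w ∈ S -> w ∈ Vh κ).
{ intros w Hw. apply ordinal_sub_V; auto. exact (proj1 Hl). }
assert (HΦS : is_PS true κ (succ ξ) (subst2 0 S Φ)) by (apply is_PS_subst; auto).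
split.
- rewrite (indescribable_iff hb hκ hω Hsucc HΩ Hc HξΩ HS).
  rewrite (models_rsat HΩ HΦS HsΩ), rsat_subst.
  rewrite <- (covers_repl Hc), H4; auto; [|exact (top_point hκ HΩ Hc HξΩ)].
  rewrite (cut_of_sub HS). reflexivity.
- intros α Hα Hαr. destruct (HCP α Hα) as [Hακ [[Hn HξX] [HsX Hp]]].
  assert (Hαo := regular_ordinal Hαr). assert (HX := proj1 Hn).
  rewrite (nice_models_restr hκ HΩ Hc Hn Hακ Hαr HΦS HsX (params_in_subst 0 S Hp)), rsat_subst.
  rewrite H4; auto; [|apply (nice_point hκ Hn Hακ Hαr)].
  rewrite <- (win_reflects_collapse Hαo HΩ HX _ HξX).
  rewrite (fcan_collapse HΩ HX (proj1 (proj2 Hn)) HξX).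
  (* The characterization is used a second time, with α for κ, the order type of c[α] for Ω and the
     collapsed enumeration for c. It holds for any enumeration, so the bijections fixed for α need
     not be related to those for κ. *)
  apply (@indescribable_iff M b α (ot (repl c α))); auto.
  + apply Hn. exact Hαr.
  + apply Hn.
  + exact (card_succ_exists (proj1 Hr) (proj1 Hαr) Hακ).
  + apply ordinal_ot. intros x Hx. exact (index_ordinal HΩ HX Hx).
  + split.
    * intros i Hi. apply in_ot. exists (c i). split; auto. apply replP. eauto.
    * intros y Hy. apply in_ot in Hy. destruct Hy as [x [Hx ->]]. apply replP in Hx.
      destruct Hx as [i [Hi ->]]. eauto.
  + apply in_ot. eauto.
  + intros w Hw. apply sepP in Hw. tauto.
Qed.
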